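(* Let $n\ge 2$ be an integer, let $\lambda,\mu\in\mathbb{R}$ satisfy $\lambda+2\mu>0$, $\mu>0$ and $\lambda+\mu\neq 0$, let $(f_0,f_1)\in\{H^1(\mathbb{R}^n)\cap L^1(\mathbb{R}^n)\}^n\times\{L^2(\mathbb{R}^n)\cap L^1(\mathbb{R}^n)\}^n$, and let $u={}^T(u_1,\dots,u_n)$ be the solution of $$\partial_t^2u-\mu\Delta u-(\lambda+\mu)\nabla(\operatorname{div}u)=0\ (t>0,\ x\in\mathbb{R}^n),\qquad u(0,x)=f_0(x),\quad \partial_tu(0,x)=f_1(x)\ (x\in\mathbb{R}^n).$$ (i) When $n=2$, if there exists $k_0\in\{1,2\}$ such that $m_{1k_0}\neq 0$, then $$C|m_{1k_0}|\sqrt{\log(t+2)}\le\|u_j(t)\|_{L^2}\le\|u(t)\|_2\le C\big(\|f_0\|_2+\|f_1\|_1\sqrt{\log(t+2)}+\|f_1\|_2\big)$$ for all $j\in\{1,2\}$ and $t\gg1$. (ii) When $n\ge 3$, if there exist $j_0\in\{0,1\}$ and $k_0\in\{1,\dots,n\}$ such that $m_{j_0k_0}\neq 0$, then $$C|m_{j_0k_0}|\le\|u_j(t)\|_{L^2}\le\|u(t)\|_2\le C\big(\|f_0\|_2+\|f_1\|_1+\|f_1\|_2\big)$$ for all $j\in\{1,\dots,n\}$ and $t\gg1$.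
   Context: All functions are real valued; $f_j={}^T(f_{j1},\dots,f_{jn})$ for $j=0,1$. For $p\in\{1,2\}$ and a vector function $f={}^T(f_1,\dots,f_n)$, $\|f\|_p:=\sum_{k=1}^n\|f_k\|_{L^p(\mathbb{R}^n)}$. Moments: $m_{jk}:=\int_{\mathbb{R}^n}f_{jk}(x)\,dx$. $C$ denotes a generic positive constant, which may differ between occurrences, and ''$t\gg1$'' means for all sufficiently large $t$. The solution is the one given in Fourier space by $$\hat u(t,\xi)=\cos(t\alpha_1|\xi|)P\hat f_0+\frac{\sin(t\alpha_1|\xi|)}{\alpha_1|\xi|}P\hat f_1+\cos(t\alpha_2|\xi|)(I-P)\hat f_0+\frac{\sin(t\alpha_2|\xi|)}{\alpha_2|\xi|}(I-P)\hat f_1,$$ where $\alpha_1=\sqrt{\lambda+2\mu}$, $\alpha_2=\sqrt{\mu}$, $P=\frac{\xi}{|\xi|}\otimes\frac{\xi}{|\xi|}$, and $I$ is the $n\times n$ identity matrix.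
   Formalization: In (ii) the constant C of the lower bound may depend on the initial data (not on t or j), since a data-independent one fails for f_0=0, f_1(x)=e^n φ(ex), e→0; all other constants depend only on n, λ, μ. *)

(* Defs.v *)
From HB Require Import structures.
From mathcomp Require Import all_boot all_order all_algebra.
From mathcomp Require Import all_classical all_reals all_analysis.
From mathcomp Require Import complex.

Set Implicit Arguments.
Unset Strict Implicit.
Unset Printing Implicit Defensive.

Import Order.TTheory GRing.Theory Num.Theory.
Import numFieldNormedType.Exports.

Local Open Scope classical_set_scope.
Local Open Scope ring_scope.

Definition measure_rV_display : measure_display -> measure_display.
Proof. exact. Qed.

(* Product sigma-algebra on row vectors, as the library does for tuples. *)
Section measurable_rV.
Context {d} {T : sigmaRingType d}.
Variable n : nat.

Definition rV_coor (i : 'I_n) (x : 'rV[T]_n) : T := x ord0 i.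

Let rV_set0 : g_sigma_preimage rV_coor set0.
Proof. exact: sigma_algebra0. Qed.

Let rV_setC A : g_sigma_preimage rV_coor A -> g_sigma_preimage rV_coor (~` A).
Proof. exact: sigma_algebraC. Qed.

Let rV_bigcup (F : _^nat) : (forall i, g_sigma_preimage rV_coor (F i)) ->
  g_sigma_preimage rV_coor (\bigcup_i (F i)).
Proof. exact: sigma_algebra_bigcup. Qed.

HB.instance Definition _ := @isMeasurable.Build (measure_rV_display d)
  'rV[T]_n (g_sigma_preimage rV_coor) rV_set0 rV_setC rV_bigcup.

End measurable_rV.

Lemma measurable_rV_coor d (T : sigmaRingType d) n (i : 'I_n) :
  measurable_fun [set: 'rV[T]_n] (fun x : 'rV[T]_n => x ord0 i).
Proof.
move=> _ Y mY; rewrite setTI; apply: sub_sigma_algebra => /=.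
rewrite -bigcup_seq/=; exists i => /=; first by rewrite mem_index_enum.
by exists Y => //; rewrite setTI.
Qed.

Lemma measurable_fun_rVP d1 d2 (T1 : measurableType d1)
    (T2 : measurableType d2) n (f : T1 -> 'rV[T2]_n) :
  measurable_fun [set: T1] f <->
  forall i, measurable_fun [set: T1] (fun x => f x ord0 i).
Proof.
split=> [mf i|mf].
  exact: (measurableT_comp (measurable_rV_coor i) mf).
move=> _; have sA : sigma_algebra [set: 'rV[T2]_n]
    [set A : set 'rV[T2]_n | measurable (f @^-1` A)].
  split=> /=.
  - by rewrite preimage_set0; exact: measurable0.
  - by move=> A mA; rewrite setTD preimage_setC; exact: measurableC.
  - by move=> F mF; rewrite preimage_bigcup; exact: bigcupT_measurable.
move=> A mA; rewrite setTI; move: A mA; apply: smallest_sub => //.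
rewrite -bigcup_seq; apply: bigcup_sub => i _ A [B mB <-] /=.
by rewrite setTI; have := mf i measurableT _ mB; rewrite setTI.
Qed.

Section rV_lebesgue_step.
Context {R : realType} {n : nat}.

Definition rV_cons (p : measurableTypeR R * 'rV[R]_n) : 'rV[R]_n.+1 :=
  row_mx (p.1 : R)%:M p.2.

Definition rV_uncons (x : 'rV[R]_n.+1) : measurableTypeR R * 'rV[R]_n :=
  (x ord0 ord0, \row_i x ord0 (lift ord0 i)).

Lemma rV_cons0 p : rV_cons p ord0 ord0 = p.1.
Proof.
rewrite (_ : ord0 = lshift n (ord0 : 'I_1)); last exact/val_inj.
by apply: etrans (row_mxEl _ _ _ _) _; rewrite mxE eqxx.
Qed.

Lemma rV_consS p i : rV_cons p ord0 (lift ord0 i) = p.2 ord0 i.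
Proof.
rewrite (_ : lift ord0 i = rshift 1 i); last exact/val_inj.
exact: row_mxEr.
Qed.

Lemma rV_consK : cancel rV_cons rV_uncons.
Proof.
move=> [x y]; rewrite /rV_uncons rV_cons0; congr pair.
by apply/rowP => i; rewrite mxE rV_consS.
Qed.

Lemma rV_unconsK : cancel rV_uncons rV_cons.
Proof.
move=> x; apply/rowP => i; case: (unliftP ord0 i) => [j|] ->.
  by rewrite rV_consS mxE.
by rewrite rV_cons0.
Qed.

Lemma measurable_rV_cons : measurable_fun setT rV_cons.
Proof.
apply/measurable_fun_rVP => i; case: (unliftP ord0 i) => [j|] ->.
  under eq_fun do rewrite rV_consS.
  exact: (measurableT_comp (measurable_rV_coor j) measurable_snd).
under eq_fun do rewrite rV_cons0.
exact: measurable_fst.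
Qed.

Lemma measurable_rV_uncons : measurable_fun setT rV_uncons.
Proof.
apply/measurable_fun_pairP; split.
  exact: measurable_rV_coor.
apply/measurable_fun_rVP => i /=.
under eq_fun do rewrite mxE.
exact: measurable_rV_coor.
Qed.

Variable nu : {sigma_finite_measure set 'rV[R]_n -> \bar R}.

Definition rV_lebesgue_succ : set 'rV[R]_n.+1 -> \bar R :=
  pushforward (lebesgue_measure \x nu)%E rV_cons.

Let succ0 : rV_lebesgue_succ set0 = 0%E.
Proof. by rewrite /rV_lebesgue_succ /pushforward preimage_set0 measure0. Qed.

Let succ_ge0 A : (0 <= rV_lebesgue_succ A)%E.
Proof. by rewrite /rV_lebesgue_succ /pushforward; exact: measure_ge0. Qed.

Let succ_sigma_additive : semi_sigma_additive rV_lebesgue_succ.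
Proof.
move=> F mF tF mUF; rewrite /rV_lebesgue_succ /pushforward preimage_bigcup.
have mcons A : measurable A -> measurable (rV_cons @^-1` A).
  by move=> mA; rewrite -[X in measurable X]setTI; exact: measurable_rV_cons.
apply: measure_semi_sigma_additive => [k||]; first exact: mcons.
- apply/trivIsetP => /= i j _ _ ij; rewrite -preimage_setI.
  by move/trivIsetP : tF => /(_ _ _ _ _ ij) ->//; rewrite preimage_set0.
- by rewrite -preimage_bigcup; exact: mcons.
Qed.

HB.instance Definition _ := isMeasure.Build _ _ _ rV_lebesgue_succ
  succ0 succ_ge0 succ_sigma_additive.

Let succ_sigma_finite : sigma_finite setT rV_lebesgue_succ.
Proof.
have /sigma_finiteP[F [FT ndF Foo]] := sigma_finiteT (@lebesgue_measure R).
have /sigma_finiteP[G [GT ndG Goo]] := sigma_finiteT nu.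
exists (fun k => rV_uncons @^-1` (F k `*` G k)).
  rewrite -preimage_bigcup; apply/esym; rewrite -subTset => x _ /=.
  have [k _ Fk] : (\bigcup_k F k) (rV_uncons x).1 by rewrite -FT.
  have [l _ Gl] : (\bigcup_k G k) (rV_uncons x).2 by rewrite -GT.
  exists (maxn k l) => //; split.
    by move: Fk; exact/subsetPset/ndF/leq_maxl.
  by move: Gl; exact/subsetPset/ndG/leq_maxr.
move=> k; have [mF Fk] := Foo k; have [mG Gk] := Goo k.
have mFG : measurable (F k `*` G k) by exact: measurableX.
split.
  by rewrite -[X in measurable X]setTI; exact: measurable_rV_uncons.
rewrite /rV_lebesgue_succ /pushforward -comp_preimage.
rewrite (_ : rV_uncons \o rV_cons = id); last first.
  by apply/funext => p; exact: rV_consK.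
by rewrite /= product_measure1E// lte_mul_pinfty// ge0_fin_numE.
Qed.

HB.instance Definition _ := Measure_isSigmaFinite.Build _ _ _ rV_lebesgue_succ
  succ_sigma_finite.

End rV_lebesgue_step.

Fixpoint rV_lebesgue {R : realType} (n : nat) :
    {sigma_finite_measure set 'rV[R]_n -> \bar R} :=
  if n is m.+1 then rV_lebesgue_succ (rV_lebesgue m)
  else \d_(0 : 'rV[R]_0).

Lemma rV_lebesgue_box (R : realType) n (a b : 'rV[R]_n) :
  (forall i, a ord0 i <= b ord0 i) ->
  rV_lebesgue n [set x : 'rV[R]_n | forall i, x ord0 i \in `[a ord0 i, b ord0 i]]
  = (\prod_(i < n) (b ord0 i - a ord0 i))%:E.
Proof.
elim: n a b => [|n IH] a b ab.
  rewrite big_ord0 /= (_ : [set x | _] = setT) ?diracT//.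
  by apply/seteqP; split=> // x _ [].
rewrite big_ord_recl EFinM /= /rV_lebesgue_succ /pushforward.
pose a' : 'rV[R]_n := \row_i a ord0 (lift ord0 i).
pose b' : 'rV[R]_n := \row_i b ord0 (lift ord0 i).
pose B : set 'rV[R]_n :=
  [set x | forall i, x ord0 i \in `[a' ord0 i, b' ord0 i]].
have mB : measurable B.
  rewrite (_ : B = \big[setI/setT]_(i < n)
    ((fun x : 'rV[R]_n => x ord0 i) @^-1` `[a' ord0 i, b' ord0 i])).
    apply: bigsetI_measurable => i _; rewrite -[X in measurable X]setTI.
    exact: (measurable_rV_coor i measurableT (measurable_itv _)).
  rewrite -bigcap_seq; apply/seteqP; split=> x /=.
    by move=> Bx i _; exact: Bx.
  by move=> Bx i; apply: Bx => /=; rewrite mem_index_enum.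
rewrite (_ : _ @^-1` _ = [set` `[a ord0 ord0, b ord0 ord0]] `*` B).
  have mI : measurable ([set` `[a ord0 ord0, b ord0 ord0]] :
    set (measurableTypeR R)) by exact: measurable_itv.
  apply: etrans (product_measure1E _ _ mI mB) _; congr (_ * _)%E.
    apply: etrans (lebesgue_measure_itv _) _; rewrite /= lte_fin.
    case: ltP => // ba; rewrite (_ : b ord0 ord0 = a ord0 ord0) ?subrr//.
    by apply/eqP; rewrite eq_le ba ab.
  rewrite IH => [|i]; last by rewrite !mxE.
  by congr EFin; apply: eq_bigr => i _; rewrite !mxE.
apply/seteqP; split=> -[x y] /=.
  move=> H; split; first by have := H ord0; rewrite rV_cons0.
  by move=> i; have := H (lift ord0 i); rewrite rV_consS !mxE.
move=> [xab yB] i; case: (unliftP ord0 i) => [j|] ->.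
  by rewrite rV_consS; have := yB j; rewrite !mxE.
by rewrite rV_cons0.
Qed.

Section euclidean_space.
Context {R : realType} {n : nat}.
Implicit Types (x xi : 'rV[R]_n) (f : 'rV[R]_n -> R).

Definition dotmx x xi : R := \sum_(i < n) x ord0 i * xi ord0 i.

(* The library norm `|x| on 'rV[R]_n is the sup norm. *)
Definition enorm x : R := Num.sqrt (dotmx x x).

Fixpoint iter_partial (s : seq 'I_n) f : 'rV[R]_n -> R :=
  if s is i :: s' then fun x => 'D_(delta_mx ord0 i) (iter_partial s' f) x
  else f.

Definition smooth f : Prop := forall s : seq 'I_n,
  continuous (iter_partial s f) /\
  forall i x, derivable (iter_partial s f) x (delta_mx ord0 i).

Definition test_function f : Prop :=
  smooth f /\ compact (closure [set x | f x != 0]).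

Definition sobolevH1 f : Prop :=
  f \in Lfun (rV_lebesgue n) 2%:E /\
  forall i : 'I_n, exists2 g : 'rV[R]_n -> R,
    g \in Lfun (rV_lebesgue n) 2%:E &
    forall phi, test_function phi ->
      \int[rV_lebesgue n]_x (f x * 'D_(delta_mx ord0 i) phi x) =
      - \int[rV_lebesgue n]_x (g x * phi x).

Definition moment f : R := \int[rV_lebesgue n]_x f x.

Definition LnormC (p : \bar R) (g : 'rV[R]_n -> R[i]) : \bar R :=
  'N[rV_lebesgue n]_p[EFin \o @Normc.normc R \o g]%E.

Definition fourier f xi : R[i] :=
  real_complex R ((Num.sqrt (2 * pi)) ^- n) *
  Complex (\int[rV_lebesgue n]_x (f x * cos (dotmx x xi)))
          (- \int[rV_lebesgue n]_x (f x * sin (dotmx x xi))).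

(* The relation "g is the L^2 Fourier transform of f", i.e. the graph of the
   L^2-continuous extension of [fourier] from the dense subspace L^1 /\ L^2. *)
Definition is_fourierL2 f (g : 'rV[R]_n -> R[i]) : Prop :=
  [/\ f \in Lfun (rV_lebesgue n) 2%:E,
      measurable_fun setT (fun xi => complex.Re (g xi)),
      measurable_fun setT (fun xi => complex.Im (g xi)) &
      exists h : nat -> 'rV[R]_n -> R,
        [/\ forall k, h k \in Lfun (rV_lebesgue n) 1,
            forall k, h k \in Lfun (rV_lebesgue n) 2%:E,
            'N[rV_lebesgue n]_(2%:E)[EFin \o (h k \- f)%R]%E
              @[k --> \oo] --> 0%E &
            LnormC 2%:E (fun xi => fourier (h k) xi - g xi)
              @[k --> \oo] --> 0%E]].

(* (xi / |xi|) (x) (xi / |xi|); the value at xi = 0 is irrelevant since all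
   functions below matter only up to null sets. *)
Definition dirproj xi : 'M[R]_n :=
  let w := (enorm xi)^-1 *: xi in w^T *m w.

Definition vec_Lnorm (p : \bar R) (f : 'I_n -> 'rV[R]_n -> R) : \bar R :=
  (\sum_(k < n) 'N[rV_lebesgue n]_p[EFin \o f k])%E.

End euclidean_space.

Section elastic_wave.
Context {R : realType} {n : nat}.
Variables lambda mu : R.
(* [f j k] is the k-th component of the initial datum f_j, j = 0, 1. *)
Variable f : 'I_2 -> 'I_n -> 'rV[R]_n -> R.

Definition elastic_data : Prop := forall k,
  [/\ sobolevH1 (f 0 k), f 0 k \in Lfun (rV_lebesgue n) 1,
      f 1 k \in Lfun (rV_lebesgue n) 2%:E &
      f 1 k \in Lfun (rV_lebesgue n) 1].

Definition elastic_hat (t : R) (xi : 'rV[R]_n) : 'cV[R[i]]_n :=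
  let alpha1 := Num.sqrt (lambda + 2 * mu) in
  let alpha2 := Num.sqrt mu in
  let r := enorm xi in
  let P := map_mx (real_complex R) (dirproj xi) in
  let fhat j : 'cV[R[i]]_n := \col_k fourier (f j k) xi in
  real_complex R (cos (t * alpha1 * r)) *: (P *m fhat 0)
  + real_complex R (sin (t * alpha1 * r) / (alpha1 * r)) *: (P *m fhat 1)
  + real_complex R (cos (t * alpha2 * r)) *: ((1%:M - P) *m fhat 0)
  + real_complex R (sin (t * alpha2 * r) / (alpha2 * r))
      *: ((1%:M - P) *m fhat 1).

(* The solution of
     u_tt - mu Delta u - (lambda + mu) grad (div u) = 0,
     u(0) = f_0, u_t(0) = f_1
   is by definition the one whose spatial Fourier transform at each time is
   the Fourier-side solution [elastic_hat]. *)
Definition elastic_solution (u : R -> 'I_n -> 'rV[R]_n -> R) : Prop :=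
  forall t, 0 <= t -> forall k,
    is_fourierL2 (u t k) (fun xi => elastic_hat t xi k ord0).

End elastic_wave.

(* Main.v *)
(** In Fourier space the solution is a sum of oscillations [cos (t a_i |xi|)]
    and [sin (t a_i |xi|) / (a_i |xi|)], [i = 1, 2], whose amplitudes are built
    from the transforms of the data and the projection on the direction
    [w = xi / |xi|]. By Plancherel all norms are integrals over frequencies.

    Upper bound: for [|xi| >= 1] the multipliers are bounded; near [0] the
    transform of [f_1] is at most its [L^1] norm, while the integral of
    [min(t^2, |xi|^-2)] over the unit cube is [O(log t)] if [n = 2] and [O(1)]
    if [n >= 3], as one sees by cutting the cube dyadically.

    Lower bound: as the two speeds differ, averaging over the dilations
    [xi |-> s xi] with [1 <= s <= 1 + kappa] removes the cross terms, so that
    the mean square of [|xi| u_j] is at least a constant times the sum of the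
    squared amplitudes. In the orthant of frequencies having the signs of the
    moments [m], nothing cancels in [w . m], and the amplitude [w_j (w . m)] is
    bounded below by a multiple of [|m_k0|]. One cube in this orthant suffices
    for [n >= 3]; for [n = 2] the cubes at the scales [8^-k] between [1 / t] and
    [1] are disjoint and contribute equally, and there are about [log t] of
    them. *)

From Pilot Require Import Defs.
From HB Require Import structures.
From mathcomp Require Import all_boot all_order all_algebra.
From mathcomp Require Import all_classical all_reals all_analysis.
From mathcomp Require Import measurable_realfun complex ring lra.
Import Pilot.Defs.
Set Implicit Arguments.
Unset Strict Implicit.
Unset Printing Implicit Defensive.
Import Order.TTheory GRing.Theory Num.Theory.
Import numFieldNormedType.Exports.
Local Open Scope classical_set_scope.
Local Open Scope ring_scope.

(** * Integration on row vectors *)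

(** The obstacle to the lower bound is that at a single frequency the longitudinal and the
    transverse parts of the solution may cancel. Dilations help because [P] depends only on the
    direction of [xi]: along a ray [s *: x] the phases [t a_i |x| s] are linear in [s], and the
    factor [|xi|] cancels the denominator of the sine terms. Freezing the transforms of the data at
    reference values leaves an explicit two-frequency signal and an error controlled by uniform
    continuity. As all squared amplitudes add up, one longitudinal amplitude is enough, whatever the
    others are. A moment is the value at [0] of a cosine transform, so the lower bounds use only the
    real part of the solution. For [n = 2] the constant must be chosen before the data: there
    [kappa = 1], and [f_0], multiplied by [|xi|], is an error at low frequencies. In the other case
    the constant may depend on the data, and [kappa] is adapted to them. Plancherel's identity is
    derived with the kernel [exp(- |x_1| - ... - |x_n|)], whose transform is an explicit product;
    this reduces it to the continuity of translations in [L^2]. *)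

Section rV_lebesgue_integral.
Context {R : realType}.
Local Open Scope ereal_scope.
Local Notation RL := (@rV_lebesgue R).
Let L : {sigma_finite_measure set (measurableTypeR R) -> \bar R} := @lebesgue_measure R.

Lemma ge0_integral_rV_succ n (G : 'rV[R]_n.+1 -> \bar R) :
  measurable_fun [set: 'rV[R]_n.+1] G -> (forall x, 0 <= G x) ->
  \int[RL n.+1]_x G x =
  \int[@lebesgue_measure R]_x \int[RL n]_y G (rV_cons (x, y)).
Proof.
move=> mG G0 /=.
rewrite [LHS](@ge0_integral_pushforward _ _ _ _ _ _ measurable_rV_cons) //.
rewrite preimage_setT.
apply: (@fubini_tonelli1 _ _ _ _ _ L (RL n) (G \o rV_cons)) => [|x].
  exact: measurableT_comp measurable_rV_cons.
exact: G0.
Qed.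

Lemma measurable_integral_rV_succ n (G : 'rV[R]_n.+1 -> \bar R) :
  measurable_fun [set: 'rV[R]_n.+1] G -> (forall x, 0 <= G x) ->
  measurable_fun (setT : set (measurableTypeR R))
    (fun x => \int[RL n]_y G (rV_cons (x, y))).
Proof.
move=> mG G0.
apply: (@measurable_fun_fubini_tonelli_F _ _ (measurableTypeR R) _ R (RL n) (G \o rV_cons)) => [|x].
  exact: measurableT_comp measurable_rV_cons.
exact: G0.
Qed.

Lemma integral_rV_succ n (G : 'rV[R]_n.+1 -> \bar R) :
  (RL n.+1).-integrable setT G ->
  \int[RL n.+1]_x G x =
  \int[@lebesgue_measure R]_x \int[RL n]_y G (rV_cons (x, y)).
Proof.
move=> iG /=.
have mG := measurable_int _ iG.
have iGc : (L \x RL n).-integrable setT (G \o rV_cons).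
  apply/integrableP; split; first exact: measurableT_comp measurable_rV_cons.
  move/integrableP : iG => [_].
  by rewrite [X in X < _ -> _](@ge0_integral_pushforward _ _ _ _ _ _ measurable_rV_cons) //;
    exact: measurableT_comp.
rewrite [LHS](@integral_pushforward _ _ _ _ _ _ measurable_rV_cons) //.
rewrite preimage_setT.
by rewrite -(integral12_prod_meas1 iGc).
Qed.

(** A measure with the values of Lebesgue measure on half-open intervals is Lebesgue measure; this
    is applied to [s] times the measure of the preimage. *)
Lemma lebesgue_measure_affine (s a : R) (A : set (measurableTypeR R)) :
  (0 < s)%R -> measurable A ->
  lebesgue_measure ((fun x : R => s * x + a)%R @^-1` A) =
  (s^-1)%:E * lebesgue_measure A.
Proof.
move=> s0 mA.
pose phi : measurableTypeR R -> measurableTypeR R := fun x => (s * x + a)%R.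
have mphi : measurable_fun setT phi.
  by apply: measurable_funD => //; apply: measurable_funM.
have [m' m'E] : exists m' : {measure set (measurableTypeR R) -> \bar R},
    forall X, m' X = s%:E * lebesgue_measure (phi @^-1` X).
  by unshelve eexists (mscale (NngNum (ltW s0)) (pushforward L phi)).
have H X : ocitv X -> lebesgue_measure X = m' X.
  move=> [[u v] _ <-]; rewrite m'E.
  rewrite (_ : _ @^-1` _ = `]((u - a) / s)%R, ((v - a) / s)%R]%classic); last first.
    apply/seteqP; split => x /=; rewrite !in_itv/= /phi;
    by rewrite ler_pdivlMr// ltr_pdivrMr// ltrBlDr lerBrDr (mulrC x).
  rewrite [LHS]lebesgue_measure_itv /= [in RHS]lebesgue_measure_itv/= !lte_fin.
  rewrite ltr_pM2r ?invr_gt0// ltrD2r; case: ifP => _; last by rewrite mule0.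
  by rewrite -!EFinD -EFinM; congr EFin; field; rewrite gt_eqF.
rewrite (lebesgue_measure_unique H mA) m'E muleA.
by rewrite -EFinM mulVf ?gt_eqF// mul1e.
Qed.

Lemma measurable_affine_R (s a : R) :
  measurable_fun (setT : set (measurableTypeR R)) (fun x : measurableTypeR R => (s * x + a)%R : measurableTypeR R).
Proof. by apply: measurable_funD => //; apply: measurable_funM. Qed.

Lemma ge0_integral_affine (s a : R) (g : R -> \bar R) :
  (0 < s)%R -> measurable_fun (setT : set (measurableTypeR R)) g -> (forall x, 0 <= g x) ->
  \int[@lebesgue_measure R]_x g (s * x + a)%R =
  (s^-1)%:E * \int[@lebesgue_measure R]_x g x.
Proof.
move=> s0 mg g0.
have sV0 : (0 <= s^-1)%R by rewrite invr_ge0 ltW.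
have E := @ge0_integral_pushforward _ _ _ _ R _ (measurable_affine_R s a) L
  setT g measurableT mg (fun x _ => g0 x).
rewrite preimage_setT in E; rewrite -[LHS]E.
rewrite -(@ge0_integral_mscale _ _ _ L setT measurableT (NngNum sV0) g mg)//.
apply: eq_measure_integral => [|mphi A mA _]; first exact: measurable_affine_R.
exact: lebesgue_measure_affine.
Qed.

Lemma rV_ord0P n (x y : 'rV[R]_n) : (forall i, x ord0 i = y ord0 i) -> x = y.
Proof. by move=> xy; apply/rowP. Qed.

Lemma measurable_affine_rV n (s : R) (a : 'rV[R]_n) :
  measurable_fun setT (fun x : 'rV[R]_n => (s *: x + a)%R).
Proof.
apply/measurable_fun_rVP => i; under eq_fun do rewrite !mxE.
apply: measurable_funD => //; apply: measurable_funM => //.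
exact: measurable_rV_coor.
Qed.

(** Tonelli's theorem splits off the first coordinate, and each coordinate contributes one factor
    [s^-1]. *)
Lemma ge0_integral_rV_affine n (s : R) (a : 'rV[R]_n) (G : 'rV[R]_n -> \bar R) :
  (0 < s)%R -> measurable_fun [set: 'rV[R]_n] G -> (forall x, 0 <= G x) ->
  \int[RL n]_x G (s *: x + a)%R =
  (s ^- n)%:E * \int[RL n]_x G x.
Proof.
move=> s0; elim: n a G => [|n IH] a G mG G0.
  rewrite expr0 invr1 mul1e; apply: eq_integral => x _.
  by congr G; apply/rowP => -[].
rewrite ge0_integral_rV_succ//; last exact: measurableT_comp (measurable_affine_rV s a).
pose a' : 'rV[R]_n := (rV_uncons a).2.
transitivity (\int[L]_x (fun z : R => ((s ^- n)%:E * \int[RL n]_y G (rV_cons (z, y)))) (s * x + a ord0 ord0)%R).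
  apply: eq_integral => x _.
  rewrite -(IH a')//; last first.
    apply: measurableT_comp => //.
    exact: (measurableT_comp measurable_rV_cons (measurable_pair1 _)).
  apply: eq_integral => y _; congr G.
  apply: rV_ord0P => i; case: (unliftP ord0 i) => [j|] ->.
    by rewrite [LHS]mxE [X in (X + _)%R]mxE (rV_consS (x, y) j) (rV_consS (_, _) j) !mxE.
  by rewrite [LHS]mxE [X in (X + _)%R]mxE (rV_cons0 (x, y)) (rV_cons0 (_, _)).
have sn0 : (0 <= s ^- n)%R by rewrite invr_ge0 exprn_ge0// ltW.
rewrite (@ge0_integral_affine s (a ord0 ord0)
  (fun z => (s ^- n)%:E * \int[RL n]_y G (rV_cons (z, y)))) //; last 2 first.
- by apply: emeasurable_funM => //; exact: measurable_integral_rV_succ.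
- by move=> x; rewrite mule_ge0 ?lee_fin//; apply: integral_ge0.
rewrite ge0_integralZl//; last 2 first.
- exact: measurable_integral_rV_succ.
- by move=> x _; apply: integral_ge0.
by rewrite -ge0_integral_rV_succ// muleA -EFinM exprS invfM.
Qed.

End rV_lebesgue_integral.

(** * Measurability and Fubini's theorem for real-valued integrals *)

Section real_integrals.
Context {R : realType}.

Lemma measurable_cos : measurable_fun [set: R] (@cos R).
Proof. apply: continuous_measurable_fun; exact: continuous_cos. Qed.

Lemma measurable_sin : measurable_fun [set: R] (@sin R).
Proof. apply: continuous_measurable_fun; exact: continuous_sin. Qed.

Lemma measurable_sqrt : measurable_fun [set: R] (@Num.sqrt R).
Proof. apply: continuous_measurable_fun; exact: sqrt_continuous. Qed.

Lemma EFin_Rintegral d (T : measurableType d) (mu : {measure set T -> \bar R})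
    (f : T -> R) : mu.-integrable setT (EFin \o f) ->
  (\int[mu]_x f x)%:E = (\int[mu]_x (f x)%:E)%E.
Proof. by move=> fi; rewrite /Rintegral fineK//; apply: integrable_fin_num. Qed.

Lemma le_integrable_real d (T : measurableType d) (mu : {measure set T -> \bar R})
    (f g : T -> R) : measurable_fun setT f -> (forall x, `|f x| <= g x) ->
  mu.-integrable setT (EFin \o g) -> mu.-integrable setT (EFin \o f).
Proof.
move=> mf fg; apply: le_integrable => //; first exact/measurable_EFinP.
by move=> x _ /=; rewrite lee_fin (le_trans (fg x))// ler_norm.
Qed.

Lemma integrable_ge0_Rintegral d (T : measurableType d)
    (mu : {measure set T -> \bar R}) (f : T -> R) :
  measurable_fun setT f -> (forall x, 0 <= f x) ->
  (\int[mu]_x (f x)%:E < +oo)%E -> mu.-integrable setT (EFin \o f).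
Proof.
move=> mf f0 foo; apply/integrableP; split; first exact/measurable_EFinP.
by under eq_integral do rewrite gee0_abs ?lee_fin//.
Qed.

Section product.
Context d1 d2 (T1 : measurableType d1) (T2 : measurableType d2).
Variables (m1 : {sigma_finite_measure set T1 -> \bar R})
          (m2 : {sigma_finite_measure set T2 -> \bar R}).

(** Tonelli's theorem gives measurability for nonnegative integrands, so the positive and negative
    parts are treated separately. *)
Lemma measurable_integral_param (F : T1 * T2 -> R) :
  measurable_fun setT F ->
  measurable_fun setT (fun x => (\int[m2]_y (F (x, y))%:E)%E).
Proof.
move=> mF; have mFE : measurable_fun setT (EFin \o F) by exact/measurable_EFinP.
under eq_fun do rewrite integralE.
apply: emeasurable_funB.
- rewrite [X in measurable_fun _ X](_ : _ = fubini_F m2 ((EFin \o F)^\+%E)); last first.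
    apply/funext => x; rewrite /fubini_F; apply: eq_integral => y _.
    by rewrite !funeposE.
  apply: measurable_fun_fubini_tonelli_F => //; exact: measurable_funepos.
- rewrite [X in measurable_fun _ X](_ : _ = fubini_F m2 ((EFin \o F)^\-%E)); last first.
    apply/funext => x; rewrite /fubini_F; apply: eq_integral => y _.
    by rewrite !funenegE.
  apply: measurable_fun_fubini_tonelli_F => //; exact: measurable_funeneg.
Qed.

Lemma measurable_Rintegral_param (F : T1 * T2 -> R) :
  measurable_fun setT F ->
  measurable_fun setT (fun x => \int[m2]_y F (x, y)).
Proof.
move=> mF; apply: (measurableT_comp (fine_measurable _)) => //.
exact: measurable_integral_param.
Qed.

(** Adapted to bounded oscillating kernels, for which each variable carries its own integrable
    factor. *)
Lemma integrable_prod_dom (F : T1 * T2 -> R) (a : T1 -> R) (b : T2 -> R) :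
  measurable_fun setT F ->
  m1.-integrable setT (EFin \o a) -> m2.-integrable setT (EFin \o b) ->
  (forall x y, `|F (x, y)| <= `|a x| * `|b y|) ->
  (m1 \x m2)%E.-integrable setT (EFin \o F).
Proof.
move=> mF ia ib Fab.
have mFE : measurable_fun setT (EFin \o F) by exact/measurable_EFinP.
apply/integrable12ltyP => //.
have ma : measurable_fun setT a by exact/measurable_EFinP/(measurable_int _ ia).
have mb : measurable_fun setT b by exact/measurable_EFinP/(measurable_int _ ib).
have /integrableP[_ iaoo] := ia; have /integrableP[_ iboo] := ib.
have Ib : (\int[m2]_y (`|b y|)%:E)%E \is a fin_num.
  by rewrite ge0_fin_numE// integral_ge0// => y _; rewrite lee_fin.
apply: (@le_lt_trans _ _ (\int[m1]_x ((fine (\int[m2]_y (`|b y|)%:E))%:E * (`|a x|)%:E))%E).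
  apply: ge0_le_integral => //.
  - by move=> x _; exact: integral_ge0.
  - apply: (@measurable_fun_fubini_tonelli_F _ _ T1 T2 R m2 (abse \o (EFin \o F))).
      exact: measurableT_comp.
    by move=> z; exact: abse_ge0.
  - apply: emeasurable_funM => //; apply/measurable_EFinP.
    exact: measurableT_comp.
  - move=> x _; rewrite fineK// muleC -ge0_integralZl//; last first.
      exact/measurable_EFinP/measurableT_comp.
    apply: ge0_le_integral => //.
    + apply: measurableT_comp => //; apply/measurable_EFinP.
      exact: (measurableT_comp mF (measurable_pair1 _)).
    + apply/measurable_EFinP; apply: measurable_funM => //.
      exact: measurableT_comp.
    + by move=> y _ /=; rewrite lee_fin.
rewrite ge0_integralZl//; last 2 first.
- exact/measurable_EFinP/measurableT_comp.
- by rewrite lee_fin fine_ge0// integral_ge0// => y _; rewrite lee_fin.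
by rewrite lte_mul_pinfty// ?lee_fin ?fine_ge0 ?integral_ge0// => y _; rewrite lee_fin.
Qed.

(** [Rintegral] is the [fine] of an extended integral, so every section has to be integrable too;
    the product bound ensures this for all [x] and all [y], not only almost everywhere. *)
Lemma Rfubini_dom (F : T1 * T2 -> R) (a : T1 -> R) (b : T2 -> R) :
  measurable_fun setT F ->
  m1.-integrable setT (EFin \o a) -> m2.-integrable setT (EFin \o b) ->
  (forall x y, `|F (x, y)| <= `|a x| * `|b y|) ->
  \int[m1]_x \int[m2]_y F (x, y) = \int[m2]_y \int[m1]_x F (x, y).
Proof.
move=> mF ia ib Fab.
have iF := integrable_prod_dom mF ia ib Fab.
have ma : measurable_fun setT a by exact/measurable_EFinP/(measurable_int _ ia).
have mb : measurable_fun setT b by exact/measurable_EFinP/(measurable_int _ ib).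
rewrite /Rintegral.
have := Fubini iF; rewrite /=.
under eq_integral => x _.
  rewrite -EFin_Rintegral; last first.
    apply: (@le_integrable_real _ _ _ _ (fun y => `|a x| * `|b y|)).
    - exact: (measurableT_comp mF (measurable_pair1 _)).
    - by move=> y; exact: Fab.
    - rewrite (_ : _ \o _ = (fun y => `|a x|%:E * (`|b y|)%:E)%E)//.
      by apply: integrableZl => //; exact: (integrable_abse ib).
  over.
move=> -> /=; congr fine; apply: eq_integral => y _.
rewrite /= fineK//; apply: integrable_fin_num => //.
apply: (@le_integrable_real _ _ _ _ (fun x => `|b y| * `|a x|)).
- exact: (measurableT_comp mF (measurable_pair2 _)).
- by move=> x; rewrite mulrC; exact: Fab.
- rewrite (_ : _ \o _ = (fun x => `|b y|%:E * (`|a x|)%:E)%E)//.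
  by apply: integrableZl => //; exact: (integrable_abse ia).
Qed.

End product.
End real_integrals.

(** * Derivatives of explicit functions of one variable *)

Section derive_lambda.
Context {R : realType}.
Implicit Types (f g : R -> R) (x : R).

(** Lets instance search or a chain of rules produce some derivative [a], and leaves [a = b] as an
    algebraic identity. *)
Lemma is_derive1_eq f x a b : is_derive x 1 f a -> a = b -> is_derive x 1 f b.
Proof. by move=> ? <-. Qed.

Lemma is_derive1_add f g x a b : is_derive x 1 f a -> is_derive x 1 g b ->
  is_derive x 1 (fun y => f y + g y) (a + b).
Proof. exact: is_deriveD. Qed.

Lemma is_derive1_mul f g x a b : is_derive x 1 f a -> is_derive x 1 g b ->
  is_derive x 1 (fun y => f y * g y) (f x * b + g x * a).
Proof. exact: is_deriveM. Qed.

Lemma is_derive1_scale f x a c : is_derive x 1 f a ->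
  is_derive x 1 (fun y => c * f y) (c * a).
Proof. exact: is_deriveZ. Qed.

Lemma is_derive1_lin x c : is_derive x 1 (fun y : R => c * y) c.
Proof. by apply: (is_derive1_eq (is_derive1_scale c (is_derive_id x 1))); rewrite mulr1. Qed.

Lemma is_derive1_sin x c : is_derive x 1 (fun y : R => sin (c * y)) (c * cos (c * x)).
Proof.
by rewrite mulrC; exact: (@is_derive1_comp _ sin _ _ _ _ (is_derive_sin _) (is_derive1_lin _ _)).
Qed.

Lemma is_derive1_cos x c : is_derive x 1 (fun y : R => cos (c * y)) (- (c * sin (c * x))).
Proof.
apply: is_derive1_eq (@is_derive1_comp _ cos _ _ _ _ (is_derive_cos _) (is_derive1_lin x c)) _.
by rewrite mulrC mulrN.
Qed.

Lemma is_derive1_expN x : is_derive x 1 (fun y : R => expR (- y)) (- expR (- x)).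
Proof.
apply: is_derive1_eq (@is_derive1_comp _ expR _ _ _ _ (is_derive_expR _) (is_deriveNid x 1)) _.
by rewrite mulrN1.
Qed.

Lemma is_derive1_continuous f x a : is_derive x 1 f a -> {for x, continuous f}.
Proof. by move=> [df _]; apply/differentiable_continuous/derivable1_diffP. Qed.

End derive_lambda.

(** * The kernel exp(-|x|) and its transform *)

Section exponential_kernel.
Context {R : realType}.
Local Notation leb := (@lebesgue_measure R).

Lemma ge0_integral_oppr (g : R -> \bar R) :
  measurable_fun (setT : set (measurableTypeR R)) g -> (forall x, 0 <= g x)%E ->
  (\int[leb]_x g (- x)%R = \int[leb]_x g x)%E.
Proof.
move=> mg g0.
have mN : measurable_fun (setT : set (measurableTypeR R)) (-%R : measurableTypeR R -> measurableTypeR R).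
  exact: (@oppr_measurable R).
have E := @ge0_integral_pushforward _ _ _ _ R _ mN leb setT g measurableT mg (fun x _ => g0 x).
rewrite preimage_setT in E; rewrite -[LHS]E.
apply: eq_measure_integral => A mA _.
exact: lebesgue_measureN.
Qed.

Lemma continuous_expR_absN : continuous (fun x : R => expR (- `|x|)).
Proof.
move=> x; apply: (@continuous_comp _ _ _ (fun x : R => - `|x|) expR); last exact: continuous_expR.
by apply: continuousN; exact: norm_continuous.
Qed.

Lemma measurable_expR_absN : measurable_fun [set: R] (fun x : R => expR (- `|x|)).
Proof. apply: continuous_measurable_fun; exact: continuous_expR_absN. Qed.

Lemma continuous_cosM (z : R) : continuous (fun x => cos (z * x)).
Proof. by move=> x; exact: is_derive1_continuous (is_derive1_cos x z). Qed.

(* The constant 2 makes the integrand nonnegative, as the fundamental theorem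
   of calculus on an unbounded interval requires. *)
Lemma expR_cos_half (b z : R) : `|b| <= 1 ->
  (\int[leb]_(x in `[0%R, +oo[) (expR (- x) * (2 + 2 * (b * cos (z * x))))%:E =
   (2 + 2 * b / (1 + z ^+ 2))%:E)%E.
Proof.
move=> b1; have z1 : 1 + z ^+ 2 != 0 by rewrite gt_eqF// ltr_wpDr ?sqr_ge0.
(* Integrating by parts twice, [expR (- x) * (z * sin (z * x) - cos (z * x)) / (1 + z ^+ 2)] is a
   primitive of [expR (- x) * cos (z * x)]. *)
pose F (x : R) := expR (- x) * (- 2 + (2 * b / (1 + z ^+ 2)) * (z * sin (z * x) + (-1) * cos (z * x))).
have dF (x : R) : is_derive x 1 F (expR (- x) * (2 + 2 * (b * cos (z * x)))).
  apply: is_derive1_eq (is_derive1_mul (is_derive1_expN x) (is_derive1_add (is_derive_cst _ _ _) (is_derive1_scale _ (is_derive1_add (is_derive1_scale _ (is_derive1_sin _ _)) (is_derive1_scale _ (is_derive1_cos _ _)))))) _.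
  by rewrite (_ : cst _ x = - 2)//; field.
have cf : continuous (fun x => expR (- x) * (2 + 2 * (b * cos (z * x)))).
  move=> x; apply: (is_derive1_continuous (a := _)).
rewrite (@ge0_continuous_FTC2y _ _ F 0 0).
- rewrite /F oppr0 expR0 mulr0 sin0 cos0 -EFinB; congr EFin.
  by field.
- move=> x _; rewrite mulr_ge0 ?expR_ge0//.
  have : `|b * cos (z * x)| <= 1.
    by rewrite normrM mulr_ile1// ler_norml cos_geN1 cos_le1.
  by rewrite ler_norml => /andP[? _]; lra.
- exact: continuous_subspaceT.
- pose M : R := `|2| + `|2 * b / (1 + z ^+ 2)| * (`|z| + 1).
  apply: (@squeeze_cvgr _ _ _ _ (fun x => (- M) * expR (- x)) (fun x => M * expR (- x))).
  + apply: nearW => x; rewrite mulNr -ler_norml /F normrM (ger0_norm (expR_ge0 _)) mulrC.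
    rewrite ler_wpM2r ?expR_ge0//.
    rewrite (le_trans (ler_normD _ _))// normrN lerD2l normrM ler_wpM2l//.
    rewrite (le_trans (ler_normD _ _))// !normrM normrN1 mul1r lerD//.
      by rewrite ler_piMr// ler_norml sin_geN1 sin_le1.
    by rewrite ler_norml cos_geN1 cos_le1.
  + rewrite -[X in _ --> X](mulr0 (- M)); apply: cvgM; first exact: cvg_cst.
    exact: cvgr_expR.
  + rewrite -[X in _ --> X](mulr0 M); apply: cvgM; first exact: cvg_cst.
    exact: cvgr_expR.
- by move=> x _; case: (dF x).
- by apply: cvg_at_right_filter; exact: is_derive1_continuous (dF 0).
- by move=> x _; rewrite derive1E; case: (dF x).
Qed.

(** The [1] keeps the integrand nonnegative. Reflection shows that [z] and [- z] give the same
    integral; in their sum the sines cancel, and an even function remains, which reduces to the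
    half-line. The phase [c] is carried along for the induction on the dimension. *)
Lemma integral_expR_1cos (c z : R) :
  (\int[leb]_x (expR (- `|x|) * (1 + cos (c + z * x)))%:E =
   (2 + 2 * cos c / (1 + z ^+ 2))%:E)%E.
Proof.
pose g (s x : R) := expR (- `|x|) * (1 + cos (c + (s * z) * x)).
have cg s : continuous (g s).
  move=> x; rewrite /g; apply: cvgM; first exact: continuous_expR_absN.
  apply: cvgD; first exact: cvg_cst.
  apply: (@continuous_comp _ _ _ (fun x => c + (s * z) * x) cos); last exact: continuous_cos.
  apply: cvgD; first exact: cvg_cst.
  exact: is_derive1_continuous (is_derive1_lin _ _).
have mg s : measurable_fun (setT : set (measurableTypeR R)) (EFin \o g s).
  by apply/measurable_EFinP; apply: continuous_measurable_fun; exact: cg.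
have g0 s x : (0 <= (g s x)%:E)%E.
  rewrite lee_fin mulr_ge0 ?expR_ge0//.
have E1 : (\int[leb]_x (g (-1) x)%:E = \int[leb]_x (g 1 x)%:E)%E.
  rewrite -(ge0_integral_oppr (mg 1) (g0 1)); apply: eq_integral => x _ /=.
  by rewrite /g normrN; congr (_ * (1 + cos _))%:E; ring.
have E2 : (\int[leb]_x (g 1 x)%:E + \int[leb]_x (g (-1) x)%:E =
    2%:E * (2 + 2 * cos c / (1 + z ^+ 2))%:E)%E.
  rewrite -ge0_integralD//; [|exact: mg|exact: mg].
  transitivity (\int[leb]_x (expR (- `|x|) * (2 + 2 * (cos c * cos (z * x))))%:E)%E.
    apply: eq_integral => x _; rewrite -EFinD /g; congr EFin.
    rewrite mul1r mulN1r mulNr cosD (cosD c (- _)) cosN sinN; ring.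
  rewrite (@ge0_symfun_integralT _ (fun x : R => (expR (- `|x|) * (2 + 2 * (cos c * cos (z * x)))))).
  - congr (_ * _)%E; rewrite -(@expR_cos_half (cos c) z); last by rewrite ler_norml cos_geN1 cos_le1.
    rewrite (_ : [set x | (0 <= x)%R] = [set` `[0%R, +oo[]); last first.
      by apply/seteqP; split => x /=; rewrite in_itv/= andbT.
    by apply: eq_integral => x; rewrite inE /= in_itv /= andbT => x0; rewrite ger0_norm.
  - by move=> x; rewrite mulr_ge0 ?expR_ge0.
  - move=> x; apply: cvgM; first exact: continuous_expR_absN.
    apply: cvgD; first exact: cvg_cst.
    apply: cvgM; first exact: cvg_cst.
    by apply: cvgM; [exact: cvg_cst|exact: continuous_cosM].
  - by move=> x /=; rewrite normrN mulrN cosN.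
rewrite E1 in E2.
have -> : (\int[leb]_x (expR (- `|x|) * (1 + cos (c + z * x)))%:E = \int[leb]_x (g 1 x)%:E)%E.
  by apply: eq_integral => x _; rewrite /g mul1r.
case: (\int[leb]_x (g 1 x)%:E)%E E2 => [r| |] //=.
by rewrite -EFinD -EFinM => -[] E2; congr EFin; lra.
Qed.

Lemma integral_expR_absN : (\int[leb]_x (expR (- `|x|))%:E = 2%:E)%E.
Proof.
have := integral_expR_1cos 0 0.
under eq_integral do rewrite mul0r addr0 cos0 EFinM muleC.
rewrite ge0_integralZl//.
- rewrite cos0 expr0n /= addr0 divr1.
  case: (\int[leb]_x _)%E => [r| |] //=; last 2 first.
  + by rewrite gt0_muley// lte_fin; lra.
  + by rewrite gt0_muleNy// lte_fin; lra.
  by rewrite -EFinM => -[] E; congr EFin; lra.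
- by apply/measurable_EFinP; exact: measurable_expR_absN.
Qed.

Lemma integrable_expR_absN : leb.-integrable setT (EFin \o (fun x : R => expR (- `|x|))).
Proof.
apply: integrable_ge0_Rintegral.
- exact: measurable_expR_absN.
- by move=> x; exact: expR_ge0.
- by rewrite integral_expR_absN ltry.
Qed.

Lemma Rintegral_expR_cos (c z : R) :
  \int[leb]_x (expR (- `|x|) * cos (c + z * x)) = cos c * (2 / (1 + z ^+ 2)).
Proof.
have mc : measurable_fun [set: R] (fun x => expR (- `|x|) * cos (c + z * x)).
  apply: measurable_funM; first exact: measurable_expR_absN.
  apply: (measurableT_comp measurable_cos).
  by apply: measurable_funD => //; apply: measurable_funM.
have ic : leb.-integrable setT (EFin \o (fun x => expR (- `|x|) * cos (c + z * x))).
  apply: le_integrable_real integrable_expR_absN => // x.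
  rewrite normrM (ger0_norm (expR_ge0 _)) ler_piMr ?expR_ge0//.
  by rewrite ler_norml cos_geN1 cos_le1.
have := integral_expR_1cos c z.
under eq_integral do rewrite mulrDr mulr1 EFinD.
rewrite integralD//; last exact: integrable_expR_absN.
rewrite integral_expR_absN -EFin_Rintegral// -EFinD => -[]/addrI ->.
by ring.
Qed.

End exponential_kernel.

(** * The kernel and its transform in dimension [n] *)

Section product_kernel.
Context {R : realType}.
Local Notation leb := (@lebesgue_measure R).
Local Notation RL := (@rV_lebesgue R).

Lemma measurable_prod_coor n (g : R -> R) : measurable_fun [set: R] g ->
  measurable_fun [set: 'rV[R]_n] (fun x : 'rV[R]_n => \prod_(i < n) g (x ord0 i)).
Proof.
move=> mg; apply: measurable_prod => i _.
exact: (measurableT_comp mg (measurable_rV_coor i)).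
Qed.

Lemma integral_rV_prod n (g : R -> R) (c : R) :
  measurable_fun [set: R] g -> (forall x, 0 <= g x) ->
  (\int[leb]_x (g x)%:E = c%:E)%E ->
  (\int[RL n]_x (\prod_(i < n) g (x ord0 i))%:E = (c ^+ n)%:E)%E.
Proof.
move=> mg g0 gc; elim: n => [|n IH].
  under eq_integral do rewrite big_ord0.
  by rewrite integral_cst//= diracT mule1 expr0.
rewrite ge0_integral_rV_succ; last 2 first.
- by apply/measurable_EFinP; exact: measurable_prod_coor.
- by move=> x; rewrite lee_fin prodr_ge0.
transitivity (\int[leb]_x ((c ^+ n)%:E * (g x)%:E))%E.
  apply: eq_integral => x _.
  transitivity (\int[RL n]_y ((g x)%:E * (\prod_(i < n) g (y ord0 i))%:E))%E.
    apply: eq_integral => y _; rewrite big_ord_recl rV_cons0 EFinM.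
    by congr (_ * _%:E)%E; apply: eq_bigr => i _; rewrite rV_consS.
  rewrite ge0_integralZl//.
  - by rewrite IH muleC.
  - by apply/measurable_EFinP; exact: measurable_prod_coor.
  - by move=> y _; rewrite lee_fin prodr_ge0.
  - by rewrite lee_fin.
have c0 : 0 <= c by rewrite -lee_fin -gc integral_ge0// => x _; rewrite lee_fin.
rewrite ge0_integralZl//; last 3 first.
- exact/measurable_EFinP.
- by move=> y _; rewrite lee_fin.
- by rewrite lee_fin exprn_ge0.
by rewrite gc -EFinM exprSr.
Qed.

(** As a product of one-variable exponentials, this kernel has a transform that factorises into
    [cauchyk]. That transform is nonnegative and integrable, so its dilations serve as an
    approximate identity. *)
Definition expabs n (x : 'rV[R]_n) : R := \prod_(i < n) expR (- `|x ord0 i|).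

Definition cauchyk n (z : 'rV[R]_n) : R := \prod_(i < n) (2 / (1 + z ord0 i ^+ 2)).

Lemma expabs_ge0 n (x : 'rV[R]_n) : 0 <= expabs x.
Proof. by apply: prodr_ge0 => i _; exact: expR_ge0. Qed.

Lemma cauchyk_ge0 n (x : 'rV[R]_n) : 0 <= cauchyk x.
Proof.
by apply: prodr_ge0 => i _; rewrite divr_ge0// addr_ge0// sqr_ge0.
Qed.

Lemma measurable_expabs n : measurable_fun [set: 'rV[R]_n] (@expabs n).
Proof. exact: (measurable_prod_coor (g := fun x => expR (- `|x|)) measurable_expR_absN). Qed.

Lemma integrable_expabs n : (RL n).-integrable setT (EFin \o @expabs n).
Proof.
apply: integrable_ge0_Rintegral; [exact: measurable_expabs|exact: expabs_ge0|].
rewrite (integral_rV_prod _ _ _ integral_expR_absN) ?ltry//.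
exact: measurable_expR_absN.
Qed.

Lemma continuous_cauchy : continuous (fun x : R => 2 / (1 + x ^+ 2)).
Proof.
move=> x; apply: cvgM; first exact: cvg_cst.
exact: (@continuous_oneDsqrV R).
Qed.

Lemma measurable_cauchyk n : measurable_fun [set: 'rV[R]_n] (@cauchyk n).
Proof.
apply: (measurable_prod_coor (g := fun x => 2 / (1 + x ^+ 2))); apply: continuous_measurable_fun.
exact: continuous_cauchy.
Qed.

(** Each factor has integral [2 * pi], from the arctangent integral of [1 / (1 + x ^+ 2)]. This is
    the origin of the constant in Plancherel's identity. *)
Lemma integral_cauchyk n : (\int[RL n]_x (cauchyk x)%:E = ((2 * pi) ^+ n)%:E)%E.
Proof.
apply: (@integral_rV_prod n (fun x => 2 / (1 + x ^+ 2))).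
- by apply: continuous_measurable_fun; exact: continuous_cauchy.
- by move=> x; rewrite divr_ge0// addr_ge0// sqr_ge0.
rewrite ge0_symfun_integralT.
- rewrite (_ : [set x | (0 <= x)%R] = [set` `[0%R, +oo[]); last first.
    by apply/seteqP; split => x /=; rewrite in_itv/= andbT.
  under eq_integral do rewrite EFinM.
  rewrite ge0_integralZl//.
  + rewrite (_ : (\int[_]_(_ in _) _)%E = (pi / 2)%:E); last exact: integral0y_oneDsqr.
    by rewrite -!EFinM; congr EFin; field.
  + apply/measurable_EFinP/measurable_funTS; apply: continuous_measurable_fun.
    exact: (@continuous_oneDsqrV R).
  + by move=> x _; rewrite lee_fin invr_ge0 addr_ge0// sqr_ge0.
- by move=> x; rewrite divr_ge0// addr_ge0// sqr_ge0.
- exact: continuous_cauchy.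
- by move=> x /=; rewrite sqrrN.
Qed.

Lemma integrable_cauchyk n : (RL n).-integrable setT (EFin \o @cauchyk n).
Proof.
apply: integrable_ge0_Rintegral; [exact: measurable_cauchyk|exact: cauchyk_ge0|].
by rewrite integral_cauchyk ltry.
Qed.

Lemma cauchykN n (z : 'rV[R]_n) : cauchyk (- z) = cauchyk z.
Proof. by apply: eq_bigr => i _; rewrite mxE sqrrN. Qed.

Lemma measurable_dotmx n (z : 'rV[R]_n) :
  measurable_fun [set: 'rV[R]_n] (fun x : 'rV[R]_n => dotmx x z).
Proof.
apply: measurable_sum => i; apply: measurable_funM => //.
exact: measurable_rV_coor.
Qed.

Lemma measurable_dotmx2 n : measurable_fun setT
  (fun p : 'rV[R]_n * 'rV[R]_n => dotmx p.1 p.2).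
Proof.
apply: measurable_sum => i; apply: measurable_funM.
- exact: (measurableT_comp (measurable_rV_coor i) measurable_fst).
- exact: (measurableT_comp (measurable_rV_coor i) measurable_snd).
Qed.

Lemma dotmxC n (x z : 'rV[R]_n) : dotmx x z = dotmx z x.
Proof. by apply: eq_bigr => i _; rewrite mulrC. Qed.

Lemma dotmxDl n (x y z : 'rV[R]_n) : dotmx (x + y) z = dotmx x z + dotmx y z.
Proof. by rewrite -big_split; apply: eq_bigr => i _; rewrite mxE mulrDl. Qed.

Lemma dotmxZl n a (x z : 'rV[R]_n) : dotmx (a *: x) z = a * dotmx x z.
Proof. by rewrite mulr_sumr; apply: eq_bigr => i _; rewrite mxE mulrA. Qed.

Lemma dotmx_cons n (x : R) (y : 'rV[R]_n) (z : 'rV[R]_n.+1) :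
  dotmx (rV_cons (x, y)) z = z ord0 ord0 * x + dotmx y (rV_uncons z).2.
Proof.
rewrite /dotmx big_ord_recl rV_cons0 mulrC; congr (_ + _).
by apply: eq_bigr => i _; rewrite rV_consS mxE.
Qed.

Lemma integrable_expabs_cos n c (z : 'rV[R]_n) :
  (RL n).-integrable setT (EFin \o (fun x => expabs x * cos (c + dotmx x z))).
Proof.
apply: le_integrable_real (integrable_expabs n).
  apply: measurable_funM; first exact: measurable_expabs.
  apply: (measurableT_comp measurable_cos); apply: measurable_funD => //.
  exact: measurable_dotmx.
move=> x; rewrite normrM (ger0_norm (expabs_ge0 _)) ler_piMr ?expabs_ge0//.
by rewrite ler_norml cos_geN1 cos_le1.
Qed.

(** The induction requires an arbitrary phase [c]: once the first coordinate is fixed, its part of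
    the scalar product joins the phase. *)
Lemma Rintegral_expabs_cos n c (z : 'rV[R]_n) :
  \int[RL n]_x (expabs x * cos (c + dotmx x z)) = cos c * cauchyk z.
Proof.
elim: n c z => [|n IH] c z.
  rewrite /cauchyk big_ord0 mulr1 /Rintegral.
  under eq_integral do rewrite /expabs /dotmx !big_ord0 mul1r addr0.
  rewrite (_ : (\int[_]_(_ in _) _)%E = (\int[RL 0]_x cst (cos c)%:E x)%E)//.
  rewrite integral_cst// [X in (_ * X)%E](_ : _ = 1%E) ?mule1//.
  exact: diracT.
apply: EFin_inj; rewrite EFin_Rintegral; last exact: integrable_expabs_cos.
rewrite integral_rV_succ; last exact: integrable_expabs_cos.
pose z' := (rV_uncons z).2.
transitivity (\int[leb]_x (cauchyk z' * (expR (- `|x|) * cos (c + z ord0 ord0 * x)))%:E)%E.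
  apply: eq_integral => x _.
  transitivity (\int[RL n]_y (expR (- `|x|) * (expabs y * cos (c + z ord0 ord0 * x + dotmx y z')))%:E)%E.
    apply: eq_integral => y _; rewrite dotmx_cons addrA mulrA.
    rewrite {1}/expabs big_ord_recl rV_cons0; congr (_ * _ * _)%:E.
    by apply: eq_bigr => i _; rewrite rV_consS.
  rewrite -EFin_Rintegral; last first.
    rewrite (_ : _ \o _ = (fun y => (expR (- `|x|))%:E *
      (expabs y * cos (c + z ord0 ord0 * x + dotmx y z'))%:E)%E)//.
    by apply: integrableZl => //; exact: integrable_expabs_cos.
  rewrite RintegralZl//; last exact: integrable_expabs_cos.
  by rewrite IH; congr EFin; rewrite mulrA mulrC.
rewrite -EFin_Rintegral; last first.
  rewrite (_ : _ \o _ = (fun x => (cauchyk z')%:E *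
    (expR (- `|x|) * cos (c + z ord0 ord0 * x))%:E)%E)//.
  apply: integrableZl => //.
  apply: le_integrable_real integrable_expR_absN.
    apply: measurable_funM; first exact: measurable_expR_absN.
    apply: (measurableT_comp measurable_cos); apply: measurable_funD => //.
  move=> x; rewrite normrM (ger0_norm (expR_ge0 _)) ler_piMr ?expR_ge0//.
  by rewrite ler_norml cos_geN1 cos_le1.
rewrite RintegralZl//.
  rewrite Rintegral_expR_cos; congr EFin.
  have -> : cauchyk z = 2 / (1 + z ord0 ord0 ^+ 2) * cauchyk z'.
    rewrite {1}/cauchyk big_ord_recl; congr (_ * _).
    by apply: eq_bigr => i _; rewrite mxE.
  by rewrite mulrCA (mulrC (cauchyk _)).
apply: le_integrable_real integrable_expR_absN.
  apply: measurable_funM; first exact: measurable_expR_absN.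
  apply: (measurableT_comp measurable_cos); apply: measurable_funD => //.
move=> x; rewrite normrM (ger0_norm (expR_ge0 _)) ler_piMr ?expR_ge0//.
by rewrite ler_norml cos_geN1 cos_le1.
Qed.

End product_kernel.

(** * Continuity of translations in L^2 *)

Section translation_sets.
Context {R : realType} {n : nat}.
Local Notation V := 'rV[R]_n.
Local Notation mu := (@rV_lebesgue R n).
Implicit Types (A B : set V) (a x : V) (N e : R).

Definition rV_box N : set V := [set x | forall i, x ord0 i \in `[- N, N]].

Definition rV_small a N := forall i, `|a ord0 i| <= N.

Lemma measurable_rV_rect (l r : V) :
  measurable [set x : V | forall i, x ord0 i \in `[l ord0 i, r ord0 i]].
Proof.
rewrite (_ : [set _ | _] = \big[setI/setT]_(i < n)
    ((fun x : V => x ord0 i) @^-1` `[l ord0 i, r ord0 i])).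
  apply: bigsetI_measurable => i _; rewrite -[X in measurable X]setTI.
  exact: (measurable_rV_coor i measurableT (measurable_itv _)).
rewrite -bigcap_seq; apply/seteqP; split=> x /=.
  by move=> Bx i _; exact: Bx.
by move=> Bx i; apply: Bx => /=; rewrite mem_index_enum.
Qed.

Lemma rV_boxE N : rV_box N = [set x : V | forall i,
  x ord0 i \in `[(const_mx (- N) : V) ord0 i, (const_mx N : V) ord0 i]].
Proof. by apply/seteqP; split => x /= H i; have := H i; rewrite !mxE. Qed.

Lemma measurable_rV_box N : measurable (rV_box N).
Proof. by rewrite rV_boxE; exact: measurable_rV_rect. Qed.

Lemma rV_lebesgue_cube N : 0 <= N -> mu (rV_box N) = ((2 * N) ^+ n)%:E.
Proof.
move=> N0; rewrite rV_boxE rV_lebesgue_box; last first.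
  by move=> i; rewrite !mxE; lra.
under eq_bigr do rewrite !mxE.
by rewrite prodr_const card_ord; congr (_ ^+ _)%:E; ring.
Qed.

Lemma measurable_shift_rV a : measurable_fun setT (fun x : V => x + a).
Proof.
have := measurable_affine_rV 1 a.
by rewrite (_ : (fun x => _) = (fun x => x + a))//; apply/funext => x; rewrite scale1r.
Qed.

Lemma measurable_preimage_shift A a : measurable A -> measurable ((fun x => x + a) @^-1` A).
Proof.
move=> mA; rewrite -[X in measurable X]setTI.
exact: (measurable_shift_rV a).
Qed.

Lemma ge0_integral_shift_rV (G : V -> \bar R) a :
  measurable_fun [set: V] G -> (forall x, 0 <= G x)%E ->
  (\int[mu]_x G (x + a)%R = \int[mu]_x G x)%E.
Proof.
move=> mG G0; have := ge0_integral_rV_affine a ltr01 mG G0.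
by rewrite expr1n invr1 mul1e => <-; apply: eq_integral => x _; rewrite scale1r.
Qed.

Lemma rV_lebesgue_shift A a : measurable A -> mu ((fun x => x + a) @^-1` A) = mu A.
Proof.
move=> mA; have := @ge0_integral_shift_rV (EFin \o \1_A) a.
rewrite (_ : (fun x => (EFin \o \1_A) (x + a)) =
  EFin \o \1_((fun x => x + a) @^-1` A)); last first.
  by apply/funext => x /=; rewrite !indicE.
rewrite integral_indic ?setIT//; last exact: measurable_preimage_shift.
rewrite integral_indic ?setIT//; apply.
- by apply/measurable_EFinP; exact: measurable_indic.
- by move=> x; rewrite lee_fin.
Qed.

(** The symmetric difference of [A] and its translate by [- a]. *)
Definition shift_diff A a : set V :=
  (((fun x => x + a) @^-1` A) `\` A) `|` (A `\` ((fun x => x + a) @^-1` A)).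

Lemma measurable_shift_diff A a : measurable A -> measurable (shift_diff A a).
Proof.
move=> mA; have mA' := measurable_preimage_shift a mA.
by apply: measurableU; exact: measurableD.
Qed.

(* The sets with this property form a sigma-algebra which contains the strips
   [u < x_i <= v], hence all measurable sets. *)
Definition shift_continuous A := measurable A /\ forall N e, 0 < N -> 0 < e ->
  exists2 d, 0 < d &
    forall a, rV_small a d -> (mu (rV_box N `&` shift_diff A a) <= e%:E)%E.

Lemma rV_small_le a d d' : d <= d' -> rV_small a d -> rV_small a d'.
Proof. by move=> dd' ad i; exact: le_trans (ad i) dd'. Qed.

Lemma shift_continuousC A : shift_continuous A -> shift_continuous (~` A).
Proof.
move=> [mA sA]; split; first exact: measurableC.
move=> N e N0 e0; have [d d0 H] := sA N e N0 e0; exists d => // a ad.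
rewrite (_ : shift_diff (~` A) a = shift_diff A a); first exact: H.
apply/seteqP; split => x; rewrite /shift_diff /=.
  by move=> [[h1 /contrapT h2]|[h1 /contrapT h2]]; [right|left].
by move=> [[h1 h2]|[h1 h2]]; [right|left]; split => //; apply.
Qed.

Lemma measure_box_shift_diff_le A a N : measurable A ->
  measurable (rV_box N `&` shift_diff A a).
Proof.
by move=> mA; apply: measurableI; [exact: measurable_rV_box|exact: measurable_shift_diff].
Qed.

Lemma shift_continuousU A B : shift_continuous A -> shift_continuous B ->
  shift_continuous (A `|` B).
Proof.
move=> [mA sA] [mB sB]; split; first exact: measurableU.
move=> N e N0 e0.
have e20 : 0 < e / 2 by rewrite divr_gt0.
have [d1 d10 H1] := sA N _ N0 e20; have [d2 d20 H2] := sB N _ N0 e20.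
exists (Num.min d1 d2); first by rewrite lt_min d10.
move=> a ad.
have mSA := measure_box_shift_diff_le a N mA.
have mSB := measure_box_shift_diff_le a N mB.
apply: (@le_trans _ _ (mu ((rV_box N `&` shift_diff A a) `|` (rV_box N `&` shift_diff B a)))).
  apply: le_measure; rewrite ?inE.
  - by apply: measure_box_shift_diff_le; exact: measurableU.
  - exact: measurableU.
  - by move=> x [bx]; rewrite /shift_diff /=; tauto.
apply: (le_trans (measureU2 _ _ _)) => //.
rewrite [e]splitr EFinD; apply: leeD.
- by apply: H1; apply: rV_small_le ad; rewrite ge_min lexx.
- by apply: H2; apply: rV_small_le ad; rewrite ge_min lexx orbT.
Qed.

Lemma shift_continuous0 : shift_continuous set0.
Proof.
split => // N e N0 e0; exists 1 => // a _.
rewrite (_ : _ `&` _ = set0) ?measure0 ?lee_fin ?ltW//.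
by apply/seteqP; split => x //= [_]; rewrite /shift_diff /=; tauto.
Qed.

(** Inside a cube, which has finite measure, all but finitely many of the sets add arbitrarily
    little, by continuity from above. The finite union is handled by [shift_continuousU]; the rest
    has small measure, and so has its translate. *)
Lemma shift_continuous_bigcup (F : (set V)^nat) :
  (forall k, shift_continuous (F k)) -> shift_continuous (\bigcup_k F k).
Proof.
move=> sF; have mF k := (sF k).1.
have mA : measurable (\bigcup_k F k) by exact: bigcupT_measurable.
split => // N e N0 e0.
pose U K := \big[setU/set0]_(k < K) F k.
have sU K : shift_continuous (U K).
  elim: K => [|K IH]; first by rewrite /U big_ord0; exact: shift_continuous0.
  by rewrite /U big_ord_recr; exact: shift_continuousU.
(* The cube is enlarged by [1] so as to contain [x + a] together with [x] when the coordinates of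
   [a] are at most [1] in absolute value. *)
pose B K := rV_box (N + 1) `&` ((\bigcup_k F k) `\` U K).
have mB K : measurable (B K).
  apply: measurableI; first exact: measurable_rV_box.
  by apply: measurableD => //; exact: (sU K).1.
have N1 : 0 <= N + 1 by lra.
have B0 : mu (B K) @[K --> \oo] --> 0%E.
  have -> : 0%E = mu (\bigcap_K B K).
    rewrite (_ : \bigcap_K _ = set0) ?measure0//.
    apply/seteqP; split => x //= Bx.
    have [_ [[k _ Fk] _]] := Bx 0%N I.
    have [_ [_ nU]] := Bx k.+1 I; apply: nU.
    by rewrite /U big_ord_recr; right.
  apply: nonincreasing_cvg_mu => //.
  - apply: (@le_lt_trans _ _ (mu (rV_box (N + 1)))).
      apply: le_measure; rewrite ?inE; [exact: mB|exact: measurable_rV_box|].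
      by move=> x [].
    by rewrite rV_lebesgue_cube// ltry.
  - exact: bigcapT_measurable.
  - move=> i j ij; apply/subsetPset => x [bx [Ax nU]]; split => //; split => //.
    by apply: contra_not nU; rewrite /U; apply: subset_bigsetU.
have e30 : 0 < e / 3 by rewrite divr_gt0.
have [K BK] : exists K, (mu (B K) <= (e / 3)%:E)%E.
  have /fine_cvgP[_ /cvgr0Pnorm_le] := B0.
  have /fine_cvgP[fB _] := B0.
  move=> /(_ _ e30) H.
  have [K _ HK] : \forall K \near \oo, mu (B K) \is a fin_num /\ `|fine (mu (B K))| <= e / 3.
    by near=> K; split; near: K.
  exists K; have [f1 f2] := HK K (leqnn K).
  by rewrite -(fineK f1) lee_fin (le_trans (ler_norm _)).
have [d d0 H] := (sU K).2 N _ N0 e30.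
exists (Num.min d 1); first by rewrite lt_min d0/=.
move=> a ad.
have mS := measure_box_shift_diff_le a N (sU K).1.
have mB' := measurable_preimage_shift a (mB K).
apply: (@le_trans _ _ (mu ((rV_box N `&` shift_diff (U K) a) `|` (B K `|` ((fun x => x + a) @^-1` B K))))).
  apply: le_measure; rewrite ?inE.
  - exact: measure_box_shift_diff_le.
  - by apply: measurableU => //; exact: measurableU.
  - have UA : U K `<=` \bigcup_k F k.
      by rewrite /U -bigcup_mkord => x [k _ Fk]; exists k.
    move=> x [bx sx].
    have bx1 : rV_box (N + 1) x.
      by move=> i; have := bx i; rewrite !in_itv/= => /andP[? ?]; apply/andP; split; lra.
    have bxa1 : rV_box (N + 1) (x + a).
      move=> i; have := bx i; rewrite !in_itv/= !mxE => /andP[? ?].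
      have : `|a ord0 i| <= 1.
        by apply: (le_trans (ad i)); rewrite ge_min lexx orbT.
      by rewrite ler_norml => /andP[? ?]; apply/andP; split; lra.
    case: sx => -[/= h1 h2].
    + have [hU|hU] := pselect (U K (x + a)).
        by left; split => //; left; split => //= /UA.
      by right; right; split.
    + have [hU|hU] := pselect (U K x).
        by left; split => //; right; split => //= /UA.
      by right; left; split.
apply: (le_trans (measureU2 _ _ _)) => //; first exact: measurableU.
rewrite (_ : e = e / 3 + (e / 3 + e / 3)); last by field.
rewrite EFinD; apply: leeD.
  by apply: H; apply: rV_small_le ad; rewrite ge_min lexx.
apply: (le_trans (measureU2 _ _ _)) => //.
rewrite EFinD; apply: leeD => //.
by have := BK; rewrite -(rV_lebesgue_shift a (mB K)); apply.
Unshelve. all: by end_near. Qed.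

(** A point can enter or leave the strip only if its [i]-th coordinate is within [d] of [u] or of
    [v], that is, on two thin slabs of the cube. *)
Lemma shift_continuous_coor_itv (i : 'I_n) (u v : R) :
  shift_continuous ((fun x : V => x ord0 i) @^-1` `]u, v]).
Proof.
split.
  rewrite -[X in measurable X]setTI.
  exact: (measurable_rV_coor i measurableT (measurable_itv _)).
move=> N e N0 e0.
pose P : R := \prod_(j < n | j != i) (N - (- N)).
have P0 : 0 <= P by apply: prodr_ge0 => j _; lra.
(* Each slab has thickness [2 * d] and measure [2 * d * P], so the two together have measure
   [e * (P / (P + 1)) <= e]. *)
pose d := e / (4 * (P + 1)).
have d0 : 0 < d by rewrite divr_gt0// mulr_gt0//; lra.
exists d => // a ad.
pose l (c : R) : V := \row_j (if j == i then c - d else - N).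
pose r (c : R) : V := \row_j (if j == i then c + d else N).
pose strip c := [set x : V | forall j, x ord0 j \in `[l c ord0 j, r c ord0 j]].
have mstrip c : measurable (strip c) by exact: measurable_rV_rect.
have sE c : mu (strip c) = (2 * d * P)%:E.
  rewrite /strip rV_lebesgue_box; last first.
    by move=> j; rewrite !mxE; case: eqP => _; lra.
  rewrite (bigD1 i)//= !mxE eqxx; congr EFin; congr (_ * _); first by lra.
  by apply: eq_bigr => j /negbTE ji; rewrite !mxE ji.
apply: (@le_trans _ _ (mu (strip u `|` strip v))).
  apply: le_measure; rewrite ?inE.
  - apply: measure_box_shift_diff_le; rewrite -[X in measurable X]setTI.
    exact: (measurable_rV_coor i measurableT (measurable_itv _)).
  - exact: measurableU.
  - move=> x [bx sx].
    have ai : `|a ord0 i| <= d by exact: ad.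
    move: ai; rewrite ler_norml => /andP[ai1 ai2].
    have key c : c - d <= x ord0 i <= c + d -> strip c x.
      move=> xc j; rewrite !mxE; case: eqP => [->|_]; first by rewrite in_itv.
      exact: bx.
    move: sx; rewrite /shift_diff /= !in_itv/= !mxE.
    move=> [[/andP[h1 h2] /negP]|[/andP[h1 h2] /negP]];
      rewrite negb_and -leNgt -ltNge => /orP[h3|h3].
    + by left; apply: key; lra.
    + by right; apply: key; lra.
    + by left; apply: key; lra.
    + by right; apply: key; lra.
apply: (le_trans (measureU2 _ _ _)) => //.
rewrite [X in (X + _ <= _)%E]sE [X in (_ + X <= _)%E]sE -EFinD lee_fin.
have -> : 2 * d * P + 2 * d * P = e * (P / (P + 1)) by rewrite /d; field; lra.
have PP : P / (P + 1) <= 1 by rewrite ler_pdivrMr; lra.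
by rewrite ler_piMr// ltW.
Qed.

Lemma shift_continuous_coor (i : 'I_n) (Y : set (measurableTypeR R)) : measurable Y ->
  shift_continuous ((fun x : V => x ord0 i) @^-1` Y).
Proof.
move=> mY; suff : [set Y | shift_continuous ((fun x : V => x ord0 i) @^-1` Y)] Y by [].
move: Y mY; apply: smallest_sub.
- split => /=.
  + by rewrite preimage_set0; exact: shift_continuous0.
  + by move=> A sA; rewrite setTD preimage_setC; exact: shift_continuousC.
  + by move=> F sF; rewrite preimage_bigcup; exact: shift_continuous_bigcup.
- by move=> _ [[u v] _ <-] /=; exact: shift_continuous_coor_itv.
Qed.

Lemma measurable_shift_continuous A : measurable A -> shift_continuous A.
Proof.
apply: smallest_sub.
- split => /=.
  + exact: shift_continuous0.
  + by move=> B sB; rewrite setTD; exact: shift_continuousC.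
  + by move=> F sF; exact: shift_continuous_bigcup.
- rewrite -bigcup_seq; apply: bigcup_sub => i _ B [Y mY <-] /=.
  by rewrite setTI; exact: shift_continuous_coor.
Qed.

End translation_sets.

(** * Translations of square-integrable functions *)

Lemma dominated_convergence_EFin d (T : measurableType d) (R : realType)
    (mu : {measure set T -> \bar R}) (f_ : nat -> T -> R) (f g : T -> R) :
  (forall k, measurable_fun setT (f_ k)) -> measurable_fun setT f ->
  (forall x, f_ k x @[k --> \oo] --> f x) ->
  mu.-integrable setT (EFin \o g) -> (forall k x, `|f_ k x| <= g x) ->
  (\int[mu]_x (f_ k x)%:E)%E @[k --> \oo] --> (\int[mu]_x (f x)%:E)%E.
Proof.
move=> mf_ mf ff ig fg.
have [||||_ _] := @dominated_convergence _ _ _ mu setT measurableT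
  (fun k x => (f_ k x)%:E) (EFin \o f) (EFin \o g) _ _ _ ig _ => //.
- by move=> k; exact/measurable_EFinP.
- exact/measurable_EFinP.
- by apply: nearW => x _; exact: cvg_EFin (nearW _ _) (ff x).
- by apply: nearW => x k _; rewrite lee_fin.
Qed.

Lemma ge0_integralZ_indic d (T : measurableType d) (R : realType)
    (mu : {measure set T -> \bar R}) (A : set T) (c : R) : measurable A -> 0 <= c ->
  (\int[mu]_x (c%:E * (\1_A x)%:E) = c%:E * mu A)%E.
Proof.
move=> mA c0; rewrite ge0_integralZl//.
- by rewrite integral_indic ?setIT.
- by apply/measurable_EFinP; exact: measurable_indic.
Qed.

Section translation_L2.
Context {R : realType} {n : nat}.
Local Notation V := 'rV[R]_n.
Local Notation mu := (@rV_lebesgue R n).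
Implicit Types (a x : V) (e : R) (g h : V -> R).

Lemma shift_continuous_family (A : nat -> set V) (K : nat) (N e : R) :
  (forall j, measurable (A j)) -> 0 < N -> 0 < e ->
  exists2 d, 0 < d & forall a, rV_small a d ->
    (mu (\big[setU/set0]_(j < K) (rV_box N `&` shift_diff (A j) a)) <= e%:E)%E.
Proof.
move=> mA N0; elim: K e => [|K IH] e e0.
  by exists 1 => // a _; rewrite big_ord0 measure0 lee_fin ltW.
have e20 : 0 < e / 2 by rewrite divr_gt0.
have [d1 d10 H1] := IH _ e20.
have [d2 d20 H2] := (measurable_shift_continuous (mA K)).2 N _ N0 e20.
exists (Num.min d1 d2); first by rewrite lt_min d10.
move=> a ad; rewrite big_ord_recr /=.
have mS j := measure_box_shift_diff_le a N (mA j).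
apply: (le_trans (measureU2 _ _ _)) => //.
  exact: bigsetU_measurable.
rewrite [e]splitr EFinD; apply: leeD.
- by apply: H1; apply: rV_small_le ad; rewrite ge_min lexx.
- by apply: H2; apply: rV_small_le ad; rewrite ge_min lexx orbT.
Qed.

(** Reduction to sets: the range of [g] is cut by thresholds of mesh [c]. Outside the symmetric
    differences of the superlevel sets, [g (x + a)] and [g x] pass the same thresholds, hence differ
    by at most [c]; on these differences, whose measure is small, the bound [2 * M] is enough. *)
Lemma bounded_shift_L2 g (M N e : R) : measurable_fun setT g ->
  (forall x, `|g x| <= M) -> 0 < N -> (forall x, ~ rV_box N x -> g x = 0) ->
  0 < e -> exists2 d, 0 < d & forall a, rV_small a d ->
    (\int[mu]_x ((g (x + a) - g x) ^+ 2)%:E <= e%:E)%E.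
Proof.
move=> mg gM N0 gN e0.
have M0 : 0 <= M by apply: le_trans (gM 0).
pose m : R := (2 * (N + 1)) ^+ n.
have N1 : 0 <= N + 1 by lra.
have m0 : 0 <= m by rewrite exprn_ge0// mulr_ge0.
(* The cap at [1] gives [c ^+ 2 <= c], so that a bound on [c * m] controls [c ^+ 2 * m]. *)
pose c := Num.min 1 (e / (2 * (m + 1))).
have c0 : 0 < c by rewrite lt_min ltr01 divr_gt0// mulr_gt0//; lra.
have c1 : c <= 1 by rewrite ge_min lexx.
have cm : c ^+ 2 * m <= e / 2.
  have : c <= e / (2 * (m + 1)) by rewrite ge_min lexx orbT.
  rewrite ler_pdivlMr ?mulr_gt0//; last by lra.
  move=> h; have c2 : c ^+ 2 <= c by rewrite expr2 ler_piMr// ltW.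
  nra.
pose J := (Num.truncn (M / c)).+1.
have JM : M < J%:R * c.
  by rewrite -ltr_pdivrMr// truncnS_gt.
pose t (j : nat) : R := (j%:R - J%:R) * c.
pose A (j : nat) : set V := [set x | t j < g x].
have mA j : measurable (A j).
  rewrite (_ : A j = setT `&` g @^-1` `]t j, +oo[); first exact: mg.
  by apply/seteqP; split => x /=; rewrite in_itv/= andbT /A /=; tauto.
have e40 : 0 < e / (2 * (4 * M ^+ 2 + 1)).
  by rewrite divr_gt0// mulr_gt0// ltr_wpDl// mulr_ge0// sqr_ge0.
have [d d0 H] := shift_continuous_family (2 * J).+2 mA (ltr_wpDl (ltW N0) ltr01) e40.
exists (Num.min d 1); first by rewrite lt_min d0/=.
move=> a ad.
have {}H := H a (rV_small_le _ ad).
have {}H : (mu (\big[setU/set0]_(j < (2 * J).+2) (rV_box (N + 1) `&` shift_diff (A j) a)) <= (e / (2 * (4 * M ^+ 2 + 1)))%:E)%E.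
  by apply: H; rewrite ge_min lexx.
set S := \big[setU/set0]_(j < _) _ in H.
have mS : measurable S.
  by apply: bigsetU_measurable => j _; exact: measure_box_shift_diff_le.
have mB := @measurable_rV_box R n (N + 1).
have mga : measurable_fun setT (fun x => (g (x + a) - g x) ^+ 2).
  apply: measurable_funX; apply: measurable_funB => //.
  exact: measurableT_comp mg (measurable_shift_rV a).
apply: (@le_trans _ _ (\int[mu]_x ((c ^+ 2)%:E * (\1_(rV_box (N + 1)) x)%:E + (4 * M ^+ 2)%:E * (\1_S x)%:E))%E).
  apply: ge0_le_integral => //.
  - by move=> x _; rewrite lee_fin sqr_ge0.
  - exact/measurable_EFinP.
  - apply/measurable_EFinP; apply: measurable_funD; apply: measurable_funM => //;
      exact: measurable_indic.
  - move=> x _; rewrite -!EFinM -EFinD lee_fin !indicE.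
    have [bx|bx] := pselect (rV_box (N + 1) x); last first.
      have z1 : g x = 0.
        apply: gN; apply: contra_not bx => b i; have := b i.
        by rewrite !in_itv/= => /andP[? ?]; apply/andP; split; lra.
      have z2 : g (x + a) = 0.
        apply: gN; apply: contra_not bx => b i; have := b i.
        have : `|a ord0 i| <= 1 by apply: (le_trans (ad i)); rewrite ge_min lexx orbT.
        rewrite !in_itv/= !mxE ler_norml => /andP[? ?] /andP[? ?]; apply/andP; split; lra.
      rewrite z1 z2 subrr expr0n /= addr_ge0// mulr_ge0 ?sqr_ge0//.
      by rewrite mulr_ge0// sqr_ge0.
    rewrite mem_set// mulr1.
    have [Sx|Sx] := pselect (S x).
      rewrite [in leRHS]mem_set// mulr1.
      have := gM x; have := gM (x + a); rewrite !ler_norml => /andP[? ?] /andP[? ?].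
      have : `|g (x + a) - g x| <= 2 * M by rewrite ler_norml; apply/andP; split; lra.
      move=> h; rewrite -(real_normK (num_real (_ - _))) (_ : 4 * M ^+ 2 = (2 * M) ^+ 2); last by ring.
      by rewrite ler_wpDl ?sqr_ge0// lerXn2r// nnegrE mulr_ge0.
    rewrite [X in _ + _ * X](_ : _ = 0) ?mulr0 ?addr0; last by rewrite memNset.
    (* If [q - p > c], the first threshold above [p] lies below [q] and separates the two values.
       Its index is at most [2 * J + 1], which is why [(2 * J).+2] sets are taken. *)
    have key p q : `|p| <= M -> `|q| <= M ->
        (forall j, (j < (2 * J).+2)%N -> (t j < p) = (t j < q)) -> q - p <= c.
      move=> pM qM tpq; rewrite leNgt; apply/negP => cpq.
      move: pM; rewrite ler_norml => /andP[pM1 pM2].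
      have pJ : 0 <= p / c + J%:R.
        by rewrite -lerBlDr sub0r ler_pdivlMr// mulNr; lra.
      have /andP[k1 k2] := truncn_itv pJ.
      set k := Num.truncn _ in k1 k2.
      have tk1 : p < t k.+1 by rewrite /t -ltr_pdivrMr// ltrBrDr.
      have tk2 : t k.+1 < q.
        rewrite /t -natr1; have : k%:R - J%:R <= p / c by rewrite lerBlDr.
        rewrite ler_pdivlMr// => h.
        rewrite (_ : (_ - _) * c = (k%:R - J%:R) * c + c); last by ring.
        by lra.
      have : (k.+1 < (2 * J).+2)%N.
        rewrite ltnS ltnS -(@ler_nat R) (le_trans k1)// natrM.
        have : p / c <= J%:R by rewrite ler_pdivrMr// ltW// (le_lt_trans pM2).
        by lra.
      by move=> /tpq; rewrite tk2 ltNge (ltW tk1).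
    have nS j : (j < (2 * J).+2)%N -> (t j < g (x + a)) = (t j < g x).
      move=> jK; apply/idP/idP => h; apply/negPn/negP => h'; apply: Sx;
      rewrite /S -(bigcup_mkord _ (fun j => rV_box (N + 1) `&` shift_diff (A j) a)); exists j => //; split => //; [left|right]; split => //;
      exact/negP.
    have b1 := key _ _ (gM x) (gM (x + a)) (fun j jK => esym (nS j jK)).
    have b2 := key _ _ (gM (x + a)) (gM x) nS.
    by rewrite -(real_normK (num_real (_ - _))) lerXn2r ?nnegrE ?normr_ge0 ?(ltW c0)// ler_norml; apply/andP; split; lra.
rewrite ge0_integralD//; last 4 first.
- by move=> x _; rewrite -EFinM lee_fin mulr_ge0 ?sqr_ge0.
- apply/measurable_EFinP; apply: measurable_funM => //; exact: measurable_indic.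
- by move=> x _; rewrite -EFinM lee_fin mulr_ge0 ?mulr_ge0 ?sqr_ge0.
- apply/measurable_EFinP; apply: measurable_funM => //; exact: measurable_indic.
have M40 : 0 <= 4 * M ^+ 2 by rewrite mulr_ge0// sqr_ge0.
rewrite (ge0_integralZ_indic mu mB (sqr_ge0 c)) (ge0_integralZ_indic mu mS M40).
rewrite [X in ((c ^+ 2)%:E * X)%E]rV_lebesgue_cube//.
rewrite [e]splitr EFinD; apply: leeD; first by rewrite -EFinM lee_fin.
apply: (@le_trans _ _ ((4 * M ^+ 2)%:E * (e / (2 * (4 * M ^+ 2 + 1)))%:E)%E).
  by apply: lee_wpmul2l => //; rewrite lee_fin mulr_ge0// sqr_ge0.
rewrite -EFinM lee_fin.
set q := 4 * M ^+ 2; have q0 : 0 <= q by rewrite mulr_ge0// sqr_ge0.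
have -> : q * (e / (2 * (q + 1))) = e / 2 * (q / (q + 1)) by field; lra.
have qq : q / (q + 1) <= 1 by rewrite ler_pdivrMr; lra.
by rewrite ler_piMr// ltW// divr_gt0.
Qed.

(** Truncating [h] in space and in height gives a bounded [g k], close to [h] in [L^2] by dominated
    convergence. The triangle inequality has three terms, each with squared norm at most [e / 9],
    and the square of a sum of three costs a factor [3]. *)
Lemma shift_L2 h e : measurable_fun setT h ->
  mu.-integrable setT (fun x => ((h x) ^+ 2)%:E) -> 0 < e ->
  exists2 d, 0 < d & forall a, rV_small a d ->
    (\int[mu]_x ((h (x + a) - h x) ^+ 2)%:E <= e%:E)%E.
Proof.
move=> mh ih e0.
pose D (k : nat) : set V := rV_box k.+1%:R `&` [set x | `|h x| <= k.+1%:R].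
have mD k : measurable (D k).
  apply: measurableI; first exact: measurable_rV_box.
  rewrite (_ : [set _ | _] = setT `&` (fun x => `|h x|) @^-1` `]-oo, k.+1%:R]).
    by apply: measurableT_comp => //; exact: measurable_itv.
  by apply/seteqP; split => x /=; rewrite in_itv/=; tauto.
pose g (k : nat) : V -> R := fun x => h x * \1_(D k) x.
have mg k : measurable_fun setT (g k).
  by apply: measurable_funM => //; exact: measurable_indic.
have cvg0 : (\int[mu]_x ((g k x - h x) ^+ 2)%:E)%E @[k --> \oo] --> 0%E.
  rewrite [X in _ --> X](_ : _ = (\int[mu]_x (0 : R)%:E)%E); last by rewrite integral0.
  apply: (@dominated_convergence_EFin _ _ _ mu (fun k x => (g k x - h x) ^+ 2)
    (fun=> 0) (fun x => h x ^+ 2)) => //.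
  - by move=> k; apply: measurable_funX; exact: measurable_funB.
  - move=> x; apply: (@cvg_near_cst).
    pose k0 := (Num.truncn (Num.max `|h x| (\sum_i `|x ord0 i|))).+1.
    have k0P : Num.max `|h x| (\sum_i `|x ord0 i|) < k0%:R by rewrite truncnS_gt.
    exists k0 => // k /= kk0.
    have kk : k0%:R <= k.+1%:R :> R by rewrite ler_nat (leq_trans kk0).
    move: k0P; rewrite gt_max => /andP[h1 h2].
    rewrite /g indicE mem_set ?mulr1 ?subrr ?expr0n//.
    split; last by rewrite /= ltW// (lt_le_trans h1).
    move=> i; rewrite in_itv/= -ler_norml (le_trans _ kk)// (le_trans _ (ltW h2))//.
    by rewrite (bigD1 i)//= lerDl sumr_ge0.
  - move=> k x; rewrite ger0_norm ?sqr_ge0// /g indicE.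
    by case: (_ \in _); rewrite ?mulr1 ?mulr0 ?subrr ?sub0r ?sqrrN ?expr0n ?sqr_ge0.
have e90 : 0 < e / 9 by rewrite divr_gt0.
have [k gk] : exists k, (\int[mu]_x ((g k x - h x) ^+ 2)%:E <= (e / 9)%:E)%E.
  have /fine_cvgP[fB /cvgr0Pnorm_le /(_ _ e90) H] := cvg0.
  have [K _ HK] : \forall K \near \oo, (\int[mu]_x ((g K x - h x) ^+ 2)%:E)%E \is a fin_num
     /\ `|fine (\int[mu]_x ((g K x - h x) ^+ 2)%:E)%E| <= e / 9.
    by near=> K; split; near: K.
  exists K; have [f1 f2] := HK K (leqnn K).
  by rewrite -(fineK f1) lee_fin (le_trans (ler_norm _)).
have [d d0 H] : exists2 d, 0 < d & forall a, rV_small a d ->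
    (\int[mu]_x ((g k (x + a) - g k x) ^+ 2)%:E <= (e / 9)%:E)%E.
  apply: (@bounded_shift_L2 (g k) k.+1%:R k.+1%:R) => //.
  - move=> x; rewrite /g indicE; have [Dx|Dx] := boolP (x \in D k).
      by rewrite mulr1; move: Dx; rewrite inE => -[].
    by rewrite mulr0 normr0.
  - move=> x bx; rewrite /g indicE memNset ?mulr0//.
    by move=> [].
exists d => // a ad.
have mhs : measurable_fun setT (fun x => (g k x - h x) ^+ 2).
  by apply: measurable_funX; exact: measurable_funB.
have mgs : measurable_fun setT (fun x => (g k (x + a) - g k x) ^+ 2).
  apply: measurable_funX; apply: measurable_funB => //.
  exact: measurableT_comp (mg k) (measurable_shift_rV a).
have mhsa : measurable_fun setT (fun x => (g k (x + a) - h (x + a)) ^+ 2).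
  exact: (measurableT_comp mhs (measurable_shift_rV a)).
have sq0 (y : R) : (0 <= (y ^+ 2)%:E)%E by rewrite lee_fin sqr_ge0.
apply: (@le_trans _ _ (\int[mu]_x (3%:E * (((g k (x + a) - h (x + a)) ^+ 2)%:E
     + (((g k (x + a) - g k x) ^+ 2)%:E + ((g k x - h x) ^+ 2)%:E))))%E).
  apply: ge0_le_integral => //.
  - apply/measurable_EFinP; apply: measurable_funX; apply: measurable_funB => //.
    exact: measurableT_comp mh (measurable_shift_rV a).
  - by apply/measurable_EFinP; apply: measurable_funM => //; apply: measurable_funD => //; apply: measurable_funD.
  - move=> x _; rewrite -!EFinD -EFinM lee_fin.
    set p := h (x + a); set q := g k (x + a); set r := g k x; set s := h x.
    have -> : p - s = - (q - p) + (q - r) + (r - s) by ring.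
    set u := q - p; set v := q - r; set w := r - s.
    have := sqr_ge0 (u + v); have := sqr_ge0 (u + w); have := sqr_ge0 (v - w).
    nra.
rewrite ge0_integralZl//; last 2 first.
- by apply/measurable_EFinP; apply: measurable_funD => //; apply: measurable_funD.
- by move=> x _; rewrite !adde_ge0.
rewrite ge0_integralD//; [|exact/measurable_EFinP|by move=> x _; rewrite adde_ge0|by apply/measurable_EFinP; apply: measurable_funD].
rewrite ge0_integralD//; [|exact/measurable_EFinP|exact/measurable_EFinP].
have E := @ge0_integral_shift_rV R n (fun x => ((g k x - h x) ^+ 2)%:E) a _ _.
rewrite E//; last exact/measurable_EFinP.
rewrite (_ : e%:E = 3%:E * ((e / 9)%:E + ((e / 9)%:E + (e / 9)%:E)))%E; last first.
  by rewrite -!EFinD -EFinM; congr EFin; field.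
apply: lee_wpmul2l; first by rewrite lee_fin.
by apply: leeD => //; apply: leeD => //; exact: H.
Unshelve. all: by end_near. Qed.

End translation_L2.

(** * Fubini's theorem and affine changes of variables for real integrals *)

Section more_fubini.
Context {R : realType}.

Lemma Rfubini d1 d2 (T1 : measurableType d1) (T2 : measurableType d2)
    (m1 : {sigma_finite_measure set T1 -> \bar R})
    (m2 : {sigma_finite_measure set T2 -> \bar R}) (F : T1 * T2 -> R) :
  (m1 \x m2)%E.-integrable setT (EFin \o F) ->
  (forall x, m2.-integrable setT (EFin \o (fun y => F (x, y)))) ->
  (forall y, m1.-integrable setT (EFin \o (fun x => F (x, y)))) ->
  \int[m1]_x \int[m2]_y F (x, y) = \int[m2]_y \int[m1]_x F (x, y).
Proof.
move=> iF i2 i1; rewrite /Rintegral.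
transitivity (fine (\int[m1]_x \int[m2]_y (F (x, y))%:E)%E).
  by congr fine; apply: eq_integral => x _; rewrite -EFin_Rintegral.
have := Fubini iF; rewrite /= => ->; congr fine.
by apply: eq_integral => y _; rewrite -EFin_Rintegral.
Qed.

Lemma integrable_scaler d (T : measurableType d) (mu : {measure set T -> \bar R})
    (c : R) (f : T -> R) : mu.-integrable setT (EFin \o f) ->
  mu.-integrable setT (EFin \o (fun x => c * f x)).
Proof. by move=> fi; rewrite (_ : _ \o _ = (fun x => c%:E * (f x)%:E)%E)//; exact: integrableZl. Qed.

Lemma integrable_addr d (T : measurableType d) (mu : {measure set T -> \bar R})
    (f g : T -> R) : mu.-integrable setT (EFin \o f) -> mu.-integrable setT (EFin \o g) ->
  mu.-integrable setT (EFin \o (fun x => f x + g x)).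
Proof.
move=> fi gi; rewrite (_ : _ \o _ = ((EFin \o f) \+ (EFin \o g))%E)//.
exact: integrableD.
Qed.

Lemma integrable_measurable_real d (T : measurableType d) (mu : {measure set T -> \bar R})
    (f : T -> R) : mu.-integrable setT (EFin \o f) -> measurable_fun setT f.
Proof. by move=> fi; apply/measurable_EFinP/(measurable_int _ fi). Qed.

Context {n : nat}.
Local Notation V := 'rV[R]_n.
Local Notation mu := (@rV_lebesgue R n).

Lemma integrable_rV_affine (s : R) (a : V) (G : V -> R) : 0 < s ->
  mu.-integrable setT (EFin \o G) ->
  mu.-integrable setT (EFin \o (fun x => G (s *: x + a))).
Proof.
move=> s0 iG; have mG := integrable_measurable_real iG.
apply/integrableP; split.
  by apply/measurable_EFinP; exact: (measurableT_comp mG (measurable_affine_rV s a)).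
rewrite (@ge0_integral_rV_affine R n s a (abse \o (EFin \o G)) s0); last 2 first.
- by apply: measurableT_comp => //; exact/measurable_EFinP.
- by move=> x; exact: abse_ge0.
move/integrableP : iG => [_ iG].
by rewrite lte_mul_pinfty// lee_fin invr_ge0 exprn_ge0// ltW.
Qed.

Lemma Rintegral_rV_affine (s : R) (a : V) (G : V -> R) : 0 < s ->
  mu.-integrable setT (EFin \o G) ->
  \int[mu]_x G (s *: x + a) = s ^- n * \int[mu]_x G x.
Proof.
move=> s0 iG; have mG := integrable_measurable_real iG.
have mGE : measurable_fun setT (EFin \o G) by exact/measurable_EFinP.
apply: EFin_inj; rewrite EFin_Rintegral; last exact: integrable_rV_affine.
rewrite EFinM EFin_Rintegral// [in LHS]integralE [in RHS]integralE.
rewrite muleBr//; last first.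
  rewrite fin_num_adde_defr//; apply: integrable_fin_num => //.
  exact: integrable_funepos.
rewrite -(@ge0_integral_rV_affine R n s a (EFin \o G)^\+%E)//; last exact: measurable_funepos.
rewrite -(@ge0_integral_rV_affine R n s a (EFin \o G)^\-%E)//; last exact: measurable_funeneg.
by congr (_ - _)%E; apply: eq_integral => x _; rewrite ?funeposE ?funenegE.
Qed.

End more_fubini.

(** * Plancherel's identity *)

Section trig_transforms.
Context {R : realType} {n : nat}.
Local Notation V := 'rV[R]_n.
Local Notation mu := (@rV_lebesgue R n).
Implicit Types (h : V -> R) (x y z xi : V).

(** Up to the normalising constant, [fcos] and [- fsin] are the real and imaginary parts of
    [fourier]; using them keeps all integrals real. *)
Definition fcos h xi : R := \int[mu]_x (h x * cos (dotmx x xi)).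
Definition fsin h xi : R := \int[mu]_x (h x * sin (dotmx x xi)).

Lemma normr_cos_le1 (x : R) : `|cos x| <= 1.
Proof. by rewrite ler_norml cos_geN1 cos_le1. Qed.

Lemma normr_sin_le1 (x : R) : `|sin x| <= 1.
Proof. by rewrite ler_norml sin_geN1 sin_le1. Qed.

Lemma measurable_dotmxr z : measurable_fun setT (fun x : V => dotmx z x).
Proof. by under eq_fun do rewrite dotmxC; exact: measurable_dotmx. Qed.

Lemma measurable_fcos h : measurable_fun setT h -> measurable_fun setT (fcos h).
Proof.
move=> mh; apply: (@measurable_Rintegral_param _ _ _ _ _ mu (fun p : V * V => h p.2 * cos (dotmx p.2 p.1))).
apply: measurable_funM; first exact: (measurableT_comp mh measurable_snd).
apply: (measurableT_comp measurable_cos).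
by under eq_fun do rewrite dotmxC; exact: measurable_dotmx2.
Qed.

Lemma measurable_fsin h : measurable_fun setT h -> measurable_fun setT (fsin h).
Proof.
move=> mh; apply: (@measurable_Rintegral_param _ _ _ _ _ mu (fun p : V * V => h p.2 * sin (dotmx p.2 p.1))).
apply: measurable_funM; first exact: (measurableT_comp mh measurable_snd).
apply: (measurableT_comp measurable_sin).
by under eq_fun do rewrite dotmxC; exact: measurable_dotmx2.
Qed.

Section L1.
Variable h : V -> R.
Hypothesis ih : mu.-integrable setT (EFin \o h).
Let mh := integrable_measurable_real ih.

Lemma integrable_Mbounded (b : V -> R) : measurable_fun setT b ->
  (forall x, `|b x| <= 1) -> mu.-integrable setT (EFin \o (fun x => h x * b x)).
Proof.
move=> mb b1; apply: (@le_integrable_real _ _ _ _ _ (fun x => `|h x|)).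
- exact: measurable_funM.
- by move=> x; rewrite normrM ler_piMr.
- exact: (integrable_abse ih).
Qed.

Lemma integrable_Mcos xi : mu.-integrable setT (EFin \o (fun x => h x * cos (dotmx x xi))).
Proof.
apply: integrable_Mbounded => [|x]; last exact: normr_cos_le1.
exact: (measurableT_comp measurable_cos (measurable_dotmx xi)).
Qed.

Lemma integrable_Msin xi : mu.-integrable setT (EFin \o (fun x => h x * sin (dotmx x xi))).
Proof.
apply: integrable_Mbounded => [|x]; last exact: normr_sin_le1.
exact: (measurableT_comp measurable_sin (measurable_dotmx xi)).
Qed.

Lemma Rintegral_Mbounded_le (b : V -> R) : measurable_fun setT b ->
  (forall x, `|b x| <= 1) -> `|\int[mu]_x (h x * b x)| <= \int[mu]_x `|h x|.
Proof.
move=> mb b1; have ihb := integrable_Mbounded mb b1.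
apply: (le_trans (le_normr_Rintegral _ ihb)) => //.
apply: le_Rintegral => //.
- exact: (integrable_abse ihb).
- exact: (integrable_abse ih).
- by move=> x _; rewrite normrM ler_piMr.
Qed.

Lemma fcos_le xi : `|fcos h xi| <= \int[mu]_x `|h x|.
Proof.
apply: Rintegral_Mbounded_le => [|x]; last exact: normr_cos_le1.
exact: (measurableT_comp measurable_cos (measurable_dotmx xi)).
Qed.

Lemma fsin_le xi : `|fsin h xi| <= \int[mu]_x `|h x|.
Proof.
apply: Rintegral_Mbounded_le => [|x]; last exact: normr_sin_le1.
exact: (measurableT_comp measurable_sin (measurable_dotmx xi)).
Qed.

Lemma fcos_fsin_combo (A B : R) xi :
  \int[mu]_x (h x * (cos (dotmx x xi) * A + sin (dotmx x xi) * B)) =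
  fcos h xi * A + fsin h xi * B.
Proof.
transitivity (\int[mu]_x (A * (h x * cos (dotmx x xi)) + B * (h x * sin (dotmx x xi)))).
  by congr Rintegral; apply/funext => x; ring.
rewrite RintegralD//; last 2 first.
- exact/integrable_scaler/integrable_Mcos.
- exact/integrable_scaler/integrable_Msin.
rewrite RintegralZl//; last exact: integrable_Mcos.
rewrite RintegralZl//; last exact: integrable_Msin.
by rewrite -/(fcos h xi) -/(fsin h xi); ring.
Qed.

Lemma dotmxNl x xi : dotmx (- x) xi = - dotmx x xi.
Proof. by rewrite -scaleN1r dotmxZl mulN1r. Qed.

(** By the addition formula the power spectrum is the double integral of
    [h x * h y * cos (dotmx (x - y) xi)]. The weight [Phi] makes everything absolutely integrable,
    so the integral in [xi] can be moved inside. *)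
Lemma integral_power_spectrum (Phi : V -> R) :
  mu.-integrable setT (EFin \o Phi) ->
  \int[mu]_xi ((fcos h xi ^+ 2 + fsin h xi ^+ 2) * Phi xi) =
  \int[mu]_x (h x * \int[mu]_y (h y * \int[mu]_xi (Phi xi * cos (dotmx (x - y) xi)))).
Proof.
move=> iP; have mP := integrable_measurable_real iP.
have mC := measurable_fcos mh; have mS := measurable_fsin mh.
pose N := \int[mu]_x `|h x|.
have N0 : 0 <= N by apply: Rintegral_ge0.
have combo x xi : `|cos (dotmx x xi) * fcos h xi + sin (dotmx x xi) * fsin h xi| <= 2 * N.
  rewrite (le_trans (ler_normD _ _))// !normrM mulr_natl mulr2n.
  by apply: lerD; rewrite -[leRHS]mul1r ler_pM// ?normr_cos_le1 ?normr_sin_le1 ?fcos_le ?fsin_le.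
(* Only one of the two transforms is opened here; the other stays bounded by the [L^1] norm and is
   opened by [F2]. *)
pose F1 (p : V * V) := h p.2 * (cos (dotmx p.2 p.1) * fcos h p.1 + sin (dotmx p.2 p.1) * fsin h p.1) * Phi p.1.
have mdot : measurable_fun setT (fun p : V * V => dotmx p.2 p.1).
  by under eq_fun do rewrite dotmxC; exact: measurable_dotmx2.
have mF1 : measurable_fun setT F1.
  apply: measurable_funM; last exact: (measurableT_comp mP measurable_fst).
  apply: measurable_funM; first exact: (measurableT_comp mh measurable_snd).
  apply: measurable_funD; apply: measurable_funM.
  - exact: (measurableT_comp measurable_cos mdot).
  - exact: (measurableT_comp mC measurable_fst).
  - exact: (measurableT_comp measurable_sin mdot).
  - exact: (measurableT_comp mS measurable_fst).
transitivity (\int[mu]_xi \int[mu]_x F1 (xi, x)).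
  congr Rintegral; apply/funext => xi; rewrite /F1 /=.
  transitivity (\int[mu]_x (Phi xi * (h x * (cos (dotmx x xi) * fcos h xi + sin (dotmx x xi) * fsin h xi)))); last first.
    by congr Rintegral; apply/funext => x; rewrite mulrC.
  rewrite RintegralZl//; first by rewrite fcos_fsin_combo mulrC !expr2.
  rewrite (_ : (fun x => _) = (fun x => fcos h xi * (h x * cos (dotmx x xi)) + fsin h xi * (h x * sin (dotmx x xi)))); last first.
    by apply/funext => x; ring.
  apply: integrable_addr.
  - exact/integrable_scaler/integrable_Mcos.
  - exact/integrable_scaler/integrable_Msin.
rewrite (@Rfubini_dom _ _ _ _ _ mu mu F1 (fun xi => 2 * N * Phi xi) h)//; last 2 first.
- exact: integrable_scaler.
- move=> xi x; rewrite /F1 /= normrM (normrM (h x)) -mulrA [leLHS]mulrC.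
  apply: ler_wpM2r => //; rewrite !normrM; apply: ler_wpM2r => //.
  by rewrite (ger0_norm N0) (ger0_norm (ler0n _ 2)) combo.
congr Rintegral; apply/funext => x; rewrite /F1 /=.
pose F2 (p : V * V) := h p.2 * cos (dotmx (x - p.2) p.1) * Phi p.1.
have mdot2 : measurable_fun setT (fun p : V * V => dotmx (x - p.2) p.1).
  rewrite (_ : (fun p : V * V => _) = (fun p : V * V => dotmx p.1 x - dotmx p.1 p.2)); last first.
    by apply/funext => p; rewrite dotmxDl dotmxNl dotmxC (dotmxC p.2).
  apply: measurable_funB; last exact: measurable_dotmx2.
  exact: (measurableT_comp (measurable_dotmx x) measurable_fst).
have mF2 : measurable_fun setT F2.
  apply: measurable_funM; last exact: (measurableT_comp mP measurable_fst).
  apply: measurable_funM; first exact: (measurableT_comp mh measurable_snd).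
  exact: (measurableT_comp measurable_cos mdot2).
transitivity (\int[mu]_xi (h x * ((cos (dotmx x xi) * fcos h xi + sin (dotmx x xi) * fsin h xi) * Phi xi))).
  by congr Rintegral; apply/funext => xi; rewrite mulrA.
have E xi : (cos (dotmx x xi) * fcos h xi + sin (dotmx x xi) * fsin h xi) * Phi xi = \int[mu]_y F2 (xi, y).
  rewrite /F2 /=.
  transitivity (\int[mu]_y (Phi xi * (h y * (cos (dotmx y xi) * cos (dotmx x xi) + sin (dotmx y xi) * sin (dotmx x xi))))).
    rewrite RintegralZl//; first by rewrite fcos_fsin_combo; ring.
    apply: integrable_Mbounded.
      by apply: measurable_funD; apply: measurable_funM => //;
        [exact: (measurableT_comp measurable_cos (measurable_dotmx xi))|
         exact: (measurableT_comp measurable_sin (measurable_dotmx xi))].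
    by move=> y; rewrite -cosB normr_cos_le1.
  congr Rintegral; apply/funext => y.
  by rewrite dotmxDl dotmxNl cosB; ring.
rewrite RintegralZl//; last first.
  apply: (@le_integrable_real _ _ _ _ _ (fun xi => 2 * N * `|Phi xi|)).
  - apply: measurable_funM => //; apply: measurable_funD; apply: measurable_funM => //.
    + exact: (measurableT_comp measurable_cos (measurable_dotmxr x)).
    + exact: (measurableT_comp measurable_sin (measurable_dotmxr x)).
  - by move=> xi; rewrite normrM ler_wpM2r// combo.
  - by apply: integrable_scaler; exact: (integrable_abse iP).
congr (_ * _).
under eq_Rintegral do rewrite E.
rewrite (@Rfubini_dom _ _ _ _ _ mu mu F2 Phi h)//; last first.
  move=> xi y; rewrite /F2 /= !normrM mulrC ler_wpM2l// ler_piMr//.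
  exact: normr_cos_le1.
congr Rintegral; apply/funext => y; rewrite /F2 /=.
rewrite -RintegralZl//.
  by congr Rintegral; apply/funext => xi; ring.
apply: (@le_integrable_real _ _ _ _ _ (fun xi => `|Phi xi|)).
- apply: measurable_funM => //.
  exact: (measurableT_comp measurable_cos (measurable_dotmxr _)).
- by move=> xi; rewrite normrM ler_piMr// normr_cos_le1.
- exact: (integrable_abse iP).
Qed.

End L1.
End trig_transforms.

Section plancherel.
Context {R : realType} {n : nat}.
Local Notation V := 'rV[R]_n.
Local Notation mu := (@rV_lebesgue R n).
Implicit Types (a x y z w xi : V).

Lemma integrable_rV_shift (G : V -> R) a : mu.-integrable setT (EFin \o G) ->
  mu.-integrable setT (EFin \o (fun x => G (x + a))).
Proof.
move=> iG; have := integrable_rV_affine a ltr01 iG.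
by rewrite (_ : (fun x => G (1 *: x + a)) = (fun x => G (x + a)))//; apply/funext => x; rewrite scale1r.
Qed.

Lemma Rintegral_rV_shift (G : V -> R) a : mu.-integrable setT (EFin \o G) ->
  \int[mu]_x G (x + a) = \int[mu]_x G x.
Proof.
move=> iG; have := Rintegral_rV_affine a ltr01 iG.
by rewrite expr1n invr1 mul1r => <-; congr Rintegral; apply/funext => x; rewrite scale1r.
Qed.

Lemma cauchyk_le z : cauchyk z <= 2 ^+ n.
Proof.
rewrite -[X in _ <= _ ^+ X]card_ord -prodr_const; apply: ler_prod => i _.
have z0 := sqr_ge0 (z ord0 i).
rewrite divr_ge0 ?addr_ge0//= ler_pdivrMr ?ltr_wpDr//.
by rewrite ler_peMr// lerDl.
Qed.

Lemma expabsZ (e : R) x : 0 <= e -> expabs (e *: x) = expR (e * - \sum_i `|x ord0 i|).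
Proof.
move=> e0; rewrite mulrN mulr_sumr -sumrN /expabs.
rewrite [RHS](big_morph expR (@expRD R) (@expR0 R)); apply: eq_bigr => i _.
by rewrite mxE normrM (ger0_norm e0).
Qed.

Lemma dotmx_scale (e : R) x z : e != 0 -> dotmx (e *: x) (e^-1 *: z) = dotmx x z.
Proof. by move=> e0; rewrite dotmxZl dotmxC dotmxZl mulrA divff// mul1r dotmxC. Qed.

Lemma measurable_add_rV : measurable_fun setT (fun p : V * V => p.1 + p.2).
Proof.
apply/measurable_fun_rVP => i; under eq_fun do rewrite mxE.
apply: measurable_funD.
- exact: (measurableT_comp (measurable_rV_coor i) measurable_fst).
- exact: (measurableT_comp (measurable_rV_coor i) measurable_snd).
Qed.

Variable h : V -> R.
Hypothesis ih1 : mu.-integrable setT (EFin \o h).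
Hypothesis ih2 : mu.-integrable setT (EFin \o (fun x => h x ^+ 2)).
Let mh := integrable_measurable_real ih1.

Definition autocorr a : R := \int[mu]_x (h x * h (x + a)).

Let S := \int[mu]_x (h x ^+ 2).

Let S0 : 0 <= S.
Proof. by apply: Rintegral_ge0 => x _; exact: sqr_ge0. Qed.

Let mhs a : measurable_fun setT (fun x => h (x + a)).
Proof. exact: measurableT_comp mh (measurable_shift_rV a). Qed.

Let ihs2 a : mu.-integrable setT (EFin \o (fun x => h (x + a) ^+ 2)).
Proof. exact: (integrable_rV_shift (G := fun x => h x ^+ 2)). Qed.

(** Here this replaces the Cauchy-Schwarz inequality without loss, because both squares will have
    the same integral [S]. *)
Let young (u v : R) : `|u * v| <= 2^-1 * u ^+ 2 + 2^-1 * v ^+ 2.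
Proof.
by rewrite ler_norml; have := sqr_ge0 (u - v); have := sqr_ge0 (u + v); nra.
Qed.

Let iyoung a : mu.-integrable setT (EFin \o (fun x => 2^-1 * h x ^+ 2 + 2^-1 * h (x + a) ^+ 2)).
Proof. by apply: integrable_addr; exact: integrable_scaler. Qed.

Lemma integrable_autocorr a : mu.-integrable setT (EFin \o (fun x => h x * h (x + a))).
Proof. by apply: le_integrable_real (iyoung a) => // ; exact: measurable_funM. Qed.

Let youngE a : \int[mu]_x (2^-1 * h x ^+ 2 + 2^-1 * h (x + a) ^+ 2) = S.
Proof.
rewrite RintegralD//; [|exact: integrable_scaler|exact: integrable_scaler].
rewrite !RintegralZl// (Rintegral_rV_shift (G := fun x => h x ^+ 2))// -/S.
by field.
Qed.

Lemma Rintegral_norm_autocorr a : \int[mu]_x `|h x * h (x + a)| <= S.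
Proof.
rewrite -(youngE a); apply: le_Rintegral => //.
exact: (integrable_abse (integrable_autocorr a)).
Qed.

Lemma autocorr_le a : `|autocorr a| <= S.
Proof.
apply: le_trans (Rintegral_norm_autocorr a).
by apply: le_normr_Rintegral => //; exact: integrable_autocorr.
Qed.

(** The squared [L^2] distance between [h] and its translate by [a] is [2 * (S - autocorr a)], so
    this is the continuity of translations. *)
Lemma autocorr_near0 e : 0 < e ->
  exists2 d, 0 < d & forall a, rV_small a d -> `|autocorr a - S| <= e.
Proof.
move=> e0; have [d d0 H] := shift_L2 mh ih2 e0.
exists d => // a ad; have {H} := H a ad.
have id2 : mu.-integrable setT (EFin \o (fun x => (h (x + a) - h x) ^+ 2)).
  apply: (@le_integrable_real _ _ _ _ _ (fun x => 4 * (2^-1 * h x ^+ 2 + 2^-1 * h (x + a) ^+ 2))).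
  - by apply: measurable_funX; exact: measurable_funB.
  - by move=> x; rewrite ger0_norm ?sqr_ge0//; have := sqr_ge0 (h (x + a) + h x); nra.
  - exact: integrable_scaler.
rewrite -EFin_Rintegral// lee_fin.
have -> : \int[mu]_x ((h (x + a) - h x) ^+ 2) = 2 * (S - autocorr a).
  transitivity (\int[mu]_x (2 * (2^-1 * h x ^+ 2 + 2^-1 * h (x + a) ^+ 2) + (- 2) * (h x * h (x + a)))).
    by congr Rintegral; apply/funext => x; field.
  rewrite RintegralD//; last 2 first.
  - exact: integrable_scaler.
  - by apply: integrable_scaler; exact: integrable_autocorr.
  rewrite !RintegralZl//; last exact: integrable_autocorr.
  by rewrite youngE -/(autocorr a); ring.
have := autocorr_le a; rewrite !ler_norml => /andP[? ?] ?; lra.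
Qed.

Lemma measurable_autocorr : measurable_fun setT autocorr.
Proof.
apply: (@measurable_Rintegral_param _ _ _ _ _ mu (fun p : V * V => h p.2 * h (p.2 + p.1))).
apply: measurable_funM; first exact: (measurableT_comp mh measurable_snd).
under eq_fun do rewrite addrC.
exact: (measurableT_comp mh measurable_add_rV).
Qed.

(* The left side is the integral of the power spectrum cut off at scale 1/e;
   both sides converge as e tends to 0, which gives Plancherel's identity. *)
Lemma power_spectrum_autocorr (e : R) : 0 < e ->
  \int[mu]_xi ((fcos h xi ^+ 2 + fsin h xi ^+ 2) * expabs (e *: xi)) =
  \int[mu]_w (cauchyk w * autocorr (e *: w)).
Proof.
move=> e0.
have en0 : e ^+ n != 0 by rewrite gt_eqF// exprn_gt0.
have iPhi : mu.-integrable setT (EFin \o (fun xi : V => expabs (e *: xi))).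
  have := integrable_rV_affine 0 e0 (integrable_expabs (R := R) n).
  by rewrite (_ : (fun x : V => _) = (fun xi => expabs (e *: xi)))//; apply/funext => x; rewrite addr0.
have mk : measurable_fun setT (@cauchyk R n) by exact: measurable_cauchyk.
rewrite (integral_power_spectrum ih1 iPhi).
have kE z : \int[mu]_xi (expabs (e *: xi) * cos (dotmx z xi)) = e ^- n * cauchyk (e^-1 *: z).
  have := Rintegral_rV_affine 0 e0 (integrable_expabs_cos 0 (e^-1 *: z)).
  rewrite Rintegral_expabs_cos cos0 mul1r => <-.
  congr Rintegral; apply/funext => xi.
  rewrite addr0 add0r; congr (_ * cos _).
  by rewrite dotmxC; apply/esym/dotmx_scale; rewrite gt_eqF.
have mlin : measurable_fun setT (fun p : V * V => e *: p.2 + p.1).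
  apply/measurable_fun_rVP => i; under eq_fun do rewrite !mxE.
  apply: measurable_funD; last exact: (measurableT_comp (measurable_rV_coor i) measurable_fst).
  by apply: measurable_funM => //; exact: (measurableT_comp (measurable_rV_coor i) measurable_snd).
have innerE x : \int[mu]_y (h y * \int[mu]_xi (expabs (e *: xi) * cos (dotmx (x - y) xi))) =
    \int[mu]_w (h (e *: w + x) * cauchyk w).
  pose G y := h y * (e ^- n * cauchyk (e^-1 *: (x - y))).
  transitivity (\int[mu]_y G y).
    by congr Rintegral; apply/funext => y; rewrite kE.
  have iG : mu.-integrable setT (EFin \o G).
    apply: (@le_integrable_real _ _ _ _ _ (fun y => (e ^- n * 2 ^+ n) * `|h y|)).
    - apply: measurable_funM => //; apply: measurable_funM => //.
      apply: (measurableT_comp mk).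
      rewrite (_ : (fun y => _) = (fun y => (- e^-1) *: y + e^-1 *: x)).
        exact: measurable_affine_rV.
      by apply/funext => y; rewrite scalerBr scaleNr addrC.
    - move=> y; rewrite /G normrM mulrC ler_wpM2r// normrM.
      rewrite !ger0_norm ?cauchyk_ge0 ?invr_ge0 ?exprn_ge0 ?(ltW e0)//.
      by rewrite ler_wpM2l ?invr_ge0 ?exprn_ge0 ?(ltW e0)// cauchyk_le.
    - by apply: integrable_scaler; exact: (integrable_abse ih1).
  (* The substitution [y = e *: w + x] turns the dilated kernel into [cauchyk w] and absorbs the
     factor [e ^- n]. *)
  have := Rintegral_rV_affine x e0 iG.
  move/(congr1 (fun r => e ^+ n * r)); rewrite mulrA (divff en0) mul1r => <-.
  rewrite -RintegralZl//; last exact: integrable_rV_affine.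
  congr Rintegral; apply/funext => w; rewrite /G.
  rewrite (_ : e^-1 *: (x - (e *: w + x)) = - w); last first.
    by rewrite opprD addrCA subrr addr0 scalerN scalerA mulVf ?gt_eqF// scale1r.
  by rewrite cauchykN mulrCA (mulrA (e ^+ n)) divff// mul1r.
under eq_Rintegral do rewrite innerE.
pose F (p : V * V) := h p.1 * (h (e *: p.2 + p.1) * cauchyk p.2).
have mF : measurable_fun setT F.
  apply: measurable_funM; first exact: (measurableT_comp mh measurable_fst).
  apply: measurable_funM; last exact: (measurableT_comp mk measurable_snd).
  exact: (measurableT_comp mh mlin).
have ihw x : mu.-integrable setT (EFin \o (fun w => h (e *: w + x) * cauchyk w)).
  apply: (@le_integrable_real _ _ _ _ _ (fun w => 2 ^+ n * `|h (e *: w + x)|)).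
  - apply: measurable_funM => //.
    exact: (measurableT_comp mh (measurable_affine_rV e x)).
  - by move=> w; rewrite normrM mulrC ler_wpM2r// ger0_norm ?cauchyk_ge0 ?cauchyk_le.
  - by apply: integrable_scaler; exact: (integrable_abse (integrable_rV_affine x e0 ih1)).
have FE w : (fun x => F (x, w)) = (fun x => cauchyk w * (h x * h (x + e *: w))).
  by apply/funext => x; rewrite /F /= (addrC x); ring.
transitivity (\int[mu]_x \int[mu]_w F (x, w)).
  by congr Rintegral; apply/funext => x; rewrite /F /= RintegralZl.
rewrite Rfubini.
- by congr Rintegral; apply/funext => w; rewrite FE RintegralZl//; exact: integrable_autocorr.
(* No product bound is at hand for this integrand. Integrating its absolute value in [x] first gives
   at most [S * cauchyk w], which is integrable in [w]. *)
- apply/integrable21ltyP; first exact/measurable_EFinP.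
  apply: (@le_lt_trans _ _ (\int[mu]_w (S * cauchyk w)%:E)%E); last first.
    have := integrable_scaler S (integrable_cauchyk (R := R) n).
    move=> /integrableP[_]; apply: le_lt_trans.
    by apply: ge0_le_integral => //;
      [by move=> w _; rewrite lee_fin mulr_ge0// cauchyk_ge0
      |by apply/measurable_EFinP; exact: measurable_funM
      |by apply: measurableT_comp => //; apply/measurable_EFinP; exact: measurable_funM
      |by move=> w _; rewrite lee_fin ler_norm].
  apply: ge0_le_integral => //.
  + by move=> w _; exact: integral_ge0.
  + apply: (@measurable_fun_fubini_tonelli_G _ _ V V R mu (abse \o (EFin \o F))).
      by apply: measurableT_comp => //; exact/measurable_EFinP.
    by move=> p; exact: abse_ge0.
  + by apply/measurable_EFinP; exact: measurable_funM.
  + move=> w _; have /= := congr1 (fun g => (\int[mu]_x `|g x|%:E)%E) (FE w) => ->.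
    under eq_integral do rewrite normrM (ger0_norm (cauchyk_ge0 _)) EFinM.
    rewrite ge0_integralZl//; last 2 first.
    * apply/measurable_EFinP; apply: measurableT_comp => //.
      exact: measurable_funM.
    * by rewrite lee_fin cauchyk_ge0.
    rewrite muleC -EFin_Rintegral; last exact: (integrable_abse (integrable_autocorr _)).
    by rewrite -EFinM lee_fin ler_wpM2r ?cauchyk_ge0// Rintegral_norm_autocorr.
- by move=> x; exact: (integrable_scaler (h x) (ihw x)).
- move=> w; rewrite (FE w).
  exact: (integrable_scaler (cauchyk w) (integrable_autocorr (e *: w))).
Qed.

Let eps (j : nat) : R := j.+1%:R^-1.

Let eps0 j : 0 < eps j. Proof. by rewrite invr_gt0. Qed.

Let cvg_autocorr w : autocorr (eps j *: w) @[j --> \oo] --> S.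
Proof.
apply/cvgrPdist_le => e e0; have [d d0 H] := autocorr_near0 e0.
pose k0 := (Num.truncn ((\sum_i `|w ord0 i|) / d)).+1.
have k0P : (\sum_i `|w ord0 i|) / d < k0%:R by rewrite truncnS_gt.
exists k0 => // j /= kj; rewrite distrC; apply: H => i.
rewrite mxE normrM ger0_norm ?(ltW (eps0 _))// mulrC ler_pdivrMr//.
apply: (@le_trans _ _ (\sum_i `|w ord0 i|)).
  by rewrite (bigD1 i)//= lerDl sumr_ge0.
rewrite mulrC -ler_pdivrMr//.
by rewrite (le_trans (ltW k0P))// ler_nat (leq_trans kj).
Qed.

Theorem plancherel :
  (\int[mu]_xi (fcos h xi ^+ 2 + fsin h xi ^+ 2)%:E = ((2 * pi) ^+ n * S)%:E)%E.
Proof.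
have mk : measurable_fun setT (@cauchyk R n) by exact: measurable_cauchyk.
pose P xi := fcos h xi ^+ 2 + fsin h xi ^+ 2.
have P0 xi : 0 <= P xi by rewrite addr_ge0 ?sqr_ge0.
have mP : measurable_fun setT P.
  by apply: measurable_funD; apply: measurable_funX; [exact: measurable_fcos|exact: measurable_fsin].
have mE j : measurable_fun setT (fun xi : V => expabs (eps j *: xi)).
  apply: (measurableT_comp (measurable_expabs (R := R) (n := n))).
  by have := measurable_affine_rV (eps j) (0 : V); under eq_fun do rewrite addr0.
pose g j xi : \bar R := (P xi * expabs (eps j *: xi))%:E.
have iPE j : mu.-integrable setT (EFin \o (fun xi => P xi * expabs (eps j *: xi))).
  pose N := \int[mu]_x `|h x|.
  apply: (@le_integrable_real _ _ _ _ _ (fun xi => (N ^+ 2 + N ^+ 2) * expabs (eps j *: xi))).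
  - exact: measurable_funM.
  - move=> xi; rewrite ger0_norm ?mulr_ge0 ?expabs_ge0// ler_wpM2r ?expabs_ge0//.
    have N0 : 0 <= N by apply: Rintegral_ge0.
    by apply: lerD; rewrite -[leLHS]real_normK ?num_real// lerXn2r ?nnegrE// ?fcos_le ?fsin_le.
  - apply: integrable_scaler; have := integrable_rV_affine 0 (eps0 j) (integrable_expabs (R := R) n).
    by rewrite (_ : (fun x : V => _) = (fun xi => expabs (eps j *: xi)))//; apply/funext => x; rewrite addr0.
(* Monotone convergence: the cutoffs increase to [1]. Integrability of the power spectrum cannot be
   presupposed, being part of the conclusion. *)
have L1 : (\int[mu]_xi g j xi)%E @[j --> \oo] --> (\int[mu]_xi (P xi)%:E)%E.
  have -> : (\int[mu]_xi (P xi)%:E = \int[mu]_xi limn (g ^~ xi))%E.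
    apply: eq_integral => xi _; apply/esym/cvg_lim => //.
    apply: cvg_EFin; first exact: nearW.
    rewrite -[X in _ --> X]mulr1; apply: cvgM; first exact: cvg_cst.
    rewrite -[X in _ --> X]expR0 -(mul0r (- \sum_i `|xi ord0 i|)).
    under eq_fun do rewrite expabsZ ?(ltW (eps0 _))//.
    apply: continuous_cvg; first exact: continuous_expR.
    apply: cvgM; last exact: cvg_cst.
    exact: cvg_harmonic.
  apply: cvg_monotone_convergence => //.
  - by move=> j; apply/measurable_EFinP; exact: measurable_funM.
  - by move=> j xi _; rewrite lee_fin mulr_ge0// expabs_ge0.
  - move=> xi _ i j ij; rewrite lee_fin ler_wpM2l//; apply: ler_prod => k _.
    rewrite expR_ge0 ler_expR lerN2 !mxE !normrM ler_wpM2r//.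
    by rewrite !ger0_norm ?(ltW (eps0 _))// lef_pV2 ?posrE// ler_nat.
(* Dominated convergence with [S * cauchyk w]: the autocorrelation tends to [S], and [cauchyk] has
   total mass [(2 * pi) ^+ n]. *)
have L2 : (\int[mu]_xi g j xi)%E @[j --> \oo] --> ((2 * pi) ^+ n * S)%:E.
  have gE j : (\int[mu]_xi g j xi = \int[mu]_w (cauchyk w * autocorr (eps j *: w))%:E)%E.
    rewrite /g -EFin_Rintegral// power_spectrum_autocorr// EFin_Rintegral//.
    apply: (@le_integrable_real _ _ _ _ _ (fun w => S * cauchyk w)).
    - apply: measurable_funM => //; apply: (measurableT_comp measurable_autocorr).
      by have := measurable_affine_rV (eps j) (0 : V); under eq_fun do rewrite addr0.
    - move=> w; rewrite normrM mulrC.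
      by rewrite (ger0_norm (cauchyk_ge0 w)) ler_wpM2r ?cauchyk_ge0// autocorr_le.
    - by apply: integrable_scaler; exact: integrable_cauchyk.
  under eq_fun do rewrite gE.
  have -> : ((2 * pi) ^+ n * S)%:E = (\int[mu]_w (cauchyk w * S)%:E)%E.
    under eq_integral do rewrite mulrC EFinM.
    rewrite ge0_integralZl//; last 2 first.
    - exact/measurable_EFinP.
    - by move=> w _; rewrite lee_fin cauchyk_ge0.
    by rewrite integral_cauchyk -EFinM mulrC.
  apply: (@dominated_convergence_EFin _ _ _ mu _ _ (fun w => S * cauchyk w)).
  - move=> j; apply: measurable_funM => //; apply: (measurableT_comp measurable_autocorr).
    by have := measurable_affine_rV (eps j) (0 : V); under eq_fun do rewrite addr0.
  - exact: measurable_funM.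
  - by move=> w; apply: cvgM; [exact: cvg_cst|exact: cvg_autocorr].
  - by apply: integrable_scaler; exact: integrable_cauchyk.
  - move=> j w; rewrite normrM mulrC.
    by rewrite (ger0_norm (cauchyk_ge0 w)) ler_wpM2r ?cauchyk_ge0// autocorr_le.
exact: (cvg_unique _ L1 L2).
Qed.

End plancherel.

(** * Lipschitz bounds for sine and cosine, uniform continuity of [fcos] *)

Section lipschitz_trig.
Context {R : realType}.

Lemma sin_le_id (x : R) : 0 <= x -> sin x <= x.
Proof.
move=> x0; have [c _] := @MVT_segment R sin cos 0 x x0 (fun y _ => is_derive_sin y)
  (continuous_subspaceT (@continuous_sin R)).
by rewrite sin0 !subr0 => ->; rewrite -[leRHS]mul1r ler_wpM2r// cos_le1.
Qed.

Lemma normr_sin_le (x : R) : `|sin x| <= `|x|.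
Proof.
wlog x0 : x / 0 <= x.
  move=> H; have [|x0] := leP 0 x; first exact: H.
  by rewrite -normrN -sinN -(normrN x); apply: H; rewrite oppr_ge0 ltW.
rewrite (ger0_norm x0) ler_norml sin_le_id// andbT.
have [c _] := @MVT_segment R sin cos 0 x x0 (fun y _ => is_derive_sin y)
  (continuous_subspaceT (@continuous_sin R)).
by rewrite sin0 !subr0 => ->; rewrite -mulN1r ler_wpM2r// cos_geN1.
Qed.

Lemma normr_cosB_le (a b : R) : `|cos a - cos b| <= `|a - b|.
Proof.
wlog ab : a b / a <= b.
  move=> H; have [|/ltW] := leP a b; first exact: H.
  by rewrite (distrC (cos a)) (distrC a); exact: H.
have dcos (y : R) : y \in `]a, b[ -> is_derive y 1 cos (- sin y).
  by move=> _; exact: is_derive_cos.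
have [c _] := MVT_segment ab dcos (continuous_subspaceT (@continuous_cos R)).
rewrite distrC => ->; rewrite normrM normrN distrC ler_piMl//.
exact: normr_sin_le1.
Qed.

End lipschitz_trig.

Section uniform_continuity.
Context {R : realType} {n : nat}.
Local Notation V := 'rV[R]_n.
Local Notation mu := (@rV_lebesgue R n).

(** The difference of the cosines is at most both [2] and the [l^1] norm of [x] times the
    displacement. The minimum of the two is needed since [h] may have no first moment; it makes
    dominated convergence applicable as the displacement shrinks. *)
Lemma fcos_uniform_continuous (h : V -> R) (e : R) :
  mu.-integrable setT (EFin \o h) -> 0 < e ->
  exists2 d, 0 < d & forall xi xi' : V,
    (forall i, `|xi ord0 i - xi' ord0 i| <= d) -> `|fcos h xi - fcos h xi'| <= e.
Proof.
move=> ih e0; have mh := integrable_measurable_real ih.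
pose l1 (x : V) := \sum_i `|x ord0 i|.
have l10 x : 0 <= l1 x by apply: sumr_ge0.
have ml1 : measurable_fun setT l1.
  apply: measurable_sum => i; apply: measurableT_comp => //.
  exact: measurable_rV_coor.
pose g (k : nat) (x : V) := `|h x| * Num.min 2 (l1 x / k.+1%:R).
have g0 k x : 0 <= g k x.
  by rewrite mulr_ge0// le_min ler0n/= divr_ge0.
have mg k : measurable_fun setT (g k).
  apply: measurable_funM; first exact: measurableT_comp.
  by apply: measurable_minr => //; apply: measurable_funM.
have gle k x : `|g k x| <= 2 * `|h x|.
  by rewrite ger0_norm// /g mulrC ler_wpM2r// ge_min lexx.
have ih2 : mu.-integrable setT (EFin \o (fun x => 2 * `|h x|)).
  by apply: integrable_scaler; exact: (integrable_abse ih).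
have ig k : mu.-integrable setT (EFin \o g k).
  exact: le_integrable_real (gle k) ih2.
have cvg0 : (\int[mu]_x (g k x)%:E)%E @[k --> \oo] --> 0%E.
  rewrite [X in _ --> X](_ : _ = (\int[mu]_x (0 : R)%:E)%E); last by rewrite integral0.
  apply: (@dominated_convergence_EFin _ _ _ mu _ _ (fun x => 2 * `|h x|)) => //.
  move=> x; apply: (@squeeze_cvgr _ _ _ _ (fun=> 0) (fun k => `|h x| * l1 x * k.+1%:R^-1)).
  - apply: nearW => k; rewrite g0/= /g -mulrA ler_wpM2l//.
    by rewrite ge_min lexx orbT.
  - exact: cvg_cst.
  - rewrite -[X in _ --> X](mulr0 (`|h x| * l1 x)); apply: cvgM; first exact: cvg_cst.
    exact: cvg_harmonic.
have [k gk] : exists k, \int[mu]_x g k x <= e.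
  have /fine_cvgP[_ /cvgr0Pnorm_le /(_ _ e0) [K _ HK]] := cvg0.
  exists K; have := HK K (leqnn K); rewrite /=.
  exact: le_trans (ler_norm _).
exists k.+1%:R^-1; first by rewrite invr_gt0.
move=> xi xi' H; apply: le_trans gk.
rewrite /fcos -RintegralB//; [|exact: integrable_Mcos|exact: integrable_Mcos].
have iB : mu.-integrable setT (EFin \o (fun x => h x * cos (dotmx x xi) - h x * cos (dotmx x xi'))).
  rewrite (_ : (fun x => _) = (fun x => h x * cos (dotmx x xi) + (- 1) * (h x * cos (dotmx x xi')))).
    by apply: integrable_addr; [exact: integrable_Mcos|apply: integrable_scaler; exact: integrable_Mcos].
  by apply/funext => x; rewrite mulN1r.
apply: (le_trans (le_normr_Rintegral _ iB)) => //.
apply: le_Rintegral => //; first exact: (integrable_abse iB).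
move=> x _; rewrite -mulrBr normrM ler_wpM2l// le_min; apply/andP; split.
  by rewrite (le_trans (ler_normB _ _))// -[2]/(1 + 1) lerD// normr_cos_le1.
rewrite (le_trans (normr_cosB_le _ _))// /dotmx -sumrB (le_trans (ler_norm_sum _ _ _))//.
rewrite /l1 mulr_suml; apply: ler_sum => i _.
by rewrite -mulrBr normrM ler_wpM2l.
Qed.

End uniform_continuity.

Lemma measurable_invr (R : realType) : measurable_fun [set: R] (fun x : R => x^-1).
Proof.
have mN0 : measurable [set~ (0 : R)] by apply: measurableC; exact: measurable_set1.
rewrite -(setUv [set (0 : R)]); apply/measurable_funU => //; split.
  exact: measurable_fun_set1.
apply: open_continuous_measurable_fun; first by apply: closed_openC; exact: closed_eq.
by move=> x; rewrite inE => /eqP x0; exact: inv_continuous.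
Qed.

(** * The wave multiplier at low frequencies *)

Section low_frequency.
Context {R : realType} {n : nat}.
Local Notation V := 'rV[R]_n.
Local Notation mu := (@rV_lebesgue R n).

Lemma enorm_ge0 (xi : V) : 0 <= enorm xi.
Proof. exact: sqrtr_ge0. Qed.

Lemma dotmx_ge0 (xi : V) : 0 <= dotmx xi xi.
Proof. by apply: sumr_ge0 => i _; rewrite -expr2 sqr_ge0. Qed.

Lemma sqr_enorm (xi : V) : enorm xi ^+ 2 = dotmx xi xi.
Proof. by rewrite sqr_sqrtr// dotmx_ge0. Qed.

Lemma coor_le_enorm (xi : V) i : `|xi ord0 i| <= enorm xi.
Proof.
rewrite -(@ler_pXn2r _ 2)// ?nnegrE ?enorm_ge0// sqr_enorm real_normK ?num_real//.
by rewrite /dotmx (bigD1 i)//= -expr2 lerDl sumr_ge0// => j _; rewrite -expr2 sqr_ge0.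
Qed.

Lemma measurable_enorm : measurable_fun setT (@enorm R n).
Proof.
apply: (measurableT_comp measurable_sqrt); apply: measurable_sum => i.
by apply: measurable_funM; exact: measurable_rV_coor.
Qed.

(** At [xi = 0] the division by zero gives [0] and not the limit [t]; the bounds below hold with
    this value too. *)
Definition wave_mult (t alpha : R) (xi : V) : R :=
  sin (t * alpha * enorm xi) / (alpha * enorm xi).

Lemma measurable_wave_mult t alpha : measurable_fun setT (wave_mult t alpha).
Proof.
have mr := measurable_enorm.
apply: measurable_funM.
  by apply: (measurableT_comp measurable_sin); apply: measurable_funM.
apply: (@measurableT_comp _ _ _ _ _ _ (fun x : R => x^-1)).
  exact: measurable_invr.
exact: measurable_funM.
Qed.

Lemma sqr_wave_mult_le_time t alpha xi : wave_mult t alpha xi ^+ 2 <= t ^+ 2.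
Proof.
rewrite /wave_mult; have [->|z] := eqVneq (alpha * enorm xi) 0.
  by rewrite invr0 mulr0 expr0n sqr_ge0.
rewrite expr_div_n ler_pdivrMr ?exprn_even_gt0//.
rewrite -[leLHS]real_normK ?num_real// -exprMn -[leRHS]real_normK ?num_real//.
by rewrite lerXn2r ?nnegrE// mulrA normr_sin_le.
Qed.

Lemma sqr_wave_mult_le_freq t alpha rho xi : 0 < alpha -> 0 < rho -> rho <= enorm xi ->
  wave_mult t alpha xi ^+ 2 <= (alpha * rho) ^- 2.
Proof.
move=> a0 r0 rr; have e0 : 0 < enorm xi by exact: lt_le_trans rr.
rewrite /wave_mult expr_div_n -[leRHS]mul1r ler_pM ?sqr_ge0 ?invr_ge0//.
- by rewrite exprn_ge0// mulr_ge0// ltW.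
- rewrite lef_pV2 ?posrE ?exprn_gt0 ?mulr_gt0//.
  by rewrite ler_pXn2r ?nnegrE ?mulr_ge0 ?(ltW a0) ?(ltW r0) ?(ltW e0)// ler_pM2l.
Qed.

(* The multiplier is at most t on the cube of half-side 2^-K and at most 2^(k+1) / alpha
   between the cubes of half-sides 2^-(k+1) and 2^-k. *)
Lemma integral_wave_mult_dyadic (t alpha : R) (K : nat) : 0 < alpha ->
  (\int[mu]_xi (\1_(rV_box 1) xi * wave_mult t alpha xi ^+ 2)%:E <=
   (2 ^+ n * (t ^+ 2 * (2^-1 ^+ n) ^+ K
     + 4 / alpha ^+ 2 * \sum_(k < K) (4 * 2^-1 ^+ n) ^+ k))%:E)%E.
Proof.
move=> a0.
have a2 : 0 <= alpha ^- 2 by rewrite invr_ge0 sqr_ge0.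
pose Q k : set V := rV_box (2^-1 ^+ k).
have mQ k : measurable (Q k) by exact: measurable_rV_box.
pose c (k : nat) : R := 4 * 4 ^+ k / alpha ^+ 2.
have c0 k : 0 <= c k by rewrite /c divr_ge0 ?sqr_ge0// mulr_ge0// exprn_ge0.
(* Full cubes [Q k] stand in for the dyadic shells: the overlaps only enlarge the bound, and the
   volumes of the cubes are explicit. *)
have pw xi : \1_(rV_box 1) xi * wave_mult t alpha xi ^+ 2 <=
    t ^+ 2 * \1_(Q K) xi + \sum_(k < K) c k * \1_(Q k) xi.
  have i0 : 0 <= (\1_(rV_box 1) xi : R) by rewrite indicE.
  have i1 : (\1_(rV_box 1) xi : R) <= 1 by rewrite indicE; case: (_ \in _).
  elim: K => [|K IH].
    by rewrite big_ord0 addr0 mulrC /Q expr0 ler_wpM2r// sqr_wave_mult_le_time.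
  rewrite big_ord_recr /=.
  have [q1|q1] := pselect (Q K.+1 xi).
    rewrite [X in t ^+ 2 * X]indicE mem_set// mulr1.
    rewrite [X in _ <= X](_ : _ = t ^+ 2 + (\sum_(i < K) c i * \1_(Q i) xi + c K * \1_(Q K) xi))//.
    rewrite ler_wpDr ?addr_ge0 ?sumr_ge0 ?mulr_ge0//; first by move=> i _; rewrite mulr_ge0.
    rewrite -[leRHS]mul1r ler_pM ?sqr_ge0 ?sqr_wave_mult_le_time//.
  rewrite [X in t ^+ 2 * X]indicE memNset// mulr0 add0r.
  have [q2|q2] := pselect (Q K xi); last first.
    move: IH; rewrite [X in t ^+ 2 * X]indicE memNset// mulr0 add0r => /le_trans; apply.
    by rewrite lerDl mulr_ge0.
  rewrite (indicE R (Q K)) mem_set// mulr1 ler_wpDl//.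
    by apply: sumr_ge0 => i _; rewrite mulr_ge0.
  have [i iP] : exists i, 2^-1 ^+ K.+1 < `|xi ord0 i|.
    apply/not_existsP => H; apply: q1 => i; rewrite in_itv/= -ler_norml leNgt.
    by apply/negP; exact: H.
  have rr : 2^-1 ^+ K.+1 <= enorm xi by apply: (le_trans (ltW iP)); exact: coor_le_enorm.
  have r0 : 0 < 2^-1 ^+ K.+1 :> R by rewrite exprn_gt0.
  apply: (@le_trans _ _ (wave_mult t alpha xi ^+ 2)).
    by rewrite -[leRHS]mul1r ler_wpM2r ?sqr_ge0.
  rewrite (le_trans (sqr_wave_mult_le_freq t a0 r0 rr))//.
  have E : (2^-1 ^+ K.+1) ^+ 2 = (4 * 4 ^+ K)^-1 :> R.
    rewrite -exprM mulnC exprM -exprS -exprVn; congr (_ ^+ _).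
    by rewrite exprVn; congr (_^-1); ring.
  by rewrite /c exprMn E invfM invrK mulrC.
apply: (@le_trans _ _ (\int[mu]_xi ((t ^+ 2)%:E * (\1_(Q K) xi)%:E + \sum_(k < K) ((c k)%:E * (\1_(Q k) xi)%:E)))%E).
  apply: ge0_le_integral => //.
  - by move=> xi _; rewrite lee_fin mulr_ge0// sqr_ge0.
  - apply/measurable_EFinP; apply: measurable_funM.
      by apply: measurable_indic; exact: measurable_rV_box.
    by apply: measurable_funX; exact: measurable_wave_mult.
  - apply: emeasurable_funD.
      by apply/measurable_EFinP; apply: measurable_funM => //; exact: measurable_indic.
    apply: emeasurable_sum => k.
    by apply/measurable_EFinP; apply: measurable_funM => //; exact: measurable_indic.
  - move=> xi _; under eq_bigr do rewrite -EFinM.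
    by rewrite sumEFin -EFinM -EFinD lee_fin pw.
rewrite ge0_integralD//; last 4 first.
- by move=> xi _; rewrite -EFinM lee_fin mulr_ge0// sqr_ge0.
- by apply/measurable_EFinP; apply: measurable_funM => //; exact: measurable_indic.
- by move=> xi _; apply: sume_ge0 => k _; rewrite -EFinM lee_fin mulr_ge0.
- apply: emeasurable_sum => k.
  by apply/measurable_EFinP; apply: measurable_funM => //; exact: measurable_indic.
rewrite (ge0_integralZ_indic mu (mQ K) (sqr_ge0 t)).
rewrite ge0_integral_sum//; last 2 first.
- by move=> k; apply/measurable_EFinP; apply: measurable_funM => //; exact: measurable_indic.
- by move=> k xi _; rewrite -EFinM lee_fin mulr_ge0.
under eq_bigr do rewrite ge0_integralZ_indic//.
have muQ k : mu (Q k) = (2 ^+ n * (2^-1 ^+ n) ^+ k)%:E.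
  rewrite /Q rV_lebesgue_cube ?exprn_ge0//; congr EFin.
  by rewrite exprMn -!exprM mulnC.
rewrite [X in ((t ^+ 2)%:E * X + _ <= _)%E]muQ.
rewrite (eq_bigr (fun k : 'I_K => (c k * (2 ^+ n * (2^-1 ^+ n) ^+ k))%:E)); last first.
  by move=> k _; rewrite [X in ((c k)%:E * X)%E]muQ -EFinM.
rewrite sumEFin -EFinM -EFinD lee_fin le_eqVlt; apply/orP; left; apply/eqP.
rewrite mulrDr mulrCA; congr (_ + _).
rewrite !mulr_sumr; apply: eq_bigr => k _.
by rewrite /c exprMn; ring.
Qed.

(** For [n = 2] the ratio [4 * 2^-1 ^+ n] is [1]: every dyadic layer contributes equally, and there
    are about [log t] of them. *)
Lemma integral_wave_mult_dim2 (alpha : R) : n = 2%N -> 0 < alpha ->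
  exists2 C : R, 0 < C & forall t, 1 <= t ->
  (\int[mu]_xi (\1_(rV_box 1) xi * wave_mult t alpha xi ^+ 2)%:E <= (C * ln (t + 2))%:E)%E.
Proof.
move=> n2 a0.
have l2 : 0 < ln 2 :> R by rewrite ln_gt0// ltr1n.
exists (4 * (1 + 8 / alpha ^+ 2) / ln 2).
  by rewrite divr_gt0// mulr_gt0// addr_gt0// divr_gt0// exprn_gt0.
move=> t t1; have t0 : 0 < t by exact: lt_le_trans t1.
pose m := Num.truncn t.
have m1 : (0 < m)%N by rewrite truncn_gt0.
have /andP[mt tm] := truncn_itv (ltW t0).
(* Then [2 ^+ K.-1 <= t <= 2 ^+ K]: the right inequality bounds the contribution of the innermost
   cube, the left one bounds [K] by a multiple of [ln (t + 2)]. *)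
pose K := (trunc_log 2 m).+1.
have /andP[k1 k2] := trunc_log_bounds (isT : (1 < 2)%N) m1.
have tK : t <= 2 ^+ K.
  by rewrite (le_trans (ltW tm))// -natrX ler_nat.
have Kt : 2 ^+ (trunc_log 2 m) <= t.
  by rewrite (le_trans _ mt)// -natrX ler_nat.
apply: (le_trans (integral_wave_mult_dyadic t K a0)); rewrite lee_fin n2.
have -> : \sum_(k < K) (4 * 2^-1 ^+ 2) ^+ k = K%:R :> R.
  have -> : 4 * 2^-1 ^+ 2 = 1 :> R by field.
  by under eq_bigr do rewrite expr1n; rewrite sumr_const card_ord.
have h1 : t ^+ 2 * (2^-1 ^+ 2) ^+ K <= 1.
  rewrite -exprM mulnC exprM -exprMn exprn_ile1// ?mulr_ge0 ?exprn_ge0 ?(ltW t0)//.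
  by rewrite exprVn ler_pdivrMr ?exprn_gt0// mul1r.
have h2 : K%:R <= 2 * (ln (t + 2) / ln 2).
  have l3 : ln 2 <= ln (t + 2) by rewrite ler_ln ?posrE//; lra.
  have l4 : (trunc_log 2 m)%:R * ln 2 <= ln (t + 2).
    rewrite mulr_natl -lnXn// ler_ln ?posrE ?exprn_gt0//; lra.
  rewrite /K -natr1 mulrA ler_pdivlMr// mulrDl mul1r; lra.
have h3 : 1 <= ln (t + 2) / ln 2.
  by rewrite ler_pdivlMr// mul1r ler_ln ?posrE//; lra.
have a2 : 0 <= 4 / alpha ^+ 2 by rewrite divr_ge0// sqr_ge0.
rewrite [leRHS](_ : _ = 2 ^+ 2 * (ln (t + 2) / ln 2 + 4 / alpha ^+ 2 * (2 * (ln (t + 2) / ln 2)))); last first.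
  by field; rewrite ?gt_eqF// lt0r_neq0.
rewrite ler_wpM2l ?exprn_ge0// lerD//; first exact: le_trans h3.
by rewrite ler_wpM2l.
Qed.

(** For [n >= 3] the ratio [4 * 2^-1 ^+ n] is at most one half, so the sum over the layers is below
    [2] for every [K]. *)
Lemma integral_wave_mult_dim3 (alpha : R) : (3 <= n)%N -> 0 < alpha ->
  exists2 C : R, 0 < C & forall t, 1 <= t ->
  (\int[mu]_xi (\1_(rV_box 1) xi * wave_mult t alpha xi ^+ 2)%:E <= C%:E)%E.
Proof.
move=> n3 a0; exists (2 ^+ n * (1 + 8 / alpha ^+ 2)).
  by rewrite mulr_gt0 ?exprn_gt0// addr_gt0// divr_gt0// exprn_gt0.
move=> t t1; have t0 : 0 < t by exact: lt_le_trans t1.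
(* Only [t <= 2 ^+ K] matters, since the geometric sum is bounded independently of [K]; this crude
   choice is sufficient. *)
pose K := (Num.truncn t).+1.
have tK : t <= 2 ^+ K.
  apply: (@le_trans _ _ K%:R); first by rewrite ltW// truncnS_gt.
  by rewrite -natrX ler_nat ltnW// ltn_expl.
apply: (le_trans (integral_wave_mult_dyadic t K a0)); rewrite lee_fin.
rewrite ler_wpM2l ?exprn_ge0//.
have half_le (j k : nat) : (j <= k)%N -> 2^-1 ^+ k <= 2^-1 ^+ j :> R.
  by move=> jk; rewrite ler_wiXn2l// invf_le1 ?ler1n.
apply: lerD.
  apply: (@le_trans _ _ (t ^+ 2 * (2^-1 ^+ 2) ^+ K)).
    rewrite ler_wpM2l ?sqr_ge0// lerXn2r ?nnegrE ?exprn_ge0//.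
    by apply: half_le; exact: leq_trans n3.
  rewrite -exprM mulnC exprM -exprMn exprn_ile1// ?mulr_ge0 ?exprn_ge0 ?(ltW t0)//.
  by rewrite exprVn ler_pdivrMr ?exprn_gt0// mul1r.
have a2 : 0 <= 4 / alpha ^+ 2 by rewrite divr_ge0// sqr_ge0.
rewrite [leRHS](_ : _ = 4 / alpha ^+ 2 * 2); last by field; rewrite lt0r_neq0.
rewrite ler_wpM2l//.
apply: (@le_trans _ _ (\sum_(k < K) 2^-1 ^+ k)).
  apply: ler_sum => k _; rewrite lerXn2r ?nnegrE ?mulr_ge0 ?exprn_ge0//.
  rewrite (le_trans (ler_wpM2l _ (half_le _ _ n3)))//; lra.
have geo (j : nat) : \sum_(k < j) 2^-1 ^+ k = 2 - 2 * 2^-1 ^+ j :> R.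
  elim: j => [|j IH]; first by rewrite big_ord0 expr0; ring.
  by rewrite big_ord_recr /= IH exprS; field.
by rewrite geo gerBl mulr_ge0// exprn_ge0.
Qed.

End low_frequency.

(** * Norms of L^2 Fourier transforms *)

Section L2_norm.
Context d (T : measurableType d) (R : realType) (mu : {measure set T -> \bar R}).
Implicit Types f g : T -> R.

Lemma Lnorm2E f : ('N[mu]_2%:E[EFin \o f] = (\int[mu]_x (f x ^+ 2)%:E) `^ 2^-1)%E.
Proof.
rewrite unlock; congr (_ `^ _)%E; apply: eq_integral => x _.
rewrite abse_EFin poweR_EFin; congr EFin.
by rewrite powR_mulrn// real_normK// num_real.
Qed.

Lemma integral_sqr_ge0 f : (0 <= \int[mu]_x (f x ^+ 2)%:E)%E.
Proof. by apply: integral_ge0 => x _; rewrite lee_fin sqr_ge0. Qed.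

Lemma poweR_sqr_half (c : R) : 0 <= c -> ((c ^+ 2)%:E `^ 2^-1 = c%:E)%E.
Proof.
move=> c0; rewrite poweR_EFin -powR_mulrn// -powRrM divff ?powRr1//.
Qed.

Lemma Lnorm2_ge f (c : R) : 0 <= c -> ((c ^+ 2)%:E <= \int[mu]_x (f x ^+ 2)%:E)%E ->
  (c%:E <= 'N[mu]_2%:E[EFin \o f])%E.
Proof.
move=> c0 H; rewrite Lnorm2E -(poweR_sqr_half c0).
by rewrite gt0_ler_poweR// ?invr_ge0// in_itv/= leey andbT ?lee_fin ?sqr_ge0// integral_sqr_ge0.
Qed.

Lemma Lnorm2_le f (c : R) : 0 <= c -> (\int[mu]_x (f x ^+ 2)%:E <= (c ^+ 2)%:E)%E ->
  ('N[mu]_2%:E[EFin \o f] <= c%:E)%E.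
Proof.
move=> c0 H; rewrite Lnorm2E -(poweR_sqr_half c0).
by rewrite gt0_ler_poweR// ?invr_ge0// in_itv/= leey andbT ?lee_fin ?sqr_ge0// integral_sqr_ge0.
Qed.

Lemma Lnorm2_mono f g : measurable_fun setT f -> measurable_fun setT g ->
  (forall x, `|f x| <= `|g x|) ->
  ('N[mu]_2%:E[EFin \o f] <= 'N[mu]_2%:E[EFin \o g])%E.
Proof.
move=> mf mg fg; rewrite !Lnorm2E.
rewrite gt0_ler_poweR// ?invr_ge0// ?in_itv/= ?leey ?andbT ?integral_sqr_ge0//.
apply: ge0_le_integral => //.
- by move=> x _; rewrite lee_fin sqr_ge0.
- by apply/measurable_EFinP; exact: measurable_funX.
- by apply/measurable_EFinP; exact: measurable_funX.
- move=> x _; rewrite lee_fin -[leLHS]real_normK ?num_real//.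
  by rewrite -[leRHS]real_normK ?num_real// lerXn2r ?nnegrE.
Qed.

Lemma Lfun_measurable f p : f \in Lfun mu p -> measurable_fun setT f.
Proof. by rewrite inE => /andP[/[!inE]]. Qed.

Lemma Lfun2_norm f : f \in Lfun mu 2%:E ->
  ('N[mu]_2%:E[EFin \o f] = (Num.sqrt (\int[mu]_x (f x ^+ 2))%R)%:E)%E.
Proof.
move=> /Lfun2_integrable_sqr fi; rewrite Lnorm2E -EFin_Rintegral//.
rewrite -[X in (X%:E `^ _)%E]sqr_sqrtr; last by apply: Rintegral_ge0 => x _; exact: sqr_ge0.
by rewrite poweR_sqr_half// sqrtr_ge0.
Qed.

Lemma Lfun1_norm f : f \in Lfun mu 1 ->
  ('N[mu]_1[EFin \o f] = (\int[mu]_x `|f x|)%R%:E)%E.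
Proof.
move=> /Lfun1_integrable fi; rewrite Lnorm1 EFin_Rintegral//.
exact: (integrable_abse fi).
Qed.

End L2_norm.

Section fourier_L2.
Context {R : realType} {n : nat}.
Local Notation V := 'rV[R]_n.
Local Notation mu := (@rV_lebesgue R n).
Implicit Types (f h : V -> R) (g : V -> R[i]).

Definition fourier_cst : R := Num.sqrt (2 * pi) ^- n.

Lemma fourier_cst_gt0 : 0 < fourier_cst.
Proof. by rewrite invr_gt0 exprn_gt0// sqrtr_gt0 mulr_gt0// pi_gt0. Qed.

Lemma sqr_fourier_cst : fourier_cst ^+ 2 * (2 * pi) ^+ n = 1.
Proof.
have p0 : 0 < 2 * pi :> R by rewrite mulr_gt0// pi_gt0.
rewrite /fourier_cst exprVn -exprM mulnC exprM sqr_sqrtr ?ltW//.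
by rewrite mulVf// gt_eqF// exprn_gt0.
Qed.

Lemma Re_fourier f xi : complex.Re (fourier f xi) = fourier_cst * fcos f xi.
Proof. by rewrite /fourier /= mul0r subr0. Qed.

Lemma Im_fourier f xi : complex.Im (fourier f xi) = - (fourier_cst * fsin f xi).
Proof. by rewrite /fourier /= mul0r addr0 mulrN. Qed.

Lemma sqr_normc_ReIm (z : R[i]) : Normc.normc z ^+ 2 = complex.Re z ^+ 2 + complex.Im z ^+ 2.
Proof. by case: z => a b /=; rewrite sqr_sqrtr// addr_ge0 ?sqr_ge0. Qed.

Lemma normc_ge0 (z : R[i]) : 0 <= Normc.normc z.
Proof. by case: z => a b; exact: sqrtr_ge0. Qed.

Lemma normc_le_sub (z w : R[i]) : Normc.normc z <= Normc.normc (w - z) + Normc.normc w.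
Proof.
have -> : Normc.normc (w - z) = Normc.normc (z - w).
  by case: z w => [a b] [c d] /=; rewrite -(sqrrN (c - a)) -(sqrrN (d - b)) !opprB.
by rewrite -{1}(subrK w z); exact: le_normcD.
Qed.

Lemma measurable_normc g :
  measurable_fun setT (fun xi => complex.Re (g xi)) ->
  measurable_fun setT (fun xi => complex.Im (g xi)) ->
  measurable_fun setT (@Normc.normc R \o g).
Proof.
move=> mr mi.
rewrite (_ : _ \o _ = (fun xi => Num.sqrt (complex.Re (g xi) ^+ 2 + complex.Im (g xi) ^+ 2))).
  by apply: (measurableT_comp measurable_sqrt); apply: measurable_funD; exact: measurable_funX.
by apply/funext => xi /=; case: (g xi).
Qed.

Lemma measurable_Re_fourier f : measurable_fun setT f ->
  measurable_fun setT (fun xi => complex.Re (fourier f xi)).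
Proof.
move=> mf; under eq_fun do rewrite Re_fourier.
by apply: measurable_funM => //; exact: measurable_fcos.
Qed.

Lemma measurable_Im_fourier f : measurable_fun setT f ->
  measurable_fun setT (fun xi => complex.Im (fourier f xi)).
Proof.
move=> mf; under eq_fun do rewrite Im_fourier.
apply: measurableT_comp => //.
by apply: measurable_funM => //; exact: measurable_fsin.
Qed.

Lemma LnormC_fourier h : h \in Lfun mu 1 -> h \in Lfun mu 2%:E ->
  LnormC 2%:E (fourier h) = 'N[mu]_2%:E[EFin \o h]%E.
Proof.
move=> h1 h2; rewrite /LnormC.
have mh := Lfun_measurable h1.
have mC := measurable_fcos mh; have mS := measurable_fsin mh.
rewrite !Lnorm2E; congr (_ `^ _)%E.
have ih1 := (Lfun1_integrable mu h).1 h1; have ih2 := Lfun2_integrable_sqr h2.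
have c2 : 0 <= fourier_cst ^+ 2 by rewrite sqr_ge0.
transitivity (\int[mu]_xi ((fourier_cst ^+ 2)%:E * (fcos h xi ^+ 2 + fsin h xi ^+ 2)%:E))%E.
  apply: eq_integral => xi _; rewrite -EFinM; congr EFin.
  by apply: etrans (sqr_normc_ReIm _) _; rewrite Re_fourier Im_fourier; ring.
rewrite ge0_integralZl//; last 2 first.
- by apply/measurable_EFinP; apply: measurable_funD; apply: measurable_funX.
- by move=> xi _; rewrite lee_fin addr_ge0// sqr_ge0.
by rewrite plancherel// -EFinM mulrA sqr_fourier_cst mul1r EFin_Rintegral.
Qed.

(** The approximants [h k] satisfy the isometry by Plancherel's identity. Minkowski's inequality,
    used in both directions, carries it to [f] and [g] up to errors that tend to [0]. *)
Lemma is_fourierL2_norm f g : is_fourierL2 f g ->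
  LnormC 2%:E g = 'N[mu]_2%:E[EFin \o f]%E.
Proof.
move=> [f2 mr mi [h [h1 h2 hf hg]]].
have mf := Lfun_measurable f2.
have mh k := Lfun_measurable (h1 k).
have mg : measurable_fun setT (@Normc.normc R \o g) by exact: measurable_normc.
have mF k : measurable_fun setT (@Normc.normc R \o fourier (h k)).
  by apply: measurable_normc; [exact: measurable_Re_fourier|exact: measurable_Im_fourier].
have mFg k : measurable_fun setT (@Normc.normc R \o (fun xi => fourier (h k) xi - g xi)).
  apply: measurable_normc.
  - rewrite (_ : (fun xi => _) = (fun xi => complex.Re (fourier (h k) xi) - complex.Re (g xi))).
      by apply: measurable_funB => //; exact: measurable_Re_fourier.
    by apply/funext => xi; case: (fourier _ _) (g xi) => [a b] [c e].
  - rewrite (_ : (fun xi => _) = (fun xi => complex.Im (fourier (h k) xi) - complex.Im (g xi))).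
      by apply: measurable_funB => //; exact: measurable_Im_fourier.
    by apply/funext => xi; case: (fourier _ _) (g xi) => [a b] [c e].
have mhf k : measurable_fun setT (h k \- f) by exact: measurable_funB.
have n12 : 1 <= 2 :> R by rewrite ler1n.
have b1 k : (LnormC 2%:E g <= LnormC 2%:E (fun xi => (fourier (h k) xi - g xi)%R)
    + ('N[mu]_2%:E[EFin \o (h k \- f)%R] + 'N[mu]_2%:E[EFin \o f]))%E.
  apply: (@le_trans _ _ (LnormC 2%:E (fun xi => (fourier (h k) xi - g xi)%R) + LnormC 2%:E (fourier (h k)))%E).
    apply: le_trans (minkowski_EFin mu (mFg k) (mF k) n12).
    apply: Lnorm2_mono => //; first exact: measurable_funD.
    move=> xi; rewrite /comp !ger0_norm ?addr_ge0 ?normc_ge0//.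
    exact: normc_le_sub.
  rewrite leeD2l// LnormC_fourier//.
  apply: le_trans (minkowski_EFin mu (mhf k) mf n12).
  apply: Lnorm2_mono => //; first exact: measurable_funD.
  by move=> x /=; rewrite subrK.
have b2 k : ('N[mu]_2%:E[EFin \o f] <= LnormC 2%:E (fun xi => (fourier (h k) xi - g xi)%R)
    + ('N[mu]_2%:E[EFin \o (h k \- f)%R] + LnormC 2%:E g))%E.
  rewrite addeCA.
  apply: (@le_trans _ _ ('N[mu]_2%:E[EFin \o (h k \- f)%R] + 'N[mu]_2%:E[EFin \o (h k)])%E).
    rewrite -(oppe_Lnorm _ (EFin \o (h k \- f)%R)).
    have mhfN : measurable_fun setT (fun x => - (h k \- f) x) by exact: measurableT_comp.
    apply: le_trans (minkowski_EFin mu mhfN (mh k) n12).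
    apply: Lnorm2_mono => //; first exact: measurable_funD.
    by move=> x /=; rewrite opprB subrK.
  rewrite leeD2l// -LnormC_fourier//.
  apply: le_trans (minkowski_EFin mu (mFg k) mg n12).
  apply: Lnorm2_mono => //; [exact: mF|exact: measurable_funD|].
  move=> xi; rewrite /comp !ger0_norm ?addr_ge0 ?normc_ge0//.
  rewrite -{1}(subrK (g xi) (fourier (h k) xi)).
  exact: le_normcD.
have lim (X Y : \bar R) : (forall k, (X <= LnormC 2%:E (fun xi => (fourier (h k) xi - g xi)%R)
    + ('N[mu]_2%:E[EFin \o (h k \- f)%R] + Y)))%E -> (X <= Y)%E.
  move=> XY; apply/lee_addgt0Pr => e e0.
  have e20 : 0 < e / 2 by rewrite divr_gt0.
  have /fine_cvgP[ffin /cvgr0Pnorm_le /(_ _ e20) fle] := hf.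
  have /fine_cvgP[gfin /cvgr0Pnorm_le /(_ _ e20) gle] := hg.
  have [k [[k1 k2] [k3 k4]]] : exists k, ('N[mu]_2%:E[EFin \o (h k \- f)%R]%E \is a fin_num /\
     `|fine 'N[mu]_2%:E[EFin \o (h k \- f)%R]%E| <= e / 2) /\
     (LnormC 2%:E (fun xi => (fourier (h k) xi - g xi)%R) \is a fin_num /\
     `|fine (LnormC 2%:E (fun xi => (fourier (h k) xi - g xi)%R))| <= e / 2).
    near \oo => k; exists k; split; split; near: k; [exact: ffin|exact: fle|exact: gfin|exact: gle].
  apply: (le_trans (XY k)); rewrite addeA addeC leeD2l//.
  rewrite -(fineK k1) -(fineK k3) -EFinD lee_fin [leRHS]splitr lerD//.
  - exact: le_trans (ler_norm _) _.
  - exact: le_trans (ler_norm _) _.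
by apply/eqP; rewrite eq_le !lim.
Unshelve. all: by end_near. Qed.

End fourier_L2.

(** * Averaging over dilations *)

Section oscillation.
Context {R : realType}.
Local Notation leb := (@lebesgue_measure R).

(** After expansion of the square, the constant part [S / 2] integrates to [k * S / 2]. The rest has
    frequencies [2 * T1], [2 * T2], [T1 + T2] and [T1 - T2], all at least [T] in absolute value, so
    its primitive is at most [4 * S / T <= k * S / 8], where the [32] is used. The two endpoints
    cost [k * S / 4], and as much remains. *)
Lemma osc_lower_bound (p0 p1 q0 q1 T1 T2 T k : R) :
  0 < k -> 0 < T -> 32 / k <= T -> T <= T1 -> T <= T2 -> T <= `|T1 - T2| ->
  ((k / 4 * (p0 ^+ 2 + p1 ^+ 2 + q0 ^+ 2 + q1 ^+ 2))%:E <=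
   \int[leb]_(s in `[1%R, (1 + k)%R])
     ((p0 * cos (T1 * s) + p1 * sin (T1 * s)
       + q0 * cos (T2 * s) + q1 * sin (T2 * s)) ^+ 2)%:E)%E.
Proof.
move=> k0 T0 kT TT1 TT2 TT.
set S := p0 ^+ 2 + _ + _ + _.
pose D := T1 - T2; pose P := T1 + T2.
have D0 : D != 0 by rewrite -normr_gt0 (lt_le_trans T0).
have T10 : 0 < T1 by exact: lt_le_trans TT1.
have T20 : 0 < T2 by exact: lt_le_trans TT2.
have P0 : 0 < P by rewrite addr_gt0.
pose f (s : R) := (p0 * cos (T1 * s) + p1 * sin (T1 * s)
       + q0 * cos (T2 * s) + q1 * sin (T2 * s)) ^+ 2.
(* The oscillating part of the primitive [F] of [f], of size O(S / T). *)
pose O (s : R) :=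
  ((p0 ^+ 2 - p1 ^+ 2) / (4 * T1)) * sin ((2 * T1) * s)
  + (- (p0 * p1 / (2 * T1))) * cos ((2 * T1) * s)
  + ((q0 ^+ 2 - q1 ^+ 2) / (4 * T2)) * sin ((2 * T2) * s)
  + (- (q0 * q1 / (2 * T2))) * cos ((2 * T2) * s)
  + ((p0 * q0 + p1 * q1) / D) * sin (D * s)
  + ((p0 * q1 - p1 * q0) / D) * cos (D * s)
  + ((p0 * q0 - p1 * q1) / P) * sin (P * s)
  + (- ((p0 * q1 + p1 * q0) / P)) * cos (P * s).
pose F (s : R) := (S / 2) * s + O s.
have dF (s : R) : is_derive s 1 F (f s).
  apply: is_derive1_eq.
  rewrite /GRing.scale /= !mulr1 /f.
  have -> : D * s = T1 * s - T2 * s by rewrite mulrBl.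
  have -> : P * s = T1 * s + T2 * s by rewrite mulrDl.
  have -> : 2 * T1 * s = T1 * s + T1 * s by ring.
  have -> : 2 * T2 * s = T2 * s + T2 * s by ring.
  rewrite !cosB !sinB !cosD !sinD.
  have := cos2Dsin2 (T1 * s); have := cos2Dsin2 (T2 * s).
  set c1 := cos (T1 * s); set s1 := sin (T1 * s).
  set c2 := cos (T2 * s); set s2 := sin (T2 * s) => h2 h1.
  have -> : S / 2 = (p0 ^+ 2 + p1 ^+ 2) / 2 * (c1 ^+ 2 + s1 ^+ 2)
     + (q0 ^+ 2 + q1 ^+ 2) / 2 * (c2 ^+ 2 + s2 ^+ 2).
    by rewrite h1 h2 /S; field.
  field; rewrite D0 !gt_eqF//.
have cf : continuous f.
  by move=> s; apply: (is_derive1_continuous (a := _)).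
rewrite (@continuous_FTC2 _ _ F).
- rewrite -EFinB lee_fin.
  have Ob s : `|O s| <= 4 * S / T.
    have tr a b c s' : 0 <= b -> T <= `|c| -> `|a| <= b -> `|s'| <= 1 -> `|(a / c) * s'| <= b / T.
      move=> b0 Tc ab s1; rewrite normrM normf_div.
      rewrite (le_trans (ler_piMr _ s1)) ?divr_ge0//.
      by rewrite ler_pM// ?invr_ge0// lef_pV2// posrE (lt_le_trans T0).
    have ns x : `|sin x| <= 1 :> R by rewrite ler_norml sin_geN1 sin_le1.
    have nc x : `|cos x| <= 1 :> R by rewrite ler_norml cos_geN1 cos_le1.
    have T1n : T <= `|4 * T1| by rewrite ger0_norm ?mulr_ge0 ?ltW//; lra.
    have T1m : T <= `|2 * T1| by rewrite ger0_norm ?mulr_ge0 ?ltW//; lra.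
    have T2n : T <= `|4 * T2| by rewrite ger0_norm ?mulr_ge0 ?ltW//; lra.
    have T2m : T <= `|2 * T2| by rewrite ger0_norm ?mulr_ge0 ?ltW//; lra.
    have Pn : T <= `|P| by rewrite ger0_norm ?ltW// /P; lra.
    have sq (x y : R) : 0 <= x ^+ 2 + y ^+ 2 by rewrite addr_ge0 ?sqr_ge0.
    have n1 (x y : R) : `|x ^+ 2 - y ^+ 2| <= x ^+ 2 + y ^+ 2.
      by rewrite ler_norml; have := sqr_ge0 x; have := sqr_ge0 y; lra.
    have n2 (x y : R) : `|x * y| <= (x ^+ 2 + y ^+ 2) / 2.
      by rewrite ler_norml; have := sqr_ge0 (x - y); have := sqr_ge0 (x + y); nra.
    have n3 (x y z w : R) : `|x * y + z * w| <= (x ^+ 2 + y ^+ 2 + z ^+ 2 + w ^+ 2) / 2.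
      apply: (le_trans (ler_normD _ _)); have := n2 x y; have := n2 z w; lra.
    have S0 : 0 <= S by rewrite /S !addr_ge0 ?sqr_ge0.
    have e1 := tr _ _ _ _ (sq p0 p1) T1n (n1 p0 p1) (ns (2 * T1 * s)).
    have e2 := tr _ ((p0 ^+ 2 + p1 ^+ 2) / 2) (2 * T1) (cos (2 * T1 * s)) _ T1m (n2 p0 p1) (nc _).
    have e3 := tr _ _ _ _ (sq q0 q1) T2n (n1 q0 q1) (ns (2 * T2 * s)).
    have e4 := tr _ ((q0 ^+ 2 + q1 ^+ 2) / 2) (2 * T2) (cos (2 * T2 * s)) _ T2m (n2 q0 q1) (nc _).
    have S2 : 0 <= S / 2 by rewrite divr_ge0.
    have m5 : `|p0 * q0 + p1 * q1| <= S / 2 by have := n3 p0 q0 p1 q1; rewrite /S; lra.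
    have m6 : `|p0 * q1 - p1 * q0| <= S / 2 by have := n3 p0 q1 (- p1) q0; rewrite /S sqrrN mulNr; lra.
    have m7 : `|p0 * q0 - p1 * q1| <= S / 2 by have := n3 p0 q0 (- p1) q1; rewrite /S sqrrN mulNr; lra.
    have m8 : `|p0 * q1 + p1 * q0| <= S / 2 by have := n3 p0 q1 p1 q0; rewrite /S; lra.
    have e5 := tr _ _ D (sin (D * s)) S2 TT m5 (ns _).
    have e6 := tr _ _ D (cos (D * s)) S2 TT m6 (nc _).
    have e7 := tr _ _ P (sin (P * s)) S2 Pn m7 (ns _).
    have e8 := tr _ _ P (cos (P * s)) S2 Pn m8 (nc _).
    have {}e2 := e2 (divr_ge0 (sq p0 p1) (ler0n _ 2)).
    have {}e4 := e4 (divr_ge0 (sq q0 q1) (ler0n _ 2)).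
    rewrite /O !mulNr.
    (* The four terms from a single speed add up to [3 / 2 * (S / T)] and the four mixed ones to at
       most [2 * (S / T)]; the coefficient [5 / 2] leaves some slack. *)
    have -> : 4 * S / T = (p0 ^+ 2 + p1 ^+ 2) / T + (p0 ^+ 2 + p1 ^+ 2) / 2 / T
       + (q0 ^+ 2 + q1 ^+ 2) / T + (q0 ^+ 2 + q1 ^+ 2) / 2 / T
       + 5 / 2 * (S / T) .
      by rewrite /S; field; rewrite gt_eqF.
    have ST : 0 <= S / T by rewrite divr_ge0// ltW.
    move: e1 e2 e3 e4 e5 e6 e7 e8; rewrite !ler_norml => /andP[? ?] /andP[? ?] /andP[? ?] /andP[? ?].
    have -> : S / 2 / T = S / T / 2 by field; rewrite gt_eqF.
    move=> /andP[? ?] /andP[? ?] /andP[? ?] /andP[? ?].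
    apply/andP; split; lra.
  have S0 : 0 <= S by rewrite /S !addr_ge0 ?sqr_ge0.
  have b1 := Ob 1; have b2 := Ob (1 + k).
  have : 4 * S / T <= k * S / 8.
    have kT' : 32 <= k * T by move: kT; rewrite ler_pdivrMr// mulrC.
    rewrite ler_pdivrMr//; nra.
  move: b1 b2; rewrite /F !ler_norml => /andP[? ?] /andP[? ?] ?; lra.
- by lra.
- exact: continuous_subspaceT.
- split.
  + by move=> x _; case: (dF x).
  + by apply: cvg_at_right_filter; exact: is_derive1_continuous (dF _).
  + by apply: cvg_at_left_filter; exact: is_derive1_continuous (dF _).
- by move=> x _; rewrite derive1E; case: (dF x).
Qed.

End oscillation.

Section dilation_lower_bound.
Context {R : realType} {n : nat}.
Local Notation V := 'rV[R]_n.
Local Notation mu := (@rV_lebesgue R n).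
Let L : {sigma_finite_measure set (measurableTypeR R) -> \bar R} := @lebesgue_measure R.

(* Up to an error e, phi is a signal with two frequencies which are so large
   and so far apart that [osc_lower_bound] applies on [1, 1 + k]. *)
Definition oscillates (k a e : R) (phi : R -> R) : Prop :=
  exists p0 p1 q0 q1 T1 T2 : R,
    [/\ [/\ 32 / k <= T1, 32 / k <= T2 & 32 / k <= `|T1 - T2|],
        a ^+ 2 <= p0 ^+ 2 + p1 ^+ 2 + q0 ^+ 2 + q1 ^+ 2 &
        forall s, 1 <= s <= 1 + k ->
          `|phi s - (p0 * cos (T1 * s) + p1 * sin (T1 * s)
                     + q0 * cos (T2 * s) + q1 * sin (T2 * s))| <= e].

(** If [phi] is within [e] of the pure signal [w], then [w ^+ 2 <= 2 * phi ^+ 2 + 2 * e ^+ 2]; thus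
    half of the bound [k * a ^+ 2 / 4] survives, minus [k * e ^+ 2]. *)
Lemma oscillates_integral (k a e : R) (phi : R -> R) :
  measurable_fun [set: R] phi -> 0 < k -> oscillates k a e phi ->
  ((k * (a ^+ 2 / 8 - e ^+ 2))%:E <=
   \int[L]_(s in `[1%R, (1 + k)%R]) (phi s ^+ 2)%:E)%E.
Proof.
move=> mphi k0 [p0 [p1 [q0 [q1 [T1 [T2 [[kT1 kT2 kT] aA pe]]]]]]].
have T0 : 0 < 32 / k by rewrite divr_gt0.
have := osc_lower_bound p0 p1 q0 q1 k0 T0 (lexx _) kT1 kT2 kT.
set w := fun s : R => p0 * cos (T1 * s) + p1 * sin (T1 * s)
                     + q0 * cos (T2 * s) + q1 * sin (T2 * s).
rewrite -/(w _) => lo.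
have mt (c : R) : measurable_fun [set: R] (fun s : R => c * s) by exact: measurable_funM.
have mw : measurable_fun [set: R] w.
  by do 3?apply: measurable_funD; apply: measurable_funM => //;
    apply: measurableT_comp (mt _); [exact: measurable_cos|exact: measurable_sin
      |exact: measurable_cos|exact: measurable_sin].
have mI : measurable (`[1%R, (1 + k)%R] : set (measurableTypeR R)) by [].
have mphi2 : measurable_fun `[1%R, (1 + k)%R] (fun s : measurableTypeR R => (phi s ^+ 2)%:E).
  by apply/measurable_EFinP; apply: measurable_funTS; exact: measurable_funX.
have mw2 : measurable_fun `[1%R, (1 + k)%R] (fun s : measurableTypeR R => (w s ^+ 2)%:E).
  by apply/measurable_EFinP; apply: measurable_funTS; exact: measurable_funX.
have LI : L `[1%R, (1 + k)%R]%classic = k%:E.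
  by rewrite /L /= lebesgue_measure_itv/= lte_fin ltrDl k0 -EFinD; congr EFin; ring.
have up : (\int[L]_(s in `[1%R, (1 + k)%R]) (w s ^+ 2)%:E <=
    2%:E * \int[L]_(s in `[1%R, (1 + k)%R]) (phi s ^+ 2)%:E + (2 * k * e ^+ 2)%:E)%E.
  rewrite -ge0_integralZl//; last by move=> *; rewrite lee_fin sqr_ge0.
  have -> : ((2 * k * e ^+ 2)%:E = \int[L]_(s in `[1%R, (1 + k)%R]) (2 * e ^+ 2)%:E)%E.
    rewrite integral_cst//; transitivity ((2 * e ^+ 2)%:E * k%:E)%E.
      by rewrite -EFinM; congr EFin; ring.
    by congr (_ * _)%E; exact: esym LI.
  rewrite -ge0_integralD//; last 3 first.
  - by move=> *; rewrite -EFinM lee_fin mulr_ge0// sqr_ge0.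
  - exact: measurable_funeM.
  - by move=> *; rewrite lee_fin mulr_ge0// sqr_ge0.
  apply: ge0_le_integral => //.
    + by move=> *; rewrite lee_fin sqr_ge0.
    + by apply: emeasurable_funD => //; exact: measurable_funeM.
  move=> s; rewrite /= in_itv/= => /pe; rewrite -/(w s) -EFinM -EFinD lee_fin.
  move=> d; have e0 : 0 <= e by exact: le_trans d.
  have : (phi s - w s) ^+ 2 <= e ^+ 2.
    by rewrite -[leLHS]real_normK ?num_real// ler_pXn2r ?nnegrE.
  by have := sqr_ge0 (2 * phi s - w s); lra.
have {up} lo := le_trans lo up.
case E : (\int[L]_(s in `[1%R, (1 + k)%R]) (phi s ^+ 2)%:E)%E lo => [r| |] //.
- rewrite -EFinM -EFinD !lee_fin => lo.
  have : k * a ^+ 2 <= k * (p0 ^+ 2 + p1 ^+ 2 + q0 ^+ 2 + q1 ^+ 2) by rewrite ler_pM2l.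
  by lra.
- by rewrite leey.
- by have := @integral_ge0 _ _ _ L `[1%R, (1 + k)%R]%classic (fun s => (phi s ^+ 2)%:E)
     (fun s _ => sqr_ge0 (phi s)); rewrite E.
Qed.

(* For each s in [1, 1 + k] the change of variable x = s y gives
   int_N v^2 >= int_B v(s y)^2 dy, since s^n >= 1; average over s and exchange
   the integrals. *)
Lemma dilation_lower_bound (v : V -> R) (B N : set V) (k a e : R) :
  measurable_fun setT v -> measurable B -> measurable N ->
  0 < k -> e ^+ 2 <= a ^+ 2 / 8 ->
  (forall x s, B x -> 1 <= s <= 1 + k -> N (s *: x)) ->
  (forall x, B x -> oscillates k a e (fun s => v (s *: x))) ->
  ((a ^+ 2 / 8 - e ^+ 2)%:E * mu B <= \int[mu]_x (\1_N x * v x ^+ 2)%:E)%E.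
Proof.
move=> mv mB mN k0 ea BN osc.
set c := a ^+ 2 / 8 - e ^+ 2.
have c0 : 0 <= c by rewrite subr_ge0.
have : (0 <= \int[mu]_x (\1_N x * v x ^+ 2)%:E)%E.
  by apply: integral_ge0 => x _; rewrite lee_fin mulr_ge0// sqr_ge0.
(* Nothing is to be proved if the integral is infinite; otherwise it is a real number [I0], and the
   factor [k] can be cancelled at the end. *)
case E : (\int[mu]_x (\1_N x * v x ^+ 2)%:E)%E => [I0| |] // _; last by rewrite leey.
pose I : set (measurableTypeR R) := [set` `[1%R, (1 + k)%R]].
have mI : measurable I by exact: measurable_itv.
have mG0 : measurable_fun setT (fun x => (\1_N x * v x ^+ 2)%:E).
  apply/measurable_EFinP; apply: measurable_funM; first exact: measurable_indic.
  exact: measurable_funX.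
have G00 x : (0 <= (\1_N x * v x ^+ 2)%:E)%E by rewrite lee_fin mulr_ge0// sqr_ge0.
pose G (z : measurableTypeR R * V) : R := \1_I z.1 * (\1_B z.2 * v (z.1 *: z.2) ^+ 2).
have mdil : measurable_fun setT (fun z : measurableTypeR R * V => (z.1 : R) *: z.2).
  apply/measurable_fun_rVP => i; under eq_fun do rewrite mxE.
  apply: measurable_funM; first exact: measurable_fst.
  exact: (measurableT_comp (measurable_rV_coor i) measurable_snd).
have mG : measurable_fun setT G.
  apply: measurable_funM.
    by apply: (measurableT_comp _ measurable_fst); exact: measurable_indic.
  apply: measurable_funM.
    by apply: (measurableT_comp _ measurable_snd); exact: measurable_indic.
  by apply: measurable_funX; exact: measurableT_comp mdil.
have mGE : measurable_fun setT (EFin \o G) by exact/measurable_EFinP.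
have G_ge0 z : (0 <= (EFin \o G) z)%E.
  by rewrite lee_fin mulr_ge0// mulr_ge0// sqr_ge0.
have up : (\int[L]_s \int[mu]_x (G (s, x))%:E <= (k * I0)%:E)%E.
  have -> : ((k * I0)%:E = \int[L]_s (I0%:E * (\1_I s)%:E))%E.
    rewrite ge0_integralZ_indic//.
      rewrite /L /= lebesgue_measure_itv/= lte_fin ltrDl k0 -EFinD -EFinM.
      by congr EFin; ring.
    by rewrite -lee_fin -E; exact: integral_ge0.
  apply: ge0_le_integral => //.
  - by move=> s _; apply: integral_ge0 => x _; exact: G_ge0.
  - exact: (@measurable_fun_fubini_tonelli_F _ _ (measurableTypeR R) _ R mu (EFin \o G)).
  - by apply: measurable_funeM; apply/measurable_EFinP; exact: measurable_indic.
  move=> s _; rewrite -E /G /=; have [sI|sI] := boolP (s \in I); last first.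
    rewrite indicE (negbTE sI) mule0 le_eqVlt; apply/orP; left; apply/eqP.
    by apply: integral0_eq => x _; rewrite mul0r.
  rewrite indicE sI mule1.
  move: sI; rewrite inE /I /= in_itv/= => /[dup] sI /andP[s1 s2].
  have s0 : 0 < s by rewrite (lt_le_trans _ s1).
  have sn : 1 <= s ^+ n by rewrite exprn_ege1.
  have /esym H := ge0_integral_rV_affine (0 : V) s0 mG0 G00.
  rewrite E -EFinM in H.
  apply: (@le_trans _ _ (s ^- n * I0)%:E); last first.
    rewrite E.
    rewrite lee_fin ler_piMl//;first by rewrite -lee_fin -E; exact: integral_ge0.
    by rewrite invf_le1// (lt_le_trans _ sn).
  rewrite H; apply: ge0_le_integral => //.
  - by move=> x _; have := G_ge0 (s, x); rewrite /G /= indicE mem_set.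
  - by have := measurableT_comp mGE (measurable_pair1 s); rewrite /G /comp/= indicE mem_set.
  - exact: measurableT_comp mG0 (measurable_affine_rV s 0).
  move=> x _; rewrite addr0 lee_fin mul1r !indicE.
  have [xB|xB] := boolP (x \in B); last by rewrite mul0r mulr_ge0// sqr_ge0.
  by rewrite mem_set//; apply: BN => //; exact: set_mem.
have lo : ((k * c)%:E * mu B <= \int[mu]_x \int[L]_s (G (s, x))%:E)%E.
  rewrite -ge0_integralZ_indic//; last by rewrite mulr_ge0// ltW.
  apply: ge0_le_integral => //.
  - by move=> x _; rewrite -EFinM lee_fin !mulr_ge0// ltW.
  - by apply: measurable_funeM; apply/measurable_EFinP; exact: measurable_indic.
  - exact: (@measurable_fun_fubini_tonelli_G _ _ (measurableTypeR R) _ R L (EFin \o G)).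
  move=> x _; rewrite /G /= indicE; have [xB|xB] := boolP (x \in B); last first.
    by rewrite mule0; apply: integral_ge0 => s _; rewrite lee_fin mul0r mulr0.
  rewrite mule1.
  have := oscillates_integral _ k0 (osc x (set_mem xB)) => H.
  apply: (le_trans (H _)).
    by apply: measurableT_comp => //; exact: (measurableT_comp mdil (measurable_pair2 x)).
  rewrite le_eqVlt; apply/orP; left; apply/eqP.
  apply: etrans (integral_mkcond _ _) _; apply: eq_integral => s _.
  rewrite /patch mul1r indicE -/I; case: ifP => _; by rewrite ?mul1r ?mul0r.
have H := @fubini_tonelli _ _ _ _ R L mu (EFin \o G) mGE G_ge0.
have := le_trans lo (le_trans _ up); rewrite {}H => /(_ (lexx _)).
by rewrite EFinM -muleA EFinM lee_pmul2l// fin_num_abs.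
Qed.

End dilation_lower_bound.

(** * The Fourier-side solution and its upper bound *)

Section real_sums.
Context {R : realType} {I : finType}.
Implicit Types a : I -> R.

Lemma sumr_sqr_le a : (forall i, 0 <= a i) -> \sum_i a i ^+ 2 <= (\sum_i a i) ^+ 2.
Proof.
move=> a0; rewrite [leRHS]expr2 mulr_suml; apply: ler_sum => i _.
rewrite expr2 ler_wpM2l// (bigD1 i)//= lerDl; exact: sumr_ge0.
Qed.

(** Cauchy-Schwarz against the constant [1]: in the double sum, [a i * a j] is at most the mean of
    the two squares. *)
Lemma sqr_sumr_le a : (\sum_i a i) ^+ 2 <= #|I|%:R * \sum_i a i ^+ 2.
Proof.
rewrite expr2 mulr_suml.
apply: (@le_trans _ _ (\sum_i \sum_j (a i ^+ 2 / 2 + a j ^+ 2 / 2))).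
  apply: ler_sum => i _; rewrite mulr_sumr; apply: ler_sum => j _.
  by have := sqr_ge0 (a i - a j); lra.
pose S := \sum_i a i ^+ 2; pose N : R := #|I|%:R.
have E i : \sum_j (a i ^+ 2 / 2 + a j ^+ 2 / 2) = N * (a i ^+ 2 / 2) + S / 2.
  by rewrite big_split/= sumr_const -mulr_suml mulr_natl.
under eq_bigr do rewrite E.
have -> : \sum_(i : I) (N * (a i ^+ 2 / 2) + S / 2) = N * (S / 2) + N * (S / 2).
  by rewrite big_split/= -mulr_sumr -mulr_suml sumr_const -[(S / 2) *+ _]mulr_natl.
by rewrite -/S -/N -mulrDr -splitr.
Qed.

End real_sums.

(** * The solution in terms of real transforms *)

Section solution_formula.
Context {R : realType} {n : nat}.
Local Notation V := 'rV[R]_n.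
Local Notation mu := (@rV_lebesgue R n).
Implicit Types (xi : V) (F : 'I_n -> R).

Definition udir xi (i : 'I_n) : R := (enorm xi)^-1 * xi ord0 i.

(** The [k]-th component of [P F], the longitudinal part of [F]. It depends on the direction of [xi]
    only and is thus constant along rays. *)
Definition lproj xi F k : R := udir xi k * \sum_l udir xi l * F l.

(** The Fourier-side formula on real vectors. As the multipliers and [P] are real, it acts
    separately on the cosine and the sine transforms of the data. *)
Definition usol (a1 a2 t : R) xi (F0 F1 : 'I_n -> R) (k : 'I_n) : R :=
  cos (t * a1 * enorm xi) * lproj xi F0 k + wave_mult t a1 xi * lproj xi F1 k
  + cos (t * a2 * enorm xi) * (F0 k - lproj xi F0 k)
  + wave_mult t a2 xi * (F1 k - lproj xi F1 k).

Lemma normr_udir_le1 xi i : `|udir xi i| <= 1.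
Proof.
rewrite normrM normfV (ger0_norm (enorm_ge0 _)).
have [->|e0] := eqVneq (enorm xi) 0; first by rewrite invr0 mul0r.
by rewrite ler_pdivrMl ?mulr1 ?coor_le_enorm// lt0r e0 enorm_ge0.
Qed.

Lemma normr_lproj_le xi F k : `|lproj xi F k| <= \sum_l `|F l|.
Proof.
rewrite normrM -[leRHS]mul1r ler_pM ?normr_udir_le1//.
apply: le_trans (ler_norm_sum _ _ _) _; apply: ler_sum => l _.
by rewrite normrM -[leRHS]mul1r ler_pM ?normr_udir_le1.
Qed.

(** The cosine terms are at most [3] times the [l^1] norm of [F0], as [I - P] costs [2] and [P]
    costs [1]; twice the square gives [18]. Each sine term keeps its multiplier, with coefficient at
    most [4 * 4 = 16]. The factor [n] is the passage from [l^1] to [l^2]. *)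
Lemma sqr_usol_le a1 a2 t xi F0 F1 k :
  usol a1 a2 t xi F0 F1 k ^+ 2 <= 18 * n%:R * \sum_l F0 l ^+ 2
   + 16 * n%:R * (wave_mult t a1 xi ^+ 2 + wave_mult t a2 xi ^+ 2) * \sum_l F1 l ^+ 2.
Proof.
pose S0 := \sum_l `|F0 l|; pose S1 := \sum_l `|F1 l|.
have S0n : S0 ^+ 2 <= n%:R * \sum_l F0 l ^+ 2.
  apply: le_trans (sqr_sumr_le _) _; rewrite card_ord.
  by under eq_bigr do rewrite real_normK ?num_real//.
have S1n : S1 ^+ 2 <= n%:R * \sum_l F1 l ^+ 2.
  apply: le_trans (sqr_sumr_le _) _; rewrite card_ord.
  by under eq_bigr do rewrite real_normK ?num_real//.
have F0k : `|F0 k| <= S0 by rewrite /S0 (bigD1 k)//= lerDl sumr_ge0.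
have F1k : `|F1 k| <= S1 by rewrite /S1 (bigD1 k)//= lerDl sumr_ge0.
have L0 := normr_lproj_le xi F0 k; have L1 := normr_lproj_le xi F1 k.
rewrite -/S0 in L0; rewrite -/S1 in L1.
rewrite /usol; set s1 := wave_mult _ a1 _; set s2 := wave_mult _ a2 _.
set A := cos _ * _; set B := s1 * _; set C := cos _ * _; set D := s2 * _.
have hA : `|A| <= S0 by rewrite normrM -[leRHS]mul1r ler_pM// normr_cos_le1.
have hC : `|C| <= 2 * S0.
  rewrite normrM -[leRHS]mul1r ler_pM// ?normr_cos_le1//.
  by apply: le_trans (ler_normB _ _) _; lra.
have hB : B ^+ 2 <= s1 ^+ 2 * S1 ^+ 2.
  by rewrite exprMn ler_wpM2l ?sqr_ge0// -[leLHS]real_normK ?num_real// lerXn2r ?nnegrE// (le_trans _ L1).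
have hD : D ^+ 2 <= s2 ^+ 2 * (2 * S1) ^+ 2.
  rewrite exprMn ler_wpM2l ?sqr_ge0// -[leLHS]real_normK ?num_real//.
  have h : `|F1 k - lproj xi F1 k| <= 2 * S1 by apply: le_trans (ler_normB _ _) _; lra.
  by rewrite lerXn2r ?nnegrE// (le_trans _ h).
have hAC : (A + C) ^+ 2 <= 9 * S0 ^+ 2.
  rewrite (_ : 9 * S0 ^+ 2 = (3 * S0) ^+ 2); last by ring.
  have h : `|A + C| <= 3 * S0 by apply: le_trans (ler_normD _ _) _; lra.
  by rewrite -[leLHS]real_normK ?num_real// lerXn2r ?nnegrE// (le_trans _ h).
have h1 : (A + B + C + D) ^+ 2 <= 2 * (A + C) ^+ 2 + 4 * (B ^+ 2 + D ^+ 2).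
  by have := sqr_ge0 (A + C - B - D); have := sqr_ge0 (B - D); lra.
apply: (le_trans h1).
apply: (@le_trans _ _ (18 * S0 ^+ 2 + 16 * (s1 ^+ 2 + s2 ^+ 2) * S1 ^+ 2)).
  have : 0 <= s1 ^+ 2 * S1 ^+ 2 by rewrite mulr_ge0 ?sqr_ge0.
  by move: hD; rewrite exprMn; lra.
have s12 : 0 <= s1 ^+ 2 + s2 ^+ 2 by rewrite addr_ge0 ?sqr_ge0.
rewrite lerD//; first by rewrite -mulrA ler_pM2l.
set Y := \sum_l F1 l ^+ 2 in S1n *; set s := s1 ^+ 2 + s2 ^+ 2 in s12 *.
rewrite (_ : 16 * n%:R * s * Y = 16 * s * (n%:R * Y)); last by ring.
by rewrite ler_wpM2l// mulr_ge0.
Qed.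

Lemma measurable_udir i : measurable_fun setT (fun xi => udir xi i).
Proof.
apply: measurable_funM; last exact: measurable_rV_coor.
apply: (@measurableT_comp _ _ _ _ _ _ (fun x : R => x^-1)); first exact: measurable_invr.
exact: measurable_enorm.
Qed.

Lemma measurable_lproj (G : 'I_n -> V -> R) k : (forall l, measurable_fun setT (G l)) ->
  measurable_fun setT (fun xi => lproj xi (fun l => G l xi) k).
Proof.
move=> mG; apply: measurable_funM; first exact: measurable_udir.
by apply: measurable_sum => l; apply: measurable_funM => //; exact: measurable_udir.
Qed.

Lemma measurable_usol a1 a2 t (G0 G1 : 'I_n -> V -> R) k :
  (forall l, measurable_fun setT (G0 l)) -> (forall l, measurable_fun setT (G1 l)) ->
  measurable_fun setT (fun xi => usol a1 a2 t xi (fun l => G0 l xi) (fun l => G1 l xi) k).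
Proof.
move=> m0 m1.
have mc a : measurable_fun setT (fun xi : V => cos (t * a * enorm xi)).
  by apply: (measurableT_comp measurable_cos); apply: measurable_funM => //; exact: measurable_enorm.
have ml0 := measurable_lproj k m0; have ml1 := measurable_lproj k m1.
do 3?apply: measurable_funD; apply: measurable_funM => //;
  by [exact: measurable_wave_mult|exact: measurable_funB].
Qed.

Lemma ReM_real (a : R) (z : R[i]) : complex.Re (real_complex R a * z) = a * complex.Re z.
Proof. by case: z => x y /=; rewrite mul0r subr0. Qed.

Lemma ImM_real (a : R) (z : R[i]) : complex.Im (real_complex R a * z) = a * complex.Im z.
Proof. by case: z => x y /=; rewrite mul0r addr0. Qed.

Lemma Re_combination (c1 s1 c2 s2 : R) (A B a b : R[i]) :
  complex.Re (real_complex R c1 * A + real_complex R s1 * B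
    + real_complex R c2 * (a - A) + real_complex R s2 * (b - B)) =
  c1 * complex.Re A + s1 * complex.Re B + c2 * (complex.Re a - complex.Re A)
    + s2 * (complex.Re b - complex.Re B).
Proof. by case: A B a b => ? ? [? ?] [? ?] [? ?] /=; rewrite !mul0r !subr0. Qed.

Lemma Im_combination (c1 s1 c2 s2 : R) (A B a b : R[i]) :
  complex.Im (real_complex R c1 * A + real_complex R s1 * B
    + real_complex R c2 * (a - A) + real_complex R s2 * (b - B)) =
  c1 * complex.Im A + s1 * complex.Im B + c2 * (complex.Im a - complex.Im A)
    + s2 * (complex.Im b - complex.Im B).
Proof. by case: A B a b => ? ? [? ?] [? ?] [? ?] /=; rewrite !mul0r !addr0. Qed.

Lemma projection_sum_entry (K : comNzRingType) (c1 s1 c2 s2 : K) (P : 'M[K]_n)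
    (v0 v1 : 'cV[K]_n) k :
  (c1 *: (P *m v0) + s1 *: (P *m v1) + c2 *: ((1%:M - P) *m v0)
    + s2 *: ((1%:M - P) *m v1)) k ord0 =
  let p v := \sum_l P k l * v l ord0 in
  c1 * p v0 + s1 * p v1 + c2 * (v0 k ord0 - p v0) + s2 * (v1 k ord0 - p v1).
Proof. by rewrite !mulmxBl !mul1mx !mxE. Qed.

Lemma Re_sum (G : 'I_n -> R[i]) : complex.Re (\sum_l G l) = \sum_l complex.Re (G l).
Proof. exact: (raddf_sum (@complex.Re R)). Qed.

Lemma Im_sum (G : 'I_n -> R[i]) : complex.Im (\sum_l G l) = \sum_l complex.Im (G l).
Proof. exact: (raddf_sum (@complex.Im R)). Qed.

Lemma lprojZ c xi F k : lproj xi (fun l => c * F l) k = c * lproj xi F k.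
Proof.
rewrite /lproj mulrCA; congr (_ * _); rewrite mulr_sumr.
by apply: eq_bigr => l _; rewrite mulrCA.
Qed.

Lemma usolZ c a1 a2 t xi F0 F1 k :
  usol a1 a2 t xi (fun l => c * F0 l) (fun l => c * F1 l) k = c * usol a1 a2 t xi F0 F1 k.
Proof. by rewrite /usol !lprojZ; ring. Qed.

Lemma dirprojE xi k l : dirproj xi k l = udir xi k * udir xi l.
Proof. by rewrite /dirproj !mxE big_ord1 !mxE. Qed.

Section elastic.
Local Notation cst := (@fourier_cst R n).
Variables lambda mu0 : R.
Variable f : 'I_2 -> 'I_n -> V -> R.
Let a1 := Num.sqrt (lambda + 2 * mu0).
Let a2 := Num.sqrt mu0.

Lemma elastic_hatE t xi k : elastic_hat lambda mu0 f t xi k ord0 =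
  let P j := \sum_l real_complex R (udir xi k * udir xi l) * fourier (f j l) xi in
  real_complex R (cos (t * a1 * enorm xi)) * P 0
  + real_complex R (wave_mult t a1 xi) * P 1
  + real_complex R (cos (t * a2 * enorm xi)) * (fourier (f 0 k) xi - P 0)
  + real_complex R (wave_mult t a2 xi) * (fourier (f 1 k) xi - P 1).
Proof.
have pm j : \sum_l map_mx (real_complex R) (dirproj xi) k l * (\col_k fourier (f j k) xi) l ord0
   = \sum_l real_complex R (udir xi k * udir xi l) * fourier (f j l) xi.
  by apply: eq_bigr => l _; rewrite -dirprojE; congr (_ * _); rewrite mxE.
apply: etrans (projection_sum_entry _ _ _ _ _ _ _ _) _; cbv beta zeta.
by rewrite !pm; do 2?congr (_ + _); congr (_ * (_ - _)); rewrite mxE.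
Qed.

Lemma Re_elastic_hat t xi k : complex.Re (elastic_hat lambda mu0 f t xi k ord0) =
  cst * usol a1 a2 t xi (fun l => fcos (f 0 l) xi) (fun l => fcos (f 1 l) xi) k.
Proof.
have E j : complex.Re (\sum_l real_complex R (udir xi k * udir xi l) * fourier (f j l) xi)
    = lproj xi (fun l => cst * fcos (f j l) xi) k.
  rewrite Re_sum /lproj mulr_sumr; apply: eq_bigr => l _.
  by rewrite ReM_real Re_fourier -!mulrA.
rewrite elastic_hatE; cbv beta zeta; rewrite Re_combination !E !Re_fourier -usolZ.
by [].
Qed.

Lemma Im_elastic_hat t xi k : complex.Im (elastic_hat lambda mu0 f t xi k ord0) =
  - cst * usol a1 a2 t xi (fun l => fsin (f 0 l) xi) (fun l => fsin (f 1 l) xi) k.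
Proof.
have E j : complex.Im (\sum_l real_complex R (udir xi k * udir xi l) * fourier (f j l) xi)
    = lproj xi (fun l => - cst * fsin (f j l) xi) k.
  rewrite Im_sum /lproj mulr_sumr; apply: eq_bigr => l _.
  by rewrite ImM_real Im_fourier -mulNr -!mulrA.
rewrite elastic_hatE; cbv beta zeta; rewrite Im_combination !E !Im_fourier -!(mulNr cst) -usolZ.
by [].
Qed.

End elastic.
End solution_formula.

(** * Energy estimate and upper bound for the norms *)

Section upper_bound.
Context {R : realType} {n : nat}.
Local Notation V := 'rV[R]_n.
Local Notation mu := (@rV_lebesgue R n).
Local Notation cst := (@fourier_cst R n).
Implicit Types (h : V -> R).

Lemma box1_or_enorm (xi : V) : rV_box 1 xi \/ 1 <= enorm xi.
Proof.
have [|e1] := leP 1 (enorm xi); first by right.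
left => i; rewrite in_itv/= -ler_norml.
exact: le_trans (coor_le_enorm _ _) (ltW e1).
Qed.

Lemma power_spectrum_le h xi : mu.-integrable setT (EFin \o h) ->
  fcos h xi ^+ 2 + fsin h xi ^+ 2 <= 2 * (\int[mu]_x `|h x|) ^+ 2.
Proof.
move=> ih; have c := fcos_le ih xi; have s := fsin_le ih xi.
have sq (x y : R) : `|x| <= y -> x ^+ 2 <= y ^+ 2.
  by move=> xy; rewrite -[leLHS]real_normK ?num_real// lerXn2r ?nnegrE// (le_trans _ xy).
by have := sq _ _ c; have := sq _ _ s; lra.
Qed.

(** On the unit cube the power spectrum of [f1 l] is replaced by its bound [2 * Y l ^+ 2], and the
    multipliers are integrated; elsewhere [|xi| >= 1], the multipliers are bounded, and Plancherel
    applies to [f1 l]. The function [g l] sums both bounds over the whole space. Starting from [16],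
    the power spectrum and the two multipliers each double the constant, giving [64]. *)
Lemma usol_energy_le (a1 a2 t K : R) (f0 f1 : 'I_n -> V -> R) k :
  0 < a1 -> 0 < a2 ->
  (forall l, f0 l \in Lfun mu 1) -> (forall l, f0 l \in Lfun mu 2%:E) ->
  (forall l, f1 l \in Lfun mu 1) -> (forall l, f1 l \in Lfun mu 2%:E) ->
  (\int[mu]_xi (\1_(rV_box 1) xi * wave_mult t a1 xi ^+ 2)%:E <= K%:E)%E ->
  (\int[mu]_xi (\1_(rV_box 1) xi * wave_mult t a2 xi ^+ 2)%:E <= K%:E)%E ->
  (\int[mu]_xi (usol a1 a2 t xi (fun l => fcos (f0 l) xi) (fun l => fcos (f1 l) xi) k ^+ 2
     + usol a1 a2 t xi (fun l => fsin (f0 l) xi) (fun l => fsin (f1 l) xi) k ^+ 2)%:E <=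
   (\sum_l (18 * n%:R * ((2 * pi) ^+ n * \int[mu]_x (f0 l x ^+ 2))
      + 64 * n%:R * K * (\int[mu]_x `|f1 l x|) ^+ 2
      + 16 * n%:R * (a1 ^- 2 + a2 ^- 2) * ((2 * pi) ^+ n * \int[mu]_x (f1 l x ^+ 2))))%:E)%E.
Proof.
move=> a10 a20 h01 h02 h11 h12 K1 K2.
have i0 l := (Lfun1_integrable mu (f0 l)).1 (h01 l).
have i1 l := (Lfun1_integrable mu (f1 l)).1 (h11 l).
have q0 l := Lfun2_integrable_sqr (h02 l).
have q1 l := Lfun2_integrable_sqr (h12 l).
have m0 l := Lfun_measurable (h01 l).
have m1 l := Lfun_measurable (h11 l).
pose E (h : V -> R) xi := fcos h xi ^+ 2 + fsin h xi ^+ 2.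
have E0 h xi : 0 <= E h xi by rewrite addr_ge0 ?sqr_ge0.
have mE h : measurable_fun setT h -> measurable_fun setT (E h).
  by move=> mh; apply: measurable_funD; apply: measurable_funX;
    [exact: measurable_fcos|exact: measurable_fsin].
pose Y l := \int[mu]_x `|f1 l x|.
pose D : R := 16 * n%:R * (a1 ^- 2 + a2 ^- 2).
have D0 : 0 <= D by rewrite mulr_ge0 ?mulr_ge0// addr_ge0// invr_ge0 ?exprn_ge0 ?ltW.
pose s1 (xi : V) := \1_(rV_box 1) xi * wave_mult t a1 xi ^+ 2.
pose s2 (xi : V) := \1_(rV_box 1) xi * wave_mult t a2 xi ^+ 2.
have s10 xi : 0 <= s1 xi by rewrite mulr_ge0// sqr_ge0.
have s20 xi : 0 <= s2 xi by rewrite mulr_ge0// sqr_ge0.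
have mbox : measurable (rV_box 1 : set V) by exact: measurable_rV_box.
have ms a : measurable_fun setT (fun xi : V => \1_(rV_box 1) xi * wave_mult t a xi ^+ 2).
  apply: measurable_funM; first exact: measurable_indic.
  by apply: measurable_funX; exact: measurable_wave_mult.
have n0 : 0 <= n%:R :> R by [].
have Y0 l : 0 <= 32 * n%:R * Y l ^+ 2 by rewrite mulr_ge0 ?sqr_ge0 ?mulr_ge0.
pose g l xi := 18 * n%:R * E (f0 l) xi + 32 * n%:R * Y l ^+ 2 * (s1 xi + s2 xi) + D * E (f1 l) xi.
have mterm (c : R) (h : V -> R) : measurable_fun setT h -> measurable_fun setT (fun xi => c * h xi).
  by move=> mh; exact: measurable_funM.
have mtE0 l : measurable_fun setT (fun xi => 18 * n%:R * E (f0 l) xi) by exact: mterm (mE _ (m0 l)).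
have mtE1 l : measurable_fun setT (fun xi => D * E (f1 l) xi) by exact: mterm (mE _ (m1 l)).
have mts l : measurable_fun setT (fun xi => 32 * n%:R * Y l ^+ 2 * (s1 xi + s2 xi)).
  exact: mterm (measurable_funD (ms a1) (ms a2)).
have mg l : measurable_fun setT (g l).
  exact: (measurable_funD (measurable_funD (mtE0 l) (mts l)) (mtE1 l)).
have g0 l xi : 0 <= g l xi.
  by rewrite !addr_ge0// mulr_ge0// ?addr_ge0// mulr_ge0.
have intZ (c : R) (h : V -> R) : 0 <= c -> (forall xi, 0 <= h xi) -> measurable_fun setT h ->
    (\int[mu]_xi (c * h xi)%:E = c%:E * \int[mu]_xi (h xi)%:E)%E.
  move=> c0 h0 mh; rewrite -ge0_integralZl//; first exact/measurable_EFinP.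
  by move=> x _; rewrite lee_fin.
have intD (h h' : V -> R) : (forall xi, 0 <= h xi) -> (forall xi, 0 <= h' xi) ->
    measurable_fun setT h -> measurable_fun setT h' ->
    (\int[mu]_xi (h xi + h' xi)%:E = \int[mu]_xi (h xi)%:E + \int[mu]_xi (h' xi)%:E)%E.
  move=> h0 h'0 mh mh'; rewrite -ge0_integralD//; [|exact/measurable_EFinP|
    |exact/measurable_EFinP]; by move=> x _; rewrite lee_fin.
apply: (@le_trans _ _ (\int[mu]_xi (\sum_l (g l xi)%:E))%E).
  apply: ge0_le_integral => //.
  - by move=> xi _; rewrite lee_fin addr_ge0// sqr_ge0.
  - apply/measurable_EFinP; apply: measurable_funD; apply: measurable_funX.
      exact: (measurable_usol a1 a2 t k (fun l => measurable_fcos (m0 l)) (fun l => measurable_fcos (m1 l))).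
    exact: (measurable_usol a1 a2 t k (fun l => measurable_fsin (m0 l)) (fun l => measurable_fsin (m1 l))).
  - by apply: emeasurable_sum => l; exact/measurable_EFinP.
  move=> xi _; rewrite sumEFin lee_fin.
  have c := sqr_usol_le a1 a2 t xi (fun l => fcos (f0 l) xi) (fun l => fcos (f1 l) xi) k.
  have s := sqr_usol_le a1 a2 t xi (fun l => fsin (f0 l) xi) (fun l => fsin (f1 l) xi) k.
  apply: (le_trans (lerD c s)).
  set w1 := wave_mult t a1 xi; set w2 := wave_mult t a2 xi.
  pose S := \sum_l E (f1 l) xi.
  have SE f : \sum_l fcos (f l) xi ^+ 2 + \sum_l fsin (f l) xi ^+ 2 = \sum_(l < n) E (f l) xi.
    by rewrite -big_split.
  have -> : \sum_l g l xi = 18 * n%:R * (\sum_l E (f0 l) xi)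
      + 16 * n%:R * ((2 * \sum_l Y l ^+ 2) * (s1 xi + s2 xi)) + D * S.
    rewrite /g 2!big_split/= -!mulr_sumr -mulr_suml -mulr_sumr.
    by congr (_ + _ + _); ring.
  have -> (c0 c1 w A B A' B' : R) : c0 * A + c1 * w * B + (c0 * A' + c1 * w * B') =
      c0 * (A + A') + c1 * (w * (B + B')) by ring.
  rewrite !SE -/S -addrA lerD2l.
  have S0 : 0 <= S by apply: sumr_ge0 => l _; exact: E0.
  have SY : S <= 2 * \sum_l Y l ^+ 2.
    by rewrite mulr_sumr; apply: ler_sum => l _; exact: power_spectrum_le.
  have YY : 0 <= \sum_l Y l ^+ 2 by apply: sumr_ge0 => l _; exact: sqr_ge0.
  have -> : D * S = 16 * n%:R * ((a1 ^- 2 + a2 ^- 2) * S) by rewrite /D mulrA.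
  rewrite -mulrDr ler_wpM2l ?mulr_ge0//.
  have [bx|e1] := box1_or_enorm xi.
    rewrite /s1 /s2 indicE mem_set// !mul1r -/w1 -/w2.
    apply: (@le_trans _ _ ((2 * \sum_l Y l ^+ 2) * (w1 ^+ 2 + w2 ^+ 2))).
      by rewrite mulrC ler_wpM2r// addr_ge0// sqr_ge0.
    by rewrite lerDl mulr_ge0// addr_ge0// invr_ge0 exprn_ge0// ltW.
  apply: (@le_trans _ _ ((a1 ^- 2 + a2 ^- 2) * S)).
    rewrite ler_wpM2r// lerD//.
      by have := sqr_wave_mult_le_freq t a10 ltr01 e1; rewrite mulr1.
    by have := sqr_wave_mult_le_freq t a20 ltr01 e1; rewrite mulr1.
  by rewrite lerDr mulr_ge0 ?mulr_ge0// addr_ge0.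
rewrite ge0_integral_sum//; last 2 first.
- by move=> l; exact/measurable_EFinP.
- by move=> l xi _; rewrite lee_fin.
rewrite -sumEFin; apply: lee_sum => l _.
rewrite /g intD//; last 3 first.
- by move=> xi; rewrite addr_ge0// mulr_ge0// ?addr_ge0// mulr_ge0.
- by move=> xi; rewrite mulr_ge0.
- exact: (measurable_funD (mtE0 l) (mts l)).
rewrite (intD _ _ _ _ (mtE0 l) (mts l))//; last 2 first.
- by move=> xi; rewrite mulr_ge0// mulr_ge0.
- by move=> xi; rewrite mulr_ge0// addr_ge0.
rewrite !intZ//; last 4 first.
- exact: mE.
- by move=> xi; rewrite addr_ge0.
- exact: (measurable_funD (ms a1) (ms a2)).
- exact: mE.
rewrite !(plancherel (i0 l) (q0 l)) !(plancherel (i1 l) (q1 l)) !EFinD -!EFinM.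
rewrite leeD2r// leeD2l// intD//; [|exact: ms|exact: ms].
have Kr : (\int[mu]_xi (s1 xi)%:E + \int[mu]_xi (s2 xi)%:E <= (2 * K)%:E)%E.
  by rewrite mulr_natl mulr2n EFinD; exact: leeD.
apply: (le_trans (lee_wpmul2l _ Kr)); first by rewrite lee_fin.
rewrite -EFinM lee_fin -/(Y l) le_eqVlt; apply/orP; left; apply/eqP; ring.
Qed.

End upper_bound.

Section norm_upper_bound.
Context {R : realType} {n : nat}.
Local Notation V := 'rV[R]_n.
Local Notation mu := (@rV_lebesgue R n).
Local Notation cst := (@fourier_cst R n).
Variables lambda mu0 : R.
Hypotheses (hlm : 0 < lambda + 2 * mu0) (hmu : 0 < mu0).
Let a1 := Num.sqrt (lambda + 2 * mu0).
Let a2 := Num.sqrt mu0.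
Implicit Types (f : 'I_2 -> 'I_n -> V -> R) (u : R -> 'I_n -> V -> R).

Lemma elastic_norm_energy f u t k : elastic_solution lambda mu0 f u -> 0 <= t ->
  (forall j l, measurable_fun setT (f j l)) ->
  'N[mu]_2%:E[EFin \o u t k]%E = 'N[mu]_2%:E[EFin \o (fun xi => (cst *
    Num.sqrt (usol a1 a2 t xi (fun l => fcos (f 0 l) xi) (fun l => fcos (f 1 l) xi) k ^+ 2
     + usol a1 a2 t xi (fun l => fsin (f 0 l) xi) (fun l => fsin (f 1 l) xi) k ^+ 2))%R)]%E.
Proof.
move=> su t0 mf; rewrite -(is_fourierL2_norm (su t t0 k)) /LnormC.
congr ('N[mu]_2%:E[EFin \o _]%E); apply/funext => xi /=.
have c0 := ltW (@fourier_cst_gt0 R n).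
apply/eqP; rewrite -(@eqrXn2 _ 2)// ?normc_ge0 ?mulr_ge0 ?sqrtr_ge0//.
rewrite sqr_normc_ReIm Re_elastic_hat Im_elastic_hat !exprMn sqr_sqrtr ?addr_ge0 ?sqr_ge0//.
by apply/eqP; rewrite -/a1 -/a2; ring.
Qed.

Lemma elastic_norm_upper : exists2 C : R, 0 < C & forall f u t K,
  elastic_data f -> elastic_solution lambda mu0 f u -> 0 <= t -> 0 <= K ->
  (\int[mu]_xi (\1_(rV_box 1) xi * wave_mult t a1 xi ^+ 2)%:E <= K%:E)%E ->
  (\int[mu]_xi (\1_(rV_box 1) xi * wave_mult t a2 xi ^+ 2)%:E <= K%:E)%E ->
  (vec_Lnorm 2%:E (u t) <= C%:E * (vec_Lnorm 2%:E (f 0%R)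
     + vec_Lnorm 1 (f 1%R) * (Num.sqrt K)%:E + vec_Lnorm 2%:E (f 1%R)))%E.
Proof.
have a10 : 0 < a1 by rewrite sqrtr_gt0.
have a20 : 0 < a2 by rewrite sqrtr_gt0.
pose D : R := 16 * n%:R * (a1 ^- 2 + a2 ^- 2).
have D0 : 0 <= D by rewrite mulr_ge0 ?mulr_ge0// addr_ge0// invr_ge0 ?exprn_ge0 ?ltW.
(* The three coefficients of the energy estimate after multiplication by [cst ^+ 2], which cancels
   the factor [(2 * pi) ^+ n] of the two Plancherel terms. *)
pose M : R := 18 * n%:R + 64 * n%:R * cst ^+ 2 + D.
have n0 : 0 <= n%:R :> R by [].
have C0 : 0 <= 64 * n%:R * cst ^+ 2 by rewrite mulr_ge0 ?sqr_ge0 ?mulr_ge0.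
have n18 : 0 <= 18 * n%:R :> R by rewrite mulr_ge0.
have M1 : 18 * n%:R <= M by rewrite /M; lra.
have M2 : 64 * n%:R * cst ^+ 2 <= M.
  by rewrite /M; lra.
have M3 : D <= M by rewrite /M; lra.
have M0 : 0 <= M by exact: le_trans D0 M3.
(* Every one of the [n] components is at most [Num.sqrt M * Z]; the [+ 1] makes the constant
   positive even if [n = 0]. *)
exists (n%:R * Num.sqrt M + 1); first by rewrite ltr_wpDl// mulr_ge0// sqrtr_ge0.
move=> f u t K df su t0 K0 K1 K2.
have h02 l : f 0 l \in Lfun mu 2%:E by have [[]] := df l.
have h01 l : f 0 l \in Lfun mu 1 by have [] := df l.
have h12 l : f 1 l \in Lfun mu 2%:E by have [] := df l.
have h11 l : f 1 l \in Lfun mu 1 by have [] := df l.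
have m0 l := Lfun_measurable (h01 l).
have m1 l := Lfun_measurable (h11 l).
pose X0 l := Num.sqrt (\int[mu]_x (f 0 l x ^+ 2)).
pose X1 l := Num.sqrt (\int[mu]_x (f 1 l x ^+ 2)).
pose Y l := \int[mu]_x `|f 1 l x|.
have X00 l : 0 <= X0 l by exact: sqrtr_ge0.
have X10 l : 0 <= X1 l by exact: sqrtr_ge0.
have Y0 l : 0 <= Y l by exact: Rintegral_ge0.
have K20 : 0 <= Num.sqrt K by exact: sqrtr_ge0.
pose Z := \sum_l (X0 l + Num.sqrt K * Y l + X1 l).
have Z0 : 0 <= Z by apply: sumr_ge0 => l _; rewrite !addr_ge0// mulr_ge0.
have SX (h : V -> R) : Num.sqrt (\int[mu]_x (h x ^+ 2)) ^+ 2 = \int[mu]_x (h x ^+ 2).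
  by rewrite sqr_sqrtr//; apply: Rintegral_ge0 => x _; exact: sqr_ge0.
have -> : (vec_Lnorm 2%:E (f 0%R) + vec_Lnorm 1 (f 1%R) * (Num.sqrt K)%:E
     + vec_Lnorm 2%:E (f 1%R) = Z%:E)%E.
  rewrite /vec_Lnorm.
  under eq_bigr do rewrite Lfun2_norm//.
  under [X in (_ + X * _ + _)%E]eq_bigr do rewrite Lfun1_norm//.
  under [X in (_ + _ + X)%E]eq_bigr do rewrite Lfun2_norm//.
  rewrite !sumEFin -EFinM -!EFinD; congr EFin.
  by rewrite /Z !big_split/= -mulr_sumr mulrC.
have uk k : ('N[mu]_2%:E[EFin \o u t k] <= (Num.sqrt M * Z)%:E)%E.
  rewrite (elastic_norm_energy k su t0); last first.
    by move=> j l; case: (unliftP 0 j) => [i|] ->//; rewrite (ord1 i) (_ : lift _ _ = 1)//; exact: val_inj.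
  apply: Lnorm2_le; first by rewrite mulr_ge0// sqrtr_ge0.
  have mU : measurable_fun setT (fun xi =>
     usol a1 a2 t xi (fun l => fcos (f 0 l) xi) (fun l => fcos (f 1 l) xi) k ^+ 2
     + usol a1 a2 t xi (fun l => fsin (f 0 l) xi) (fun l => fsin (f 1 l) xi) k ^+ 2).
    apply: measurable_funD; apply: measurable_funX.
      exact: (measurable_usol a1 a2 t k (fun l => measurable_fcos (m0 l)) (fun l => measurable_fcos (m1 l))).
    exact: (measurable_usol a1 a2 t k (fun l => measurable_fsin (m0 l)) (fun l => measurable_fsin (m1 l))).
  under eq_integral do rewrite exprMn sqr_sqrtr ?addr_ge0 ?sqr_ge0// EFinM.
  rewrite ge0_integralZl//; last 3 first.
  - exact/measurable_EFinP.
  - by move=> xi _; rewrite lee_fin addr_ge0 ?sqr_ge0.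
  - by rewrite lee_fin sqr_ge0.
  have := @usol_energy_le _ _ a1 a2 t K (f 0) (f 1) k a10 a20 h01 h02 h11 h12 K1 K2.
  move=> /(lee_wpmul2l _) H; apply: (le_trans (H (cst ^+ 2)%:E _)); first by rewrite lee_fin sqr_ge0.
  rewrite -EFinM lee_fin (_ : (Num.sqrt M * Z) ^+ 2 = M * Z ^+ 2); last by rewrite exprMn sqr_sqrtr.
  apply: (@le_trans _ _ (M * \sum_l (X0 l + Num.sqrt K * Y l + X1 l) ^+ 2)); last first.
    by rewrite ler_wpM2l//; apply: sumr_sqr_le => l; rewrite !addr_ge0// mulr_ge0.
  rewrite !mulr_sumr; apply: ler_sum => l _.
  apply: (@le_trans _ _ (M * (X0 l ^+ 2 + K * Y l ^+ 2 + X1 l ^+ 2))); last first.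
    rewrite ler_wpM2l//.
    have -> : K * Y l ^+ 2 = (Num.sqrt K * Y l) ^+ 2 by rewrite exprMn sqr_sqrtr.
    have : 0 <= Num.sqrt K * Y l by rewrite mulr_ge0.
    move: (Num.sqrt K * Y l) => y y0.
    have := mulr_ge0 (X00 l) y0; have := mulr_ge0 (X00 l) (X10 l); have := mulr_ge0 y0 (X10 l).
    by lra.
  rewrite -(SX (f 0 l)) -(SX (f 1 l)) -/(X0 l) -/(X1 l) -/(Y l) -/D.
  have -> (c m D' P x y z : R) : c * (18 * m * (P * x) + 64 * m * K * y + D' * (P * z)) =
     (c * P) * (18 * m * x) + 64 * m * c * (K * y) + (c * P) * (D' * z) by ring.
  rewrite sqr_fourier_cst !mul1r !mulrDr !lerD// ler_wpM2r ?sqr_ge0//.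
  by rewrite mulr_ge0 ?sqr_ge0.
apply: (@le_trans _ _ (\sum_(k < n) (Num.sqrt M * Z)%:E)%E).
  by apply: lee_sum => k _; exact: uk.
rewrite sumEFin big_const_ord iter_addr_0 -EFinM lee_fin.
by rewrite mulrDl mul1r -mulrA mulr_natl lerDl.
Qed.

End norm_upper_bound.

(** * Lower bounds *)

Section orthant_boxes.
Context {R : realType} {n : nat}.
Local Notation V := 'rV[R]_n.
Local Notation mu := (@rV_lebesgue R n).
Implicit Types (b : 'I_n -> bool) (x : V) (r : R).

(** A cube in the orthant with sign pattern [b], at distance [r] from all coordinate hyperplanes, so
    that no component of the direction is small there. *)
Definition obox b r r' : set V :=
  [set x | forall l, (-1) ^+ b l * x ord0 l \in `[r, r']].

Lemma oboxE b r r' : obox b r r' = [set x : V | forall l, x ord0 l \in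
  `[(\row_l (if b l then - r' else r)) ord0 l, (\row_l (if b l then - r else r')) ord0 l]].
Proof.
apply/seteqP; split => x H l; have := H l; rewrite !mxE; case: (b l);
  rewrite /= ?expr1 ?expr0 ?mul1r ?mulN1r !in_itv/= => /andP[? ?];
  by apply/andP; split; lra.
Qed.

Lemma measurable_obox b r r' : measurable (obox b r r').
Proof. by rewrite oboxE; exact: measurable_rV_rect. Qed.

Lemma rV_lebesgue_obox b r r' : r <= r' -> mu (obox b r r') = ((r' - r) ^+ n)%:E.
Proof.
move=> rr; rewrite oboxE rV_lebesgue_box; last first.
  by move=> i; rewrite !mxE; case: (b i) => //; rewrite lerN2.
congr EFin; under eq_bigr do rewrite !mxE.
rewrite (eq_bigr (fun=> r' - r)) ?prodr_const ?card_ord// => i _.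
by case: (b i) => //; rewrite opprK addrC.
Qed.

Lemma obox_scale b r x s : 0 < r -> obox b r (2 * r) x -> 1 <= s <= 2 ->
  obox b r (4 * r) (s *: x).
Proof.
move=> r0 bx /andP[s1 s2] l; have := bx l; rewrite mxE mulrCA !in_itv/= => /andP[h1 h2].
move: h1 h2; set y := _ * _ => h1 h2.
apply/andP; split; nra.
Qed.

Lemma obox_normr b r r' x l : obox b r r' x -> r <= `|x ord0 l| /\ (0 < r -> `|x ord0 l| <= r').
Proof.
move=> /(_ l); rewrite in_itv/= => /andP[h1 h2].
have E : `|x ord0 l| = `|(-1) ^+ b l * x ord0 l| by rewrite normrM normr_sign mul1r.
split; first by rewrite E (le_trans h1)// ler_norm.
by move=> r0; rewrite E ger0_norm// (le_trans (ltW r0)).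
Qed.

Lemma enorm_le_box x r : 0 <= r -> (forall l, `|x ord0 l| <= r) -> enorm x <= n%:R * r.
Proof.
move=> r0 xr; rewrite -(@ler_pXn2r _ 2)// ?nnegrE ?enorm_ge0 ?mulr_ge0// sqr_enorm.
apply: (@le_trans _ _ (\sum_(l < n) r ^+ 2)).
  apply: ler_sum => l _; rewrite -expr2 -[leLHS]real_normK ?num_real//.
  by rewrite lerXn2r ?nnegrE.
rewrite sumr_const card_ord -[leLHS]mulr_natl exprMn ler_wpM2r ?sqr_ge0//.
by rewrite -natrX ler_nat; case: (n) => // m; rewrite leq_pmull.
Qed.

(* x and m have the same signs, so nothing cancels in the sum of x_l m_l. *)
Lemma lproj_obox_ge b r x (m G : 'I_n -> R) (k0 k : 'I_n) :
  0 < r -> obox b r (2 * r) x -> (forall l, 0 <= (-1) ^+ b l * m l) ->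
  \sum_l `|G l - m l| <= `|m k0| / (4 * n%:R) ->
  `|m k0| / (8 * n%:R ^+ 2) <= `|lproj x G k|.
Proof.
move=> r0 bx bm Gm.
have n0 : 0 < n%:R :> R by rewrite ltr0n (leq_trans _ (ltn_ord k)).
have xr l := (obox_normr l bx).2 r0.
have rx l := (obox_normr l bx).1.
have r20 : 0 <= 2 * r by rewrite mulr_ge0// ltW.
have ex := enorm_le_box r20 xr.
have e0 : 0 < enorm x.
  by apply: lt_le_trans (coor_le_enorm _ k); exact: lt_le_trans r0 (rx k).
have ul l : (2 * n%:R)^-1 <= `|udir x l|.
  rewrite normrM normfV (gtr0_norm e0) ler_pdivlMl// ler_pdivrMr ?mulr_gt0//.
  have := rx l; have := ltW n0; nra.
have um l : udir x l * m l = `|udir x l| * `|m l|.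
  have := bx l; rewrite in_itv/= => /andP[h _].
  have h0 : 0 <= (-1) ^+ b l * udir x l.
    by rewrite /udir mulrCA mulr_ge0 ?invr_ge0 ?(ltW e0)// (le_trans (ltW r0)).
  have sg (y : R) : 0 <= (-1) ^+ b l * y -> `|y| = (-1) ^+ b l * y.
    by move=> /ger0_norm; rewrite normrM normr_sign mul1r.
  rewrite !sg//.
  by rewrite mulrACA -expr2 sqrr_sign mul1r.
have sm : `|m k0| / (2 * n%:R) <= \sum_l udir x l * m l.
  rewrite (bigD1 k0)//= um [leLHS]mulrC -[leLHS]addr0 lerD//.
    by rewrite ler_wpM2r.
  by apply: sumr_ge0 => l _; rewrite um mulr_ge0.
have sG : `|m k0| / (4 * n%:R) <= `|\sum_l udir x l * G l|.
  apply: le_trans (ler_norm _).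
  have -> : \sum_l udir x l * G l = \sum_l udir x l * m l + \sum_l udir x l * (G l - m l).
    by rewrite -big_split/=; apply: eq_bigr => l _; ring.
  have : `|\sum_l udir x l * (G l - m l)| <= `|m k0| / (4 * n%:R).
    apply: le_trans Gm; apply: le_trans (ler_norm_sum _ _ _) _; apply: ler_sum => l _.
    by rewrite normrM -[leRHS]mul1r ler_pM ?normr_udir_le1.
  rewrite ler_norml => /andP[h _].
  have -> : `|m k0| / (4 * n%:R) = `|m k0| / (2 * n%:R) - `|m k0| / (4 * n%:R).
    by field; rewrite gt_eqF.
  by rewrite lerD.
rewrite normrM (_ : _ / _ = (2 * n%:R)^-1 * (`|m k0| / (4 * n%:R))); last first.
  by field; rewrite gt_eqF.
by rewrite ler_pM// ?invr_ge0 ?divr_ge0 ?mulr_ge0 ?(ltW n0).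
Qed.

Lemma enormZ s x : 0 <= s -> enorm (s *: x) = s * enorm x.
Proof.
move=> s0; apply/eqP; rewrite -(@eqrXn2 _ 2)// ?enorm_ge0 ?mulr_ge0 ?enorm_ge0//.
rewrite exprMn !sqr_enorm; apply/eqP; rewrite /dotmx mulr_sumr.
by apply: eq_bigr => l _; rewrite !mxE; ring.
Qed.

Lemma udirZ s x l : 0 < s -> udir (s *: x) l = udir x l.
Proof.
move=> s0; rewrite /udir enormZ ?ltW// mxE.
have [->|e0] := eqVneq (enorm x) 0; first by rewrite mulr0 invr0 !mul0r.
by field; rewrite e0 gt_eqF.
Qed.

Lemma lprojB x (F G : 'I_n -> R) k : lproj x (fun l => F l - G l) k = lproj x F k - lproj x G k.
Proof.
rewrite /lproj -mulrBr; congr (_ * _); rewrite -sumrB.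
by apply: eq_bigr => l _; rewrite mulrBr.
Qed.

(** On the ray [s *: x] the direction is fixed and [enorm (s *: x)] cancels the denominators, so
    with [F1] frozen at [G1] and [s * enorm x * F0] at [r * G0] the signal has exactly two
    frequencies. The weights [3] and [a1^-1 + 2 / a2] of the freezing errors count [1] for [P] and
    [2] for [I - P]. The free [r] allows [f_0] to be kept, with [r = enorm x], or discarded, with
    [r = 0]. *)
Lemma oscillates_usol (a1 a2 t : R) x (F0 F1 : 'I_n -> V -> R) (G0 G1 : 'I_n -> R)
    (r : R) k (kap a e : R) :
  0 < a1 -> 0 < a2 -> 0 < enorm x -> 0 <= a ->
  32 / kap <= t * a1 * enorm x -> 32 / kap <= t * a2 * enorm x ->
  32 / kap <= t * `|a1 - a2| * enorm x -> 0 <= t ->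
  a <= `|r * lproj x G0 k| \/ a <= `|lproj x G1 k| / a1 ->
  (forall s, 1 <= s <= 1 + kap ->
    3 * (\sum_l `|s * enorm x * F0 l (s *: x) - r * G0 l|)
    + (a1^-1 + 2 / a2) * (\sum_l `|F1 l (s *: x) - G1 l|) <= e) ->
  oscillates kap a e (fun s => enorm (s *: x) *
    usol a1 a2 t (s *: x) (F0 ^~ (s *: x)) (F1 ^~ (s *: x)) k).
Proof.
move=> a10 a20 x0 a0 T1 T2 T12 t0 amp err.
exists (r * lproj x G0 k), (lproj x G1 k / a1), (r * (G0 k - lproj x G0 k)),
  ((G1 k - lproj x G1 k) / a2), (t * a1 * enorm x), (t * a2 * enorm x); split.
- by split=> //; rewrite -mulrBl -mulrBr normrM (normrM t) (ger0_norm t0) (gtr0_norm x0).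
- have sq (y : R) : a <= `|y| -> a ^+ 2 <= y ^+ 2.
    by move=> ay; rewrite -[leRHS]real_normK ?num_real// lerXn2r ?nnegrE.
  set p0 := r * _; set p1 := _ / a1; set q0 := r * _; set q1 := _ / a2.
  have := sqr_ge0 p0; have := sqr_ge0 p1; have := sqr_ge0 q0; have := sqr_ge0 q1.
  case: amp => [/sq|h]; rewrite -?/p0; first by lra.
  have : a <= `|p1| by rewrite /p1 normrM normfV (gtr0_norm a10).
  by move=> /sq; lra.
move=> s s1; apply: le_trans (err s s1).
have s0 : 0 < s by case/andP: s1 => s1 _; exact: lt_le_trans s1.
pose H0 l := s * enorm x * F0 l (s *: x) - r * G0 l.
pose H1 l := F1 l (s *: x) - G1 l.
have lpZ (F : 'I_n -> R) : lproj (s *: x) F k = lproj x F k.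
  by rewrite /lproj udirZ//; congr (_ * _); apply: eq_bigr => l _; rewrite udirZ.
have -> : enorm (s *: x) * usol a1 a2 t (s *: x) (F0 ^~ (s *: x)) (F1 ^~ (s *: x)) k -
   (r * lproj x G0 k * cos (t * a1 * enorm x * s) + lproj x G1 k / a1 * sin (t * a1 * enorm x * s)
    + r * (G0 k - lproj x G0 k) * cos (t * a2 * enorm x * s)
    + (G1 k - lproj x G1 k) / a2 * sin (t * a2 * enorm x * s)) =
   cos (t * a1 * enorm x * s) * lproj x H0 k + sin (t * a1 * enorm x * s) * (a1^-1 * lproj x H1 k)
   + cos (t * a2 * enorm x * s) * (H0 k - lproj x H0 k)
   + sin (t * a2 * enorm x * s) * (a2^-1 * (H1 k - lproj x H1 k)).
  rewrite /H0 /H1 !lprojB !lprojZ /usol /wave_mult !lpZ enormZ ?ltW//.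
  rewrite (_ : t * a1 * (s * enorm x) = t * a1 * enorm x * s); last by ring.
  rewrite (_ : t * a2 * (s * enorm x) = t * a2 * enorm x * s); last by ring.
  by field; rewrite !gt_eqF.
have cb (y z w : R) : `|y| <= 1 -> `|z| <= w -> `|y * z| <= w.
  by move=> y1 zw; rewrite normrM -[leRHS]mul1r ler_pM.
have L0 := normr_lproj_le x H0 k; have L1 := normr_lproj_le x H1 k.
set S0 := \sum_l `|H0 l| in L0; set S1 := \sum_l `|H1 l| in L1.
rewrite -[\sum_l `|s * _ * _ - _|]/S0 -[\sum_l `|F1 _ _ - _|]/S1.
have B0 : `|H0 k - lproj x H0 k| <= 2 * S0.
  apply: le_trans (ler_normB _ _) _.
  have : `|H0 k| <= S0 by rewrite /S0 (bigD1 k)//= lerDl sumr_ge0.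
  by lra.
have B1 : `|H1 k - lproj x H1 k| <= 2 * S1.
  apply: le_trans (ler_normB _ _) _.
  have : `|H1 k| <= S1 by rewrite /S1 (bigD1 k)//= lerDl sumr_ge0.
  by lra.
have A1 : `|a1^-1 * lproj x H1 k| <= a1^-1 * S1.
  by rewrite normrM normfV (gtr0_norm a10) ler_wpM2l// invr_ge0 ltW.
have A2 : `|a2^-1 * (H1 k - lproj x H1 k)| <= a2^-1 * (2 * S1).
  by rewrite normrM normfV (gtr0_norm a20) ler_wpM2l// invr_ge0 ltW.
rewrite (_ : 3 * S0 + _ = S0 + a1^-1 * S1 + 2 * S0 + a2^-1 * (2 * S1)); last by ring.
apply: le_trans (ler_normD _ _) _; apply: lerD; last exact: cb (normr_sin_le1 _) A2.
apply: le_trans (ler_normD _ _) _; apply: lerD; last exact: cb (normr_cos_le1 _) B0.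
apply: le_trans (ler_normD _ _) _; apply: lerD; last exact: cb (normr_sin_le1 _) A1.
exact: cb (normr_cos_le1 _) L0.
Qed.

(** The error [a / 4] leaves [a ^+ 2 / 8 - a ^+ 2 / 16] per unit of volume, and the inner box has
    volume [r ^+ n]. The weight [enorm x] is then removed through [enorm x <= 4 n r] on the larger
    box. *)
Lemma usol_obox_lower (a1 a2 t : R) (F0 F1 : 'I_n -> V -> R) b r k (kap a : R) :
  (forall l, measurable_fun setT (F0 l)) -> (forall l, measurable_fun setT (F1 l)) ->
  0 < r -> 0 < kap <= 1 -> 0 <= a ->
  (forall x, obox b r (2 * r) x -> oscillates kap a (a / 4) (fun s => enorm (s *: x) *
    usol a1 a2 t (s *: x) (F0 ^~ (s *: x)) (F1 ^~ (s *: x)) k)) ->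
  ((a ^+ 2 / 16 * r ^+ n / (4 * n%:R * r) ^+ 2)%:E <=
    \int[mu]_x (\1_(obox b r (4 * r)) x * usol a1 a2 t x (F0 ^~ x) (F1 ^~ x) k ^+ 2)%:E)%E.
Proof.
move=> m0 m1 r0 /andP[k0 k1] a0 osc.
have n0 : 0 < n%:R :> R by rewrite ltr0n (leq_trans _ (ltn_ord k)).
have mU := measurable_usol a1 a2 t k m0 m1.
have mv : measurable_fun setT (fun x => enorm x * usol a1 a2 t x (F0 ^~ x) (F1 ^~ x) k).
  by apply: measurable_funM => //; exact: measurable_enorm.
have ea : (a / 4) ^+ 2 <= a ^+ 2 / 8 by have := sqr_ge0 a; rewrite expr_div_n; lra.
have := @dilation_lower_bound R n _ (obox b r (2 * r)) (obox b r (4 * r)) kap a (a / 4)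
  mv (measurable_obox _ _ _) (measurable_obox _ _ _) k0 ea _ osc.
have H1 x s : obox b r (2 * r) x -> 1 <= s <= 1 + kap -> obox b r (4 * r) (s *: x).
  by move=> bx /andP[s1 s2]; apply: obox_scale => //; apply/andP; split=> //; lra.
move=> /(_ H1); rewrite rV_lebesgue_obox; last by lra.
rewrite -EFinM => lo.
have P0 : 0 < (4 * n%:R * r) ^+ 2 by rewrite exprn_gt0// !mulr_gt0.
have mo : measurable (obox b r (4 * r)) by exact: measurable_obox.
have mI : measurable_fun setT (fun x : V => \1_(obox b r (4 * r)) x *
    usol a1 a2 t x (F0 ^~ x) (F1 ^~ x) k ^+ 2).
  by apply: measurable_funM; [exact: measurable_indic|exact: measurable_funX].
rewrite -(@lee_pmul2l _ ((4 * n%:R * r) ^+ 2)%:E)// ?lte_fin// -EFinM.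
rewrite -ge0_integralZl//; last 3 first.
- exact/measurable_EFinP.
- by move=> x _; rewrite lee_fin mulr_ge0// sqr_ge0.
- by rewrite lee_fin ltW.
apply: (@le_trans _ _ _ _ _ (le_trans _ lo)).
  rewrite lee_fin [leLHS]mulrC divfK ?gt_eqF//.
  rewrite (_ : 2 * r - r = r); last by ring.
  rewrite ler_wpM2r//; first by rewrite exprn_ge0// ltW.
  by rewrite expr_div_n; have := sqr_ge0 a; lra.
apply: ge0_le_integral => //.
- by move=> x _; rewrite lee_fin mulr_ge0// sqr_ge0.
- apply/measurable_EFinP; apply: measurable_funM; first exact: measurable_indic.
  exact: measurable_funX.
- by apply: measurable_funeM; exact/measurable_EFinP.
move=> x _; rewrite -EFinM lee_fin indicE.
have [bx|bx] := boolP (x \in obox b r (4 * r)); last by rewrite !mul0r mulr0.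
rewrite !mul1r exprMn ler_wpM2r ?sqr_ge0//.
rewrite lerXn2r ?nnegrE ?enorm_ge0 ?mulr_ge0 ?(ltW r0)//.
rewrite (_ : 4 * n%:R * r = n%:R * (4 * r)); last by ring.
apply: enorm_le_box; first by rewrite mulr_ge0// ltW.
by move=> l; exact: (obox_normr l (set_mem bx)).2.
Qed.

End orthant_boxes.

(** * Lower bound in dimension two, over many scales *)

Section lower_bounds.
Context {R : realType} {n : nat}.
Local Notation V := 'rV[R]_n.
Local Notation mu := (@rV_lebesgue R n).
Implicit Types (f : 'I_n -> V -> R) (x : V).

(** Through this identity the moments control the real part of the solution at low frequencies, and
    the lower bounds need no more. *)
Lemma fcos0 (h : V -> R) : fcos h 0 = moment h.
Proof.
apply: eq_Rintegral => x _; rewrite /dotmx big1 ?cos0 ?mulr1// => i _.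
by rewrite mxE mulr0.
Qed.

Lemma fcos_family_uniform_continuous f (e : R) :
  (forall l, mu.-integrable setT (EFin \o f l)) -> 0 < e ->
  exists2 d, 0 < d & forall x x', (forall i, `|x ord0 i - x' ord0 i| <= d) ->
    \sum_l `|fcos (f l) x - fcos (f l) x'| <= e.
Proof.
move=> fi e0.
have en0 : 0 < e / n.+1%:R by rewrite divr_gt0.
have /choice[d dP] : forall l, exists d, 0 < d /\ forall x x',
    (forall i, `|x ord0 i - x' ord0 i| <= d) ->
    `|fcos (f l) x - fcos (f l) x'| <= e / n.+1%:R.
  by move=> l; have [d d0 dP] := fcos_uniform_continuous (fi l) en0; exists d.
have S0 : 0 <= \sum_l (d l)^-1.
  by apply: sumr_ge0 => l _; rewrite invr_ge0 ltW//; case: (dP l).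
(* A common radius below every [d l], positive even for an empty family. *)
exists ((\sum_l (d l)^-1 + 1)^-1); first by rewrite invr_gt0 ltr_wpDl.
move=> x x' xx'.
apply: (@le_trans _ _ (\sum_(l < n) e / n.+1%:R)).
  apply: ler_sum => l _; have [dl0 H] := dP l; apply: H => i.
  apply: le_trans (xx' i) _; rewrite invf_ple ?posrE ?ltr_wpDl//.
  rewrite (bigD1 l)//= -addrA lerDl addr_ge0//.
  by apply: sumr_ge0 => j _; rewrite invr_ge0 ltW//; case: (dP j).
rewrite sumr_const card_ord -[leLHS]mulr_natl mulrCA -[leRHS]mulr1 ler_pM2l//.
by rewrite ler_pdivrMr// mul1r ler_nat.
Qed.

Variables a1 a2 : R.
Hypotheses (a10 : 0 < a1) (a20 : 0 < a2) (a12 : a1 != a2).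

(** With this minimum, one lower bound on [t * speed_gap * r] makes both frequencies and their
    difference large. *)
Definition speed_gap : R := Num.min a1 (Num.min a2 `|a1 - a2|).

Lemma speed_gap_gt0 : 0 < speed_gap.
Proof. by rewrite !lt_min a10 a20 normr_gt0 subr_eq0 a12. Qed.

Lemma speed_gap_le : [/\ speed_gap <= a1, speed_gap <= a2 & speed_gap <= `|a1 - a2|].
Proof. by rewrite /speed_gap; split; rewrite !ge_min lexx ?orbT. Qed.

Lemma obox_enorm_gt0 b (r : R) x (k : 'I_n) : 0 < r -> obox b r (2 * r) x ->
  0 < enorm x /\ r <= enorm x.
Proof.
move=> r0 bx; have rx : r <= enorm x.
  exact: le_trans (obox_normr k bx).1 (coor_le_enorm _ _).
by split=> //; exact: lt_le_trans rx.
Qed.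


Definition neg_sign (m : 'I_n -> R) (l : 'I_n) : bool := m l < 0.

Lemma neg_signP m l : 0 <= (-1) ^+ (neg_sign m l) * m l.
Proof.
rewrite /neg_sign; case: ltP => ml; first by rewrite expr1 mulN1r oppr_ge0 ltW.
by rewrite expr0 mul1r.
Qed.

(** For [n = 2] the quotient [r ^+ n / (4 * n%:R * r) ^+ 2] does not depend on [r], so all
    admissible scales contribute the same multiple of the squared moment, with a constant fixed
    before the data; only the threshold for [t] depends on them. *)
Lemma usol_lower_dim2 : n = 2%N -> exists2 c : R, 0 < c &
  forall f0 f1 (k0 : 'I_n),
  (forall l, mu.-integrable setT (EFin \o f0 l)) ->
  (forall l, mu.-integrable setT (EFin \o f1 l)) ->
  moment (f1 k0) != 0 ->
  \forall t \near +oo, forall k, ((c * moment (f1 k0) ^+ 2 * ln (t + 2))%:E <=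
    \int[mu]_xi (usol a1 a2 t xi (fun l => fcos (f0 l) xi) (fun l => fcos (f1 l) xi) k ^+ 2)%:E)%E.
Proof.
move=> n2.
have n0 : 0 < n%:R :> R by rewrite n2.
have g0 := speed_gap_gt0; have [ga1 ga2 ga12] := speed_gap_le.
have l80 : 0 < ln (8 : R) by rewrite ln_gt0// ltr1n.
(* The factor [1 / (8 n^2)] of [lproj_obox_ge], divided by [a1] from the sine multiplier. *)
pose ca : R := (8 * n%:R ^+ 2 * a1)^-1.
have ca0 : 0 < ca by rewrite invr_gt0 !mulr_gt0// exprn_gt0.
pose c1 : R := ca ^+ 2 / 16 / (4 * n%:R) ^+ 2.
have c10 : 0 < c1 by apply: divr_gt0; [apply: divr_gt0 => //|]; rewrite exprn_gt0// mulr_gt0.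
exists (c1 / (4 * ln 8)); first by rewrite divr_gt0// mulr_gt0.
move=> f0 f1 k0 i0 i1 mk0.
pose m l := moment (f1 l); pose a := ca * `|m k0|.
have a0 : 0 < a by rewrite mulr_gt0// normr_gt0.
pose b := neg_sign m.
have m0 l := integrable_measurable_real (i0 l).
have m1 l := integrable_measurable_real (i1 l).
pose A : R := a1^-1 + 2 / a2.
have A0 : 0 < A by rewrite addr_gt0 ?invr_gt0 ?divr_gt0.
have e0 : 0 < a / (8 * A) by rewrite divr_gt0// mulr_gt0.
have [d d0 dP] := fcos_family_uniform_continuous i1 e0.
pose S0 := \sum_l \int[mu]_x `|f0 l x|.
have S00 : 0 <= S0 by apply: sumr_ge0 => l _; exact: Rintegral_ge0.
(* The first bound puts the box of half-side [4 * r] where the transform of [f1] is close to its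
   moments; the second makes the contribution of [f0], of size [|xi|], at most [a / 8]. Together the
   errors stay below [a / 4]. *)
pose del := Num.min (d / 4) (a / (8 * (12 * n%:R * S0 + 1))).
have q0 : 0 < 12 * n%:R * S0 + 1 by rewrite ltr_wpDl// !mulr_ge0.
have del0 : 0 < del.
  by rewrite lt_min; apply/andP; split; rewrite divr_gt0// mulr_gt0.
(* Each scale r that is small and satisfies t r >> 1 contributes the same amount. *)
have scale t r k : 0 <= t -> 0 < r -> r <= del -> 32 <= t * speed_gap * r ->
  ((c1 * m k0 ^+ 2)%:E <= \int[mu]_xi (\1_(obox b r (4 * r)) xi *
    usol a1 a2 t xi (fun l => fcos (f0 l) xi) (fun l => fcos (f1 l) xi) k ^+ 2)%:E)%E.
  move=> t0 r0 rd tr.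
  have := @usol_obox_lower R n a1 a2 t (fun l => fcos (f0 l)) (fun l => fcos (f1 l)) b r k 1 a
    (fun l => measurable_fcos (m0 l)) (fun l => measurable_fcos (m1 l)) r0.
  rewrite ltr01 lexx => /(_ isT (ltW a0)) H.
  apply: le_trans (H _).
    rewrite lee_fin le_eqVlt; apply/orP; left; apply/eqP.
    have -> : a ^+ 2 = ca ^+ 2 * m k0 ^+ 2 by rewrite exprMn real_normK ?num_real.
    have -> : r ^+ n = r ^+ 2 by rewrite n2.
    by rewrite /c1; field; rewrite !gt_eqF.
  move=> x bx; have [x0 rx] := obox_enorm_gt0 k r0 bx.
  have tl T : speed_gap <= T -> 32 / 1 <= t * T * enorm x.
    move=> gT; rewrite divr1; apply: (le_trans tr); rewrite -!mulrA ler_wpM2l//.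
    by rewrite ler_pM// ltW.
  apply: (@oscillates_usol R n a1 a2 t x (fun l => fcos (f0 l)) (fun l => fcos (f1 l))
    (fun=> 0) m 0 k 1 a (a / 4)) => //.
  - exact: ltW.
  - exact: tl.
  - exact: tl.
  - exact: tl.
  - right; rewrite ler_pdivlMr//.
    have := @lproj_obox_ge R n b r x m m k0 k r0 bx (neg_signP m).
    rewrite big1 => [/(_ _)|l _]; last by rewrite subrr normr0.
    have mn : 0 <= `|m k0| / (4 * n%:R) by rewrite divr_ge0.
    move=> /(_ mn); apply: le_trans.
    rewrite /a /ca le_eqVlt; apply/orP; left; apply/eqP.
    by field; rewrite !gt_eqF.
  move=> s /andP[s1 s2].
  have bsx : obox b r (4 * r) (s *: x).
    by apply: obox_scale => //; apply/andP; split=> //; lra.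
  have coor i : `|(s *: x) ord0 i| <= 4 * r by exact: (obox_normr i bsx).2.
  have e1 : \sum_l `|fcos (f1 l) (s *: x) - m l| <= a / (8 * A).
    under eq_bigr do rewrite /m -fcos0.
    apply: dP => i; rewrite [X in _ - X]mxE subr0 (le_trans (coor i))//.
    by rewrite -ler_pdivlMl// mulrC (le_trans rd)// ge_min lexx.
  have es : enorm (s *: x) <= n%:R * (4 * r).
    by apply: enorm_le_box => //; rewrite mulr_ge0// ltW.
  have e2 : \sum_l `|s * enorm x * fcos (f0 l) (s *: x) - 0 * 0| <= n%:R * (4 * r) * S0.
    rewrite mulr_sumr; apply: ler_sum => l _.
    rewrite mulr0 subr0 -enormZ ?(le_trans _ s1)// normrM (ger0_norm (enorm_ge0 _)).
    by rewrite ler_pM ?enorm_ge0// fcos_le.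
  have e3 : 12 * n%:R * S0 * r <= a / 8.
    have : r <= a / (8 * (12 * n%:R * S0 + 1)) by rewrite (le_trans rd)// ge_min lexx orbT.
    by rewrite ler_pdivlMr ?mulr_gt0//; lra.
  have e4 : A * \sum_l `|fcos (f1 l) (s *: x) - m l| <= a / 8.
    have := ler_wpM2l (ltW A0) e1; rewrite (_ : A * (a / (8 * A)) = a / 8)//.
    by field; rewrite gt_eqF.
  rewrite -/A; lra.
(* With [r j = del / 8 ^+ j], the condition [32 <= t * speed_gap * r j] reads [8 ^+ j <= t * w]. *)
pose w : R := (del * speed_gap / 32).
have w0 : 0 < w by rewrite divr_gt0// mulr_gt0.
near=> t => k.
have t62 : 62 <= t by near: t; by apply: nbhs_pinfty_ge; rewrite num_real.
have tw : 2 / w ^+ 2 <= t by near: t; by apply: nbhs_pinfty_ge; rewrite num_real.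
have t0 : 0 < t by lra.
(* The [2] in the denominator absorbs the constant [w]: it gives [(8 ^+ K) ^+ 2 <= t + 2], which is
   at most [(t * w) ^+ 2] once [t * w ^+ 2 >= 2]. The bound [62 <= t] makes [y >= 1], so that
   rounding down loses at most half. *)
pose y : R := ln (t + 2) / (2 * ln 8).
have y1 : 1 <= y.
  rewrite ler_pdivlMr ?mulr_gt0// mul1r.
  rewrite (_ : 2 * ln 8 = ln (64 : R)); last first.
    by rewrite (_ : 64 = 8 ^+ 2 :> R) ?lnXn// ?mulr_natl//; ring.
  by rewrite ler_ln ?posrE//; lra.
pose K := Num.truncn y.
have Ky : K%:R <= y by rewrite truncn_le// (le_trans _ y1).
have yK : y / 2 <= K%:R.
  have K1 : (1 : R) <= K%:R by rewrite ler1n truncn_gt0.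
  have := truncnS_gt y; rewrite -/K -natr1 => ?; lra.
have pow8 : (8 : R) ^+ K <= t * w.
  have tw0 : 0 <= t * w by rewrite ltW// mulr_gt0.
  rewrite -(@ler_pXn2r _ 2)// ?nnegrE ?exprn_ge0//.
  apply: (@le_trans _ _ (t + 2)).
    rewrite -[leRHS]lnK ?posrE; last by lra.
    rewrite -exprM -[leLHS]lnK ?posrE ?exprn_gt0// ler_expR.
    have -> : ln ((8 : R) ^+ (K * 2)) = K%:R * 2 * ln 8 by rewrite lnXn// -[LHS]mulr_natl natrM.
    have := Ky; rewrite ler_pdivlMr ?mulr_gt0//; lra.
  have h : 2 <= t * w ^+ 2 by move: tw; rewrite ler_pdivrMr ?exprn_gt0.
  have : t * 2 <= t * (t * w ^+ 2) by rewrite ler_pM2l.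
  by rewrite [(t * w) ^+ 2]exprMn; lra.
pose r j : R := del / 8 ^+ j.
have r0 j : 0 < r j by rewrite divr_gt0// exprn_gt0.
have rdel j : r j <= del.
  by rewrite ler_pdivrMr ?exprn_gt0// ler_peMr ?exprn_ege1 ?ler1n// ltW.
pose g xi := usol a1 a2 t xi (fun l => fcos (f0 l) xi) (fun l => fcos (f1 l) xi) k ^+ 2.
have gg0 xi : 0 <= g xi by exact: sqr_ge0.
have mg : measurable_fun setT g.
  apply: measurable_funX.
  exact: (measurable_usol a1 a2 t k (fun l => measurable_fcos (m0 l)) (fun l => measurable_fcos (m1 l))).
have mI j : measurable_fun setT (fun xi : V => \1_(obox b (r j) (4 * r j)) xi * g xi).
  by apply: measurable_funM => //; apply: measurable_indic; exact: measurable_obox.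
apply: (@le_trans _ _ (\sum_(j < K) (c1 * m k0 ^+ 2)%:E)%E).
  rewrite sumEFin lee_fin sumr_const card_ord -[leRHS]mulr_natl.
  have mk : 0 < c1 * m k0 ^+ 2 by rewrite mulr_gt0// exprn_even_gt0.
  rewrite (_ : c1 / _ * _ * _ = y / 2 * (c1 * m k0 ^+ 2)); first by rewrite ler_pM2r.
  by rewrite /y -/(m k0); field; rewrite gt_eqF.
apply: (@le_trans _ _ (\int[mu]_xi (\sum_(j < K) (\1_(obox b (r j) (4 * r j)) xi * g xi)%:E))%E).
  rewrite ge0_integral_sum//; last 2 first.
  - by move=> j; exact/measurable_EFinP.
  - by move=> j x _; rewrite lee_fin mulr_ge0.
  apply: lee_sum => j _; apply: (scale t (r j) k (ltW t0) (r0 j) (rdel j)).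
  have jK : (8 : R) ^+ j <= t * w.
    by apply: le_trans pow8; rewrite ler_eXn2l ?ltr1n// ltnW.
  rewrite /r mulrA ler_pdivlMr ?exprn_gt0//.
  have -> : t * speed_gap * del = 32 * (t * w) by rewrite /w; field.
  by rewrite ler_pM2l.
apply: ge0_le_integral => //.
- by move=> x _; apply: sume_ge0 => j _; rewrite lee_fin mulr_ge0.
- by apply: emeasurable_sum => j; exact/measurable_EFinP.
- exact/measurable_EFinP.
move=> x _; rewrite sumEFin lee_fin -mulr_suml ler_piMl//.
(* The box at scale [r j] reaches only up to [4 * r j], while consecutive scales differ by a factor
   [8]. *)
have disj (i j : nat) : (i < j)%N -> obox b (r i) (4 * r i) x -> ~ obox b (r j) (4 * r j) x.
  move=> ij bi bj.
  have h1 := (obox_normr k bi).1; have h2 := (obox_normr k bj).2 (r0 j).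
  have : r i <= 4 * r j by exact: le_trans h2.
  rewrite /r ler_pdivrMr ?exprn_gt0// -{1}[del]mulr1.
  rewrite (_ : 4 * (del / 8 ^+ j) * 8 ^+ i = del * (4 / 8 ^+ (j - i))); last first.
    rewrite -{1}(subnK (ltnW ij)) exprD; field.
    by rewrite !expf_neq0.
  rewrite ler_pM2l// ler_pdivlMr ?exprn_gt0// mul1r leNgt => /negP; apply.
  apply: (@lt_le_trans _ _ (8 ^+ 1)); first by rewrite expr1 ltr_nat.
  by rewrite ler_eXn2l ?ltr1n// subn_gt0.
have [[j bj]|nb] := pselect (exists j : 'I_K, obox b (r j) (4 * r j) x).
  rewrite (bigD1 j)//= big1 ?addr0 ?indicE; first by rewrite mem_set.
  move=> i ij; rewrite indicE memNset// => bi.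
  case: (ltngtP i j) => [h|h|h].
  - exact: disj h bi bj.
  - exact: disj h bj bi.
  - by move: ij; rewrite (val_inj h) eqxx.
rewrite big1// => i _; rewrite indicE memNset// => bi; apply: nb; by exists i.
Unshelve. all: by end_near. Qed.

End lower_bounds.

(** * Lower bound at one fixed scale *)

Section fixed_scale_lower_bound.
Context {R : realType} {n : nat}.
Local Notation V := 'rV[R]_n.
Local Notation mu := (@rV_lebesgue R n).
Variables a1 a2 : R.
Hypotheses (a10 : 0 < a1) (a20 : 0 < a2) (a12 : a1 != a2).

(** The nonzero moment may belong to [f 0], whose amplitude carries the factor [enorm x] and is not
    negligible here. Both data are therefore frozen at [x] itself on a box near the origin, and
    [kap] is taken small enough for their transforms and for [s * enorm x] to vary little. *)
Lemma usol_lower_fixed_scale (f : 'I_2 -> 'I_n -> V -> R) (j0 : 'I_2) (k0 : 'I_n) :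
  (forall j l, mu.-integrable setT (EFin \o f j l)) -> moment (f j0 k0) != 0 ->
  exists2 c : R, 0 < c & \forall t \near +oo, forall k, (c%:E <=
    \int[mu]_xi (usol a1 a2 t xi (fun l => fcos (f 0 l) xi) (fun l => fcos (f 1 l) xi) k ^+ 2)%:E)%E.
Proof.
move=> fi mk0; have g0 := speed_gap_gt0 a10 a20 a12; have [ga1 ga2 ga12] := speed_gap_le a1 a2.
have n0 : 0 < n%:R :> R by rewrite ltr0n (leq_trans _ (ltn_ord k0)).
have mf j l := integrable_measurable_real (fi j l).
pose m l := moment (f j0 l); pose b := neg_sign m.
have mk : 0 < `|m k0| by rewrite normr_gt0.
have e10 : 0 < `|m k0| / (4 * n%:R) by rewrite divr_gt0// mulr_gt0.
have [d1 d10 d1P] := fcos_family_uniform_continuous (fi j0) e10.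
pose r := d1 / 4; have r0 : 0 < r by rewrite divr_gt0.
pose L := `|m k0| / (8 * n%:R ^+ 2).
have L0 : 0 < L by rewrite divr_gt0// mulr_gt0// exprn_gt0.
(* The two entries are the amplitudes available when the nonzero moment belongs to [f 0] and to
   [f 1], respectively. *)
pose a := Num.min (r * L) (L / a1).
have a0 : 0 < a by rewrite lt_min mulr_gt0//= divr_gt0.
pose A : R := a1^-1 + 2 / a2.
have A0 : 0 < A by rewrite addr_gt0 ?invr_gt0 ?divr_gt0.
pose E : R := n%:R * (2 * r).
have E0 : 0 < E by rewrite !mulr_gt0.
have q0 : 0 < 8 * (6 * E + A) by rewrite mulr_gt0// addr_gt0// mulr_gt0.
have e20 : 0 < a / (8 * (6 * E + A)) by rewrite divr_gt0.
have [d2 d20 d2P] := fcos_family_uniform_continuous (fi 0) e20.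
have [d3 d30 d3P] := fcos_family_uniform_continuous (fi 1) e20.
pose S0 := \sum_l \int[mu]_x `|f 0 l x|.
have S00 : 0 <= S0 by apply: sumr_ge0 => l _; exact: Rintegral_ge0.
have q1 : 0 < 3 * E * S0 + 1 by rewrite ltr_wpDl// mulr_ge0// mulr_ge0// ltW.
(* Dilations up to [1 + kap] move each coordinate by at most [kap * (2 * r)], hence the bound by
   [d2] and [d3]; the last entry makes the variation of [s * enorm x] cost at most [a / 8]. The
   other [a / 8] comes from the transforms. *)
pose kap := Num.min 1 (Num.min (Num.min d2 d3 / (2 * r)) (a / (8 * (3 * E * S0 + 1)))).
have r20 : 0 < 2 * r by rewrite mulr_gt0.
have d230 : 0 < Num.min d2 d3 by rewrite lt_min d20.
have kap0 : 0 < kap.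
  rewrite lt_min ltr01 /= lt_min; apply/andP; split; rewrite divr_gt0//.
  by rewrite mulr_gt0.
have kap1 : kap <= 1 by rewrite ge_min lexx.
have kap2 : kap * (2 * r) <= Num.min d2 d3.
  by rewrite -ler_pdivlMr// /kap !ge_min lexx !orbT.
have kap3 : kap * (8 * (3 * E * S0 + 1)) <= a.
  by rewrite -ler_pdivlMr ?mulr_gt0// /kap !ge_min lexx !orbT.
exists (a ^+ 2 / 16 * r ^+ n / (4 * n%:R * r) ^+ 2).
  apply: divr_gt0; last by rewrite exprn_gt0// !mulr_gt0.
  by apply: mulr_gt0; [apply: divr_gt0 => //|]; rewrite exprn_gt0.
near=> t => k.
have t0 : 0 < t by near: t; apply: nbhs_pinfty_gt; rewrite num_real.
have tbig : 32 / kap / (speed_gap a1 a2 * r) <= t.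
  by near: t; apply: nbhs_pinfty_ge; rewrite num_real.
have tgr : 32 / kap <= t * speed_gap a1 a2 * r.
  by move: tbig; rewrite ler_pdivrMr ?mulr_gt0// mulrA.
have kap01 : 0 < kap <= 1 by apply/andP.
apply: le_trans (@usol_obox_lower R n a1 a2 t (fun l => fcos (f 0 l)) (fun l => fcos (f 1 l)) b r k kap a
    (fun l => measurable_fcos (mf 0 l)) (fun l => measurable_fcos (mf 1 l)) r0 kap01 (ltW a0) _) _;
  last first.
  apply: ge0_le_integral => //.
  - by move=> x _; rewrite lee_fin mulr_ge0// sqr_ge0.
  - apply/measurable_EFinP; apply: measurable_funM.
      by apply: measurable_indic; exact: measurable_obox.
    apply: measurable_funX.
    exact: (measurable_usol a1 a2 t k (fun l => measurable_fcos (mf 0 l)) (fun l => measurable_fcos (mf 1 l))).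
  - apply/measurable_EFinP; apply: measurable_funX.
    exact: (measurable_usol a1 a2 t k (fun l => measurable_fcos (mf 0 l)) (fun l => measurable_fcos (mf 1 l))).
  by move=> x _; rewrite lee_fin ler_piMl ?sqr_ge0// indicE; case: (_ \in _).
move=> x bx; have [x0 rx] := obox_enorm_gt0 k r0 bx.
have tl T : speed_gap a1 a2 <= T -> 32 / kap <= t * T * enorm x.
  move=> gT; apply: (le_trans tgr); rewrite -!mulrA ler_wpM2l ?(ltW t0)//.
  by rewrite ler_pM// ltW.
have coor i : `|x ord0 i| <= 2 * r by exact: (obox_normr i bx).2.
have xE : enorm x <= E by apply: enorm_le_box => //; exact: ltW.
have Lx : L <= `|lproj x (fun l => fcos (f j0 l) x) k|.
  apply: (@lproj_obox_ge R n b r x m _ k0 k r0 bx (neg_signP m)).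
  under eq_bigr do rewrite /m -fcos0.
  apply: d1P => i; rewrite [X in _ - X]mxE subr0 (le_trans (coor i))//.
  by rewrite /r; have := d10; lra.
apply: (@oscillates_usol R n a1 a2 t x (fun l => fcos (f 0 l)) (fun l => fcos (f 1 l))
    (fun l => fcos (f 0 l) x) (fun l => fcos (f 1 l) x) (enorm x) k kap a (a / 4)) => //.
- exact: ltW.
- exact: tl.
- exact: tl.
- exact: tl.
- have [j00|j01] : j0 = 0 \/ j0 = 1.
    case: (unliftP 0 j0) => [i|] ->; last by left.
    by right; rewrite (ord1 i); exact: val_inj.
  + left; rewrite j00 in Lx; apply: (@le_trans _ _ (r * L)); first by rewrite ge_min lexx.
    by rewrite normrM (gtr0_norm x0) ler_pM// ltW.
  + right; rewrite j01 in Lx; apply: (@le_trans _ _ (L / a1)); first by rewrite ge_min lexx orbT.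
    by rewrite ler_pM2r// invr_gt0.
move=> s /andP[s1 s2].
have near_x i : `|(s *: x) ord0 i - x ord0 i| <= Num.min d2 d3.
  apply: le_trans kap2; rewrite mxE -[X in _ - X]mul1r -mulrBl normrM.
  by rewrite ler_pM// ger0_norm ?subr_ge0//; lra.
have c0 : \sum_l `|fcos (f 0 l) (s *: x) - fcos (f 0 l) x| <= a / (8 * (6 * E + A)).
  by apply: d2P => i; apply: le_trans (near_x i) _; rewrite ge_min lexx.
have c1 : \sum_l `|fcos (f 1 l) (s *: x) - fcos (f 1 l) x| <= a / (8 * (6 * E + A)).
  by apply: d3P => i; apply: le_trans (near_x i) _; rewrite ge_min lexx orbT.
set e2 := a / _ in c0 c1 e20.
have e2E : e2 * (8 * (6 * E + A)) = a by rewrite divfK// gt_eqF.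
have d0 : \sum_l `|s * enorm x * fcos (f 0 l) (s *: x) - enorm x * fcos (f 0 l) x| <=
    2 * E * e2 + kap * E * S0.
  apply: (@le_trans _ _ (\sum_l (2 * E * `|fcos (f 0 l) (s *: x) - fcos (f 0 l) x|
      + kap * E * \int[mu]_x `|f 0 l x|))).
    apply: ler_sum => l _.
    have -> : s * enorm x * fcos (f 0 l) (s *: x) - enorm x * fcos (f 0 l) x =
      s * enorm x * (fcos (f 0 l) (s *: x) - fcos (f 0 l) x) + (s - 1) * enorm x * fcos (f 0 l) x.
      by ring.
    have s0 : 0 <= s by lra.
    have s10 : 0 <= s - 1 by lra.
    apply: le_trans (ler_normD _ _) _; apply: lerD; rewrite normrM.
      rewrite ler_wpM2r// normrM (ger0_norm s0) (gtr0_norm x0) ler_pM ?(ltW x0)//.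
      by lra.
    rewrite ler_pM//; last exact: fcos_le.
    by rewrite normrM (ger0_norm s10) (gtr0_norm x0) ler_pM ?(ltW x0)//; lra.
  rewrite big_split/= -!mulr_sumr lerD// ler_wpM2l//.
  by rewrite mulr_ge0// ltW.
have h1 : A * \sum_l `|fcos (f 1 l) (s *: x) - fcos (f 1 l) x| <= A * e2.
  by rewrite ler_wpM2l// ltW.
rewrite -/A.
apply: (@le_trans _ _ (3 * (2 * E * e2 + kap * E * S0) + A * e2)).
  by rewrite lerD// ler_wpM2l.
have : 3 * kap * E * S0 <= a / 8.
  by move: kap3 kap0; lra.
by move: e2E; lra.
Unshelve. all: by end_near. Qed.

End fixed_scale_lower_bound.

(** * From energies to norms, and the theorem *)

Section elastic_lower.
Context {R : realType} {n : nat}.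
Local Notation V := 'rV[R]_n.
Local Notation mu := (@rV_lebesgue R n).
Local Notation cst := (@fourier_cst R n).
Variables lambda mu0 : R.
Let a1 := Num.sqrt (lambda + 2 * mu0).
Let a2 := Num.sqrt mu0.

Lemma elastic_data_integrable (f : 'I_2 -> 'I_n -> V -> R) : elastic_data f ->
  forall j l, mu.-integrable setT (EFin \o f j l).
Proof.
move=> df j l; apply/Lfun1_integrable; have [_ h0 _ h1] := df l.
case: (unliftP 0 j) => [i|] ->//.
by rewrite (ord1 i) (_ : lift _ _ = 1)//; exact: val_inj.
Qed.

(** The energy is the sum of a cosine and a sine part; the sine part is nonnegative and is
    dropped. *)
Lemma elastic_norm_lower (f : 'I_2 -> 'I_n -> V -> R) u t k (q : R) :
  elastic_data f -> elastic_solution lambda mu0 f u -> 0 <= t -> 0 <= q ->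
  (q%:E <= \int[mu]_xi
     (usol a1 a2 t xi (fun l => fcos (f 0 l) xi) (fun l => fcos (f 1 l) xi) k ^+ 2)%:E)%E ->
  ((cst * Num.sqrt q)%:E <= 'N[mu]_2%:E[EFin \o u t k])%E.
Proof.
move=> df su t0 q0 qi.
have mf j l := integrable_measurable_real (elastic_data_integrable df j l).
have c0 := ltW (@fourier_cst_gt0 R n).
rewrite (elastic_norm_energy k su t0 mf).
apply: Lnorm2_ge; first by rewrite mulr_ge0// sqrtr_ge0.
rewrite exprMn sqr_sqrtr// EFinM.
apply: le_trans (lee_wpmul2l _ qi) _; first by rewrite lee_fin sqr_ge0.
have mC := measurable_usol a1 a2 t k (fun l => measurable_fcos (mf 0 l)) (fun l => measurable_fcos (mf 1 l)).
have mS := measurable_usol a1 a2 t k (fun l => measurable_fsin (mf 0 l)) (fun l => measurable_fsin (mf 1 l)).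
rewrite -ge0_integralZl//; last 3 first.
- by apply/measurable_EFinP; exact: measurable_funX.
- by move=> x _; rewrite lee_fin sqr_ge0.
- by rewrite lee_fin sqr_ge0.
apply: ge0_le_integral => //.
- by move=> x _; rewrite -EFinM lee_fin mulr_ge0 ?sqr_ge0.
- by apply: measurable_funeM; apply/measurable_EFinP; exact: measurable_funX.
- apply/measurable_EFinP; apply: measurable_funX; apply: measurable_funM => //.
  apply: (measurableT_comp measurable_sqrt).
  by apply: measurable_funD; exact: measurable_funX.
move=> x _; rewrite -EFinM lee_fin [leRHS]exprMn sqr_sqrtr ?addr_ge0 ?sqr_ge0//.
by rewrite ler_wpM2l ?sqr_ge0// lerDl sqr_ge0.
Qed.

Lemma elastic_norms_fin (f : 'I_2 -> 'I_n -> V -> R) : elastic_data f ->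
  exists x y z : R, [/\ [/\ 0 <= x, 0 <= y & 0 <= z], vec_Lnorm 2%:E (f 0%R) = x%:E,
    vec_Lnorm 1 (f 1%R) = y%:E & vec_Lnorm 2%:E (f 1%R) = z%:E].
Proof.
move=> df.
exists (\sum_l Num.sqrt (\int[mu]_x (f 0 l x ^+ 2))), (\sum_l \int[mu]_x `|f 1 l x|),
  (\sum_l Num.sqrt (\int[mu]_x (f 1 l x ^+ 2))); split.
- split; apply: sumr_ge0 => l _; rewrite ?sqrtr_ge0//; exact: Rintegral_ge0.
- by rewrite -sumEFin; apply: eq_bigr => l _; rewrite Lfun2_norm//; have [[]] := df l.
- by rewrite -sumEFin; apply: eq_bigr => l _; rewrite Lfun1_norm//; have [] := df l.
- by rewrite -sumEFin; apply: eq_bigr => l _; rewrite Lfun2_norm//; have [] := df l.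
Qed.

Lemma Lnorm_le_vec_Lnorm (p : \bar R) (g : 'I_n -> V -> R) k :
  ('N[mu]_p[EFin \o g k] <= vec_Lnorm p g)%E.
Proof.
by rewrite /vec_Lnorm (bigD1 k)//= leeDl// sume_ge0// => i _; exact: Lnorm_ge0.
Qed.

End elastic_lower.

Theorem corollary1p2 (R : realType) (n : nat) (lambda mu : R)
    (hn : (2 <= n)%N) (hlm : 0 < lambda + 2 * mu) (hmu : 0 < mu)
    (hne : lambda + mu != 0) :
  (n = 2%N ->
    exists c C : R, [/\ 0 < c, 0 < C &
      forall (f : 'I_2 -> 'I_n -> 'rV[R]_n -> R)
             (u : R -> 'I_n -> 'rV[R]_n -> R),
      elastic_data f -> elastic_solution lambda mu f u ->
      forall k0 : 'I_n, moment (f 1 k0) != 0 ->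
      \forall t \near +oo, forall j : 'I_n,
        [/\ ((c * `|moment (f 1 k0)| * Num.sqrt (ln (t + 2)))%:E
               <= 'N[rV_lebesgue n]_(2%:E)[EFin \o u t j])%E,
            ('N[rV_lebesgue n]_(2%:E)[EFin \o u t j] <= vec_Lnorm 2%:E (u t))%E &
            (vec_Lnorm 2%:E (u t)
               <= C%:E * (vec_Lnorm 2%:E (f 0%R)
                          + vec_Lnorm 1 (f 1%R) * (Num.sqrt (ln (t + 2)))%:E
                          + vec_Lnorm 2%:E (f 1%R)))%E]])
  /\
  ((3 <= n)%N ->
    exists C : R, 0 < C /\
      forall (f : 'I_2 -> 'I_n -> 'rV[R]_n -> R)
             (u : R -> 'I_n -> 'rV[R]_n -> R),
      elastic_data f -> elastic_solution lambda mu f u ->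
      forall (j0 : 'I_2) (k0 : 'I_n), moment (f j0 k0) != 0 ->
      exists c : R, 0 < c /\
      \forall t \near +oo, forall j : 'I_n,
        [/\ ((c * `|moment (f j0 k0)|)%:E
               <= 'N[rV_lebesgue n]_(2%:E)[EFin \o u t j])%E,
            ('N[rV_lebesgue n]_(2%:E)[EFin \o u t j] <= vec_Lnorm 2%:E (u t))%E &
            (vec_Lnorm 2%:E (u t)
               <= C%:E * (vec_Lnorm 2%:E (f 0%R) + vec_Lnorm 1 (f 1%R)
                          + vec_Lnorm 2%:E (f 1%R)))%E]).
Proof.
pose a1 := Num.sqrt (lambda + 2 * mu); pose a2 := Num.sqrt mu.
have a10 : 0 < a1 by rewrite sqrtr_gt0.
have a20 : 0 < a2 by rewrite sqrtr_gt0.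
(* The squares of the speeds differ by [lambda + mu]. *)
have a12 : a1 != a2.
  apply: contra hne => /eqP/(congr1 (fun x => x ^+ 2)).
  by rewrite !sqr_sqrtr ?ltW// => h; apply/eqP; lra.
have cst0 := @fourier_cst_gt0 R n.
have [C C0 upper] := @elastic_norm_upper R n lambda mu hlm hmu.
split=> [n2|n3].
  have [C1 C10 low1] := @integral_wave_mult_dim2 R n a1 n2 a10.
  have [C2 C20 low2] := @integral_wave_mult_dim2 R n a2 n2 a20.
  have [c c0 lower] := usol_lower_dim2 a10 a20 a12 n2.
  pose C' := C1 + C2; have C'0 : 0 < C' by rewrite addr_gt0.
  have s0 : 0 <= Num.sqrt C' by exact: sqrtr_ge0.
  (* The upper bound is used with [K = C' * ln (t + 2)]; its square root puts [Num.sqrt C'] on the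
     [f 1] term only, and the [1] covers the other two. *)
  exists (@fourier_cst R n * Num.sqrt c), (C * (1 + Num.sqrt C')); split.
  - by rewrite mulr_gt0// sqrtr_gt0.
  - by rewrite mulr_gt0// ltr_wpDr.
  move=> f u df su k0 mk0; have fi := elastic_data_integrable df.
  have lo := lower _ _ _ (fi 0) (fi 1) mk0.
  near=> t => j.
  have t1 : 1 <= t by near: t; apply: nbhs_pinfty_ge; rewrite num_real.
  have t0 : 0 <= t by exact: le_trans t1.
  have ln0 : 0 <= ln (t + 2) by rewrite ln_ge0//; lra.
  have lot : ((c * moment (f 1 k0) ^+ 2 * ln (t + 2))%:E <=
    \int[@rV_lebesgue R n]_xi (usol a1 a2 t xi (fun l => fcos (f 0 l) xi)
       (fun l => fcos (f 1 l) xi) j ^+ 2)%:E)%E.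
    by move: j; near: t; exact: lo.
  split; [|exact: Lnorm_le_vec_Lnorm|].
    have q0 : 0 <= c * moment (f 1 k0) ^+ 2 * ln (t + 2).
      by rewrite mulr_ge0// mulr_ge0 ?sqr_ge0// ltW.
    have := elastic_norm_lower df su t0 q0 lot.
    rewrite sqrtrM; last by rewrite mulr_ge0 ?sqr_ge0// ltW.
    by rewrite sqrtrM ?(ltW c0)// sqrtr_sqr !mulrA.
  have K0 : 0 <= C' * ln (t + 2) by rewrite mulr_ge0// ltW.
  apply: (le_trans (upper f u t _ df su t0 K0 _ _)).
  - by apply: le_trans (low1 t t1) _; rewrite lee_fin ler_wpM2r// lerDl ltW.
  - by apply: le_trans (low2 t t1) _; rewrite lee_fin ler_wpM2r// lerDr ltW.
  have [x [y [z [[x0 y0 z0] -> -> ->]]]] := elastic_norms_fin df.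
  rewrite -!(EFinM y) -!EFinD -!EFinM lee_fin sqrtrM ?(ltW C'0)// -mulrA ler_pM2l//.
  have : 0 <= y * Num.sqrt (ln (t + 2)) by rewrite mulr_ge0// sqrtr_ge0.
  move: (Num.sqrt (ln _)) => s ys.
  have := mulr_ge0 s0 x0; have := mulr_ge0 s0 z0; lra.
have [C1 C10 low1] := @integral_wave_mult_dim3 R n a1 n3 a10.
have [C2 C20 low2] := @integral_wave_mult_dim3 R n a2 n3 a20.
pose C' := C1 + C2; have C'0 : 0 < C' by rewrite addr_gt0.
have s0 : 0 <= Num.sqrt C' by exact: sqrtr_ge0.
exists (C * (1 + Num.sqrt C')); split; first by rewrite mulr_gt0// ltr_wpDr.
move=> f u df su j0 k0 mk0; have fi := elastic_data_integrable df.
have [c c0 lo] := usol_lower_fixed_scale a10 a20 a12 fi mk0.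
have m0 : 0 < `|moment (f j0 k0)| by rewrite normr_gt0.
(* The bound [c] is not proportional to the moment, so the moment is divided out; this is legitimate
   because the constant is chosen after the data. *)
exists (@fourier_cst R n * Num.sqrt c / `|moment (f j0 k0)|); split.
  by rewrite divr_gt0// mulr_gt0// sqrtr_gt0.
near=> t => j.
have t1 : 1 <= t by near: t; apply: nbhs_pinfty_ge; rewrite num_real.
have t0 : 0 <= t by exact: le_trans t1.
have lot : (c%:E <=
  \int[@rV_lebesgue R n]_xi (usol a1 a2 t xi (fun l => fcos (f 0 l) xi)
     (fun l => fcos (f 1 l) xi) j ^+ 2)%:E)%E.
  by move: j; near: t; exact: lo.
split; [|exact: Lnorm_le_vec_Lnorm|].
  by rewrite divfK ?gt_eqF//; exact: elastic_norm_lower df su t0 (ltW c0) lot.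
apply: (le_trans (upper f u t _ df su t0 (ltW C'0) _ _)).
- by apply: le_trans (low1 t t1) _; rewrite lee_fin lerDl ltW.
- by apply: le_trans (low2 t t1) _; rewrite lee_fin lerDr ltW.
have [x [y [z [[x0 y0 z0] -> -> ->]]]] := elastic_norms_fin df.
rewrite -!EFinD -!EFinM lee_fin -mulrA ler_pM2l//.
have := mulr_ge0 s0 x0; have := mulr_ge0 s0 y0; have := mulr_ge0 s0 z0; lra.
Unshelve. all: by end_near. Qed.
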